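(* Let $N_0\ge1$, $m=N_0$, $\alpha=2N_0+1$, and let $$v^{(0)}=Y_{10}+\sum_{i+j+|\mathbf{n}|\ge2,\ i+j\ge1}a^{(0)}_{ij\mathbf{n}}X_{ij}\mu^{\mathbf{n}}+\sum_{i+j+|\mathbf{n}|\ge2,\ i+j\ge1}b^{(0)}_{ij\mathbf{n}}Y_{ij}\mu^{\mathbf{n}}\in\mathscr{L}$$ be a parametric generic system associated with generalized Hopf singularity, of parametric dimension $N_0$. Then there exist a permutation $\sigma\in S_{N_0}$, a parameter solution $Y^P\in F^1\mathscr{P}^m$, a time solution $Y^T\in F^1\mathscr{R}$ and a state solution $Y^S\in F^1\mathscr{L}$ such that their associated near-identity maps, together with an invertible linear reparametrization, transform $v^{(0)}$ to an infinite level parametric normal form $$v^{(\infty)}=Y_{10}+\sum_{i=0}^{N_0-1}X_{(i+1)i}\mu_{\sigma(i+1)}+a^{(2N_0)}_{(N_0+1)N_0}X_{(N_0+1)N_0}+\sum_{r=0}^\infty\ \sum_{\mathbf{n}\in\mathbb{N}_0^{N_0},\,|\mathbf{n}|=r}b^{(2N_0+2rN_0+r)}_{(N_0+1)N_0\mathbf{n}}Y_{(N_0+1)N_0}\mu^{\mathbf{n}},$$ where the coefficients $a^{(2N_0)}_{(N_0+1)N_0}$, $b^{(2N_0+2rN_0+r)}_{(N_0+1)N_0\mathbf{n}}\in\mathbb{F}$ are uniquely expressed in terms of the coefficients of $v^{(0)}$.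
   Context: The field is $\mathbb{F}=\mathbb{R}$; $m\ge1$ (number of parameters $\mu=(\mu_1,\dots,\mu_m)$) and $\alpha\ge 1$ (weight) are integers. For $\mathbf{n}\in\mathbb{N}_0^m$, $\mu^{\mathbf{n}}=\prod\mu_i^{n_i}$ and $|\mathbf{n}|=\sum n_i$. On $\mathbb{C}^2$ with coordinates $(z,w)$ put $X_{jk}=(z^jw^k,\,w^jz^k)^T$, $Y_{jk}=(iz^jw^k,\,-iw^jz^k)^T$. State space. $\mathscr{L}$ is the space of formal series $aY_{10}+\sum \alpha_{jk\mathbf{n}}X_{jk}\mu^{\mathbf{n}}+\sum\beta_{jk\mathbf{n}}Y_{jk}\mu^{\mathbf{n}}$, with coefficients in $\mathbb{F}$, sums over $j+k\ge1$, $j+k+|\mathbf{n}|\ge2$. It is a Lie algebra under $[u,v]=u'v-v'u$ ($'$ = Jacobian in $(z,w)$), graded by $\delta(X_{jk}\mu^{\mathbf{n}})=\delta(Y_{jk}\mu^{\mathbf{n}})=j+k-1+\alpha|\mathbf{n}|$; $\mathscr{L}_k$ is the grade-$k$ part. Time space. $\mathscr{R}=\mathbb{F}[[Z_1,\mu]]$, $Z_k=z^kw^k$, graded by $\delta(Z_k\mu^{\mathbf{n}})=2k+\alpha|\mathbf{n}|$; it acts on $\mathscr{L}$ by $Z_i\mu^{\mathbf{a}}X_{jk}\mu^{\mathbf{b}}=X_{(i+j)(i+k)}\mu^{\mathbf{a}+\mathbf{b}}$, and likewise for $Y_{jk}$. Parameter space. $\mathscr{P}^m=\mathbb{F}[[\mu]]^m$,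 graded by $\delta(\mu^{\mathbf{n}}\mathbf{e}_k)=\alpha|\mathbf{n}|-\alpha$. For each graded space $V$, $F^kV$ is the set of formal sums of terms of grade $\ge k$. Infinite direct sums mean formal (infinite) sums. Transformations. For $Y^S\in F^1\mathscr{L}$: $\phi^S_{Y^S*}=\exp(\mathrm{ad}_{Y^S})$. For $Y^T\in F^1\mathscr{R}$: $\phi^T_{Y^T*}(v)=v+Y^Tv$. For $Y^P\in F^1\mathscr{P}^m$: $\phi^P_{Y^P*}(v)$ is obtained by substituting $\mu=\nu+Y^P(\nu)$ in $v$ (and renaming $\nu$ as $\mu$). These are the near-identity maps associated with state, time and parameter solutions; they are applied in composition. An invertible linear reparametrization substitutes $\mu=M\nu$ with $M\in GL_m(\mathbb{F})$. Let $A^0=F^1\mathscr{P}^m\times F^1\mathscr{R}\times F^1\mathscr{L}$ with the product filtration $F^nA^0$. Extended partial normal forms. For $v\in\mathscr{L}$, $Y=(Y^P,Y^T,Y^S)\in A^0$ let $d(v,Y)=D_\mu(v)Y^P+Y^Tv+[Y^S,v]$. Put $\tilde v^{(0)}=v$. For $r\ge1$, let $\mathscr{T}_n^{(r)}\subseteq\mathscr{L}_n$ be the projection to $\mathscr{L}_n$ of $F^n\mathscr{L}\cap d(\tilde v^{(r-1)},F^{\max(n-r+1,1)}A^0)$, let $\mathscr{N}_n^{(r)}$ be its unique complement in $\mathscr{L}_n$, and let the $r$th level extended partial parametric normal form $\tilde v^{(r)}$ be the image of $v$ under a composition $\phi^P_{Y^P*}\circ\phi^T_{Y^T*}\circ\phi^S_{Y^S*}$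 with $\tilde v^{(r)}\in\bigoplus_n\mathscr{N}_n^{(r)}$. (For $v=Y_{10}+\cdots$ as in the claim, $\mathscr{N}_n^{(1)}=\mathrm{span}\{X_{(k+1)k}\mu^{\mathbf{n}}: n=2k+\alpha|\mathbf{n}|\}$ for $n\ge1$.) Here the unique complement is defined by the formal basis style: the monomials of $\mathscr{L}$ are put in a fixed sequence $e_1,e_2,\dots$ in which lower grades come first and, within a grade, $Y$ terms precede $X$ terms and parameter-free terms precede terms with parameters; the unique complement of $W\subseteq\mathscr{L}_n$ is the span of $e_{n_1},e_{n_2},\dots$, where inductively $n_k$ is the least index (among basis elements of $\mathscr{L}_n$) with $e_{n_k}\notin W\oplus\mathrm{span}\{e_{n_i}:i<k\}$. Parametric dimension. $v$ has parametric dimension $N_0$ if for every natural number $r$ the coefficient of the (parameter-free) term $X_{(i+1)i}$ in $\tilde v^{(r)}$ is zero for all $i<N_0$ and the coefficient of $X_{(N_0+1)N_0}$ is nonzero. Parametric generic. Let $A^{(1)}$ be the $N_0\times m$ matrix whose rows are indexed by $k=0,\dots,N_0-1$, with $(k,j)$ entry the coefficient of $X_{(k+1)k}\mu_j$ in $\tilde v^{(1)}$ (the matrix of $D_\mu\tilde v^{(1)}$ at $\mu=\mathbf 0$ on $\mathrm{span}\{X_{(k+1)k}\}_{k=0}^{N_0-1}$). $v$ is parametric generic if $\mathrm{rank}\,A^{(1)}=N_0$. *)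

(* Defs.v *)
From HB Require Import structures.
From mathcomp Require Import all_boot all_order all_fingroup all_algebra.
From mathcomp Require Import functions reals.
From mathcomp Require Import complex.
From mathcomp Require Import mpoly.

Set Implicit Arguments.
Unset Strict Implicit.
Unset Printing Implicit Defensive.

Import Order.TTheory GRing.Theory Num.Theory.
Local Open Scope ring_scope.
Local Open Scope complex_scope.

(* Formal power series in mu_1, ..., mu_m over R, and in z, w, mu_1, ..., mu_m
   over R[i], are given by their coefficients.  They carry the pointwise additive
   structure of functions; beware that the pointwise ring product [*] on
   functions is not the product of series, which is [pmul], resp. [smul]. *)
Definition pseries (R : realType) (m : nat) := 'X_{1..m} -> R.
Definition zwseries (R : realType) (m : nat) := nat -> nat -> 'X_{1..m} -> R[i].

(* Formal vector fields on C^2. *)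
Definition vfield (R : realType) (m : nat) := (zwseries R m * zwseries R m)%type.

Section FormalSeries.
Variables (R : realType) (m : nat).
Implicit Types (n c : 'X_{1..m}) (p q : pseries R m) (f g : zwseries R m).
Implicit Types (u v : vfield R m).

Definition pone : pseries R m := fun n => (n == 0%MM)%:R.

Definition pmul p q : pseries R m := fun n =>
  \sum_(c : 'X_{1..m < (mdeg n).+1} | (c <= n)%MM) p c * q (n - c)%MM.

Definition smono (j k : nat) n : zwseries R m := fun j' k' n' =>
  [&& j' == j, k' == k & n' == n]%:R.

Definition sscale (a : R[i]) f : zwseries R m := fun j k n => a * f j k n.

Definition smul f g : zwseries R m := fun j k n =>
  \sum_(a < j.+1) \sum_(b < k.+1)
    \sum_(c : 'X_{1..m < (mdeg n).+1} | (c <= n)%MM)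
      f a b c * g (j - a)%N (k - b)%N (n - c)%MM.

Definition dz f : zwseries R m := fun j k n => f j.+1 k n *+ j.+1.
Definition dw f : zwseries R m := fun j k n => f j k.+1 n *+ k.+1.
Definition dmu (i : 'I_m) f : zwseries R m := fun j k n =>
  f j k (n + U_(i))%MM *+ (n i).+1.

Definition vscale (a : R) v : vfield R m :=
  (sscale a%:C v.1, sscale a%:C v.2).

Definition vmul f v : vfield R m := (smul f v.1, smul f v.2).

Definition jac u v : vfield R m :=
  (smul (dz u.1) v.1 + smul (dw u.1) v.2,
   smul (dz u.2) v.1 + smul (dw u.2) v.2).

Definition bracket u v : vfield R m := jac u v - jac v u.

(* X_jk mu^n and Y_jk mu^n *)
Definition Xmon (j k : nat) n : vfield R m := (smono j k n, smono k j n).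
Definition Ymon (j k : nat) n : vfield R m :=
  (sscale 'i%C (smono j k n), sscale (- 'i%C) (smono k j n)).

(* The formal sum of cX j k n X_jk mu^n + cY j k n Y_jk mu^n over all
   j, k, n: the monomial z^j w^k mu^n occurs in the first component of X_jk,
   Y_jk and in the second component of X_kj, Y_kj. *)
Definition XYseries (cX cY : nat -> nat -> 'X_{1..m} -> R) : vfield R m :=
  (fun j k n => cX j k n +i* cY j k n, fun j k n => cX k j n -i* cY k j n).

(* Coefficients of X_jk mu^n and Y_jk mu^n; they invert [XYseries]. *)
Definition X_coef v (j k : nat) n : R := complex.Re (v.1 j k n).
Definition Y_coef v (j k : nat) n : R := complex.Im (v.1 j k n).

Definition higher (j k : nat) n : bool :=
  (1 <= j + k)%N && (2 <= j + k + mdeg n)%N.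

Definition higher_part (c : nat -> nat -> 'X_{1..m} -> R) :
  nat -> nat -> 'X_{1..m} -> R :=
  fun j k n => if higher j k n then c j k n else 0.

Definition higher_series (cX cY : nat -> nat -> 'X_{1..m} -> R) : vfield R m :=
  XYseries (higher_part cX) (higher_part cY).

Definition state_space v : Prop :=
  exists (a : R) (cX cY : nat -> nat -> 'X_{1..m} -> R),
    v = vscale a (Ymon 1 0 0%MM) + higher_series cX cY.

(* Time space R[[Z_1, mu]]: t k n is the coefficient of Z_k mu^n, where
   Z_k = (z w)^k, so the action on vector fields is multiplication. *)
Definition time_space := nat -> 'X_{1..m} -> R.
Definition time_series (t : time_space) : zwseries R m := fun j k n =>
  if j == k then (t j n)%:C else 0.
Definition time_act (t : time_space) v : vfield R m := vmul (time_series t) v.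

Definition param_space := 'I_m -> pseries R m.
Definition param_series p : zwseries R m := fun j k n =>
  if (j == 0%N) && (k == 0%N) then (p n)%:C else 0.

(* exp (ad_y) v for y of positive grade: ad_y then raises the degree
   j + k - 1 + |n| by at least one, so the terms of index > j + k + |n| do not
   contribute to the coefficients of z^j w^k mu^n. *)
Definition exp_ad (y v : vfield R m) : vfield R m :=
  let term l := vscale (l`!%:R)^-1 (iter l (bracket y) v) in
  (fun j k n => \sum_(l < (j + k + mdeg n).+1) (term l).1 j k n,
   fun j k n => \sum_(l < (j + k + mdeg n).+1) (term l).2 j k n).

Definition time_map (t : time_space) v : vfield R m := v + time_act t v.

Definition pmonomial (phi : param_space) c : pseries R m :=
  \big[pmul/pone]_(i < m) iter (c i) (pmul (phi i)) pone.

(* Substitution of mu_i := phi i, for phi without constant term: phi^c then has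
   order at least |c|, so only |c| <= |n| contributes to mu^n. *)
Definition ssubst (phi : param_space) f : zwseries R m := fun j k n =>
  \sum_(c : 'X_{1..m < (mdeg n).+1}) f j k c * (pmonomial phi c n)%:C.
Definition vsubst (phi : param_space) v : vfield R m :=
  (ssubst phi v.1, ssubst phi v.2).

(* mu = nu + yP(nu) *)
Definition param_map (yP : param_space) v : vfield R m :=
  vsubst (fun i n => (n == U_(i)%MM)%:R + yP i n) v.

(* mu = M nu *)
Definition linear_reparam (M : 'M[R]_m) v : vfield R m :=
  vsubst (fun i n => \sum_(j < m) M i j * (n == U_(j)%MM)%:R) v.

Definition dmu_act (yP : param_space) v : vfield R m :=
  \sum_(i < m) (smul (dmu i v.1) (param_series (yP i)),
                smul (dmu i v.2) (param_series (yP i))).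

Definition dmap v (yP : param_space) (yT : time_space) (yS : vfield R m) :
  vfield R m :=
  dmu_act yP v + time_act yT v + bracket yS v.

Section Grading.
Variable alpha : nat.

(* Only meant for j + k >= 1, which holds for all terms of the state space. *)
Definition grade (j k : nat) n : nat := ((j + k).-1 + alpha * mdeg n)%N.

Definition state_filt (p : nat) v : Prop :=
  state_space v /\
  forall j k n, (grade j k n < p)%N -> X_coef v j k n = 0 /\ Y_coef v j k n = 0.

Definition time_filt (p : nat) (t : time_space) : Prop :=
  forall k n, (2 * k + alpha * mdeg n < p)%N -> t k n = 0.

(* The grade alpha |n| - alpha of mu^n e_i may be negative. *)
Definition param_filt (p : nat) (yP : param_space) : Prop :=
  forall i n, (alpha * mdeg n < p + alpha)%N -> yP i n = 0.

Definition filtA (p : nat) (yP : param_space) (yT : time_space)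
  (yS : vfield R m) : Prop :=
  [/\ param_filt p yP, time_filt p yT & state_filt p yS].

Definition near_identity_image v v' : Prop :=
  exists (yP : param_space) (yT : time_space) (yS : vfield R m),
    filtA 1 yP yT yS /\ v' = param_map yP (time_map yT (exp_ad yS v)).

Definition grade_part (p : nat) v : vfield R m :=
  (fun j k n => if grade j k n == p then v.1 j k n else 0,
   fun j k n => if grade j k n == p then v.2 j k n else 0).

(* The r-th level removable space, r >= 1, where v is the normal form of level
   r - 1; the truncated n + 1 - r is harmless inside the maximum. *)
Definition removable (r : nat) v (n : nat) (w : vfield R m) : Prop :=
  exists (yP : param_space) (yT : time_space) (yS : vfield R m),
    [/\ filtA (maxn (n.+1 - r) 1) yP yT yS,
        state_filt n (dmap v yP yT yS) &
        w = grade_part n (dmap v yP yT yS)].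

End Grading.
End FormalSeries.

Arguments smono {R m}.
Arguments Xmon {R m}.
Arguments Ymon {R m}.

Inductive monomial (m : nat) : Type :=
| MX of nat & nat & 'X_{1..m}
| MY of nat & nat & 'X_{1..m}.

Section FormalBasisStyle.
Variables (R : realType) (m alpha : nat).
Implicit Types (b : monomial m) (v : vfield R m).

Definition monomial_field b : vfield R m :=
  match b with MX j k n => Xmon j k n | MY j k n => Ymon j k n end.

Definition monomial_grade b : nat :=
  match b with MX j k n | MY j k n => grade alpha j k n end.

Definition is_X b : bool := if b is MX _ _ _ then true else false.

Definition has_param b : bool :=
  match b with MX _ _ n | MY _ _ n => n != 0%MM end.

Definition state_monomial b : bool :=
  match b with
  | MX j k n => higher j k n
  | MY j k n => higher j k n || [&& j == 1%N, k == 0%N & n == 0%MM]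
  end.

(* e enumerates (from index 0) the monomials of the state space. *)
Definition formal_basis_style (e : nat -> monomial m) : Prop :=
  [/\ injective e,
      forall b, state_monomial b <-> exists p, e p = b &
      forall p q, (p < q)%N ->
        (monomial_grade (e p) <= monomial_grade (e q))%N /\
        (monomial_grade (e p) = monomial_grade (e q) ->
          (is_X (e p) <= is_X (e q))%N /\
          (is_X (e p) = is_X (e q) -> (has_param (e p) <= has_param (e q))%N))].

Variable e : nat -> monomial m.

Definition in_span (s : seq nat) v : Prop :=
  exists c : nat -> R, v = \sum_(q <- s) vscale (c q) (monomial_field (e q)).

Definition in_sum_span (W : vfield R m -> Prop) (s : seq nat) v : Prop :=
  exists w u, [/\ W w, in_span s u & v = w + u].

Definition eligible (W : vfield R m -> Prop) (n : nat) (s : seq nat) (p : nat) :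
  Prop :=
  monomial_grade (e p) = n /\ ~ in_sum_span W s (monomial_field (e p)).

(* The initial segments n_1, ..., n_k of the greedily chosen indices. *)
Inductive pivots (W : vfield R m -> Prop) (n : nat) : seq nat -> Prop :=
| pivots_nil : pivots W n [::]
| pivots_rcons s p : pivots W n s ->
    eligible W n s p -> (forall q, eligible W n s q -> (p <= q)%N) ->
    pivots W n (rcons s p).

Definition unique_complement (W : vfield R m -> Prop) (n : nat) v : Prop :=
  exists2 s, pivots W n s & in_span s v.

(* vt r is an r-th level extended partial parametric normal form of v. *)
Definition extended_partial_normal_forms v (vt : nat -> vfield R m) : Prop :=
  vt 0%N = v /\
  forall r, (1 <= r)%N ->
    near_identity_image alpha v (vt r) /\
    forall n, unique_complement (removable alpha r (vt r.-1) n) n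
                (grade_part alpha n (vt r)).

Definition parametric_dimension (vt : nat -> vfield R m) (N0 : nat) : Prop :=
  forall r, (1 <= r)%N ->
    (forall i, (i < N0)%N -> X_coef (vt r) i.+1 i 0%MM = 0) /\
    X_coef (vt r) N0.+1 N0 0%MM <> 0.

Definition parametric_generic (vt : nat -> vfield R m) (N0 : nat) : Prop :=
  \rank (\matrix_(k < N0, j < m) X_coef (vt 1%N) k.+1 k U_(j)%MM) = N0.

End FormalBasisStyle.

Definition reduces_to (R : realType) (m alpha : nat) (v v' : vfield R m) : Prop :=
  exists (yP : param_space R m) (yT : time_space R m) (yS : vfield R m)
         (M : 'M[R]_m),
    [/\ filtA alpha 1 yP yT yS, M \in unitmx &
        v' = linear_reparam M (param_map yP (time_map yT (exp_ad yS v)))].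

Definition infinite_level_form (R : realType) (N0 : nat) (sigma : 'S_N0)
  (a : R) (b : 'X_{1..N0} -> R) : vfield R N0 :=
  Ymon 1 0 0%MM
  + \sum_(i < N0) Xmon i.+1 i U_(sigma i)%MM
  + vscale a (Xmon N0.+1 N0 0%MM)
  + XYseries (fun _ _ _ => 0)
      (fun j k n => if (j == N0.+1) && (k == N0) then b n else 0).

(* Main.v *)
Require Import Defs.
From HB Require Import structures.
From mathcomp Require Import all_boot all_order all_fingroup all_algebra.
From mathcomp Require Import functions reals boolp.
From mathcomp Require Import complex.
From mathcomp Require Import mpoly.
From mathcomp Require Import ring zify.

(** The field v^(0) is equivalent at the first level to an equivariant field
    z (P + i) with P a real series in s = zw and the parameters, since brackets
    with the rotation Y_10 remove all terms that do not commute with it and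
    rescalings of time remove the angular ones.  Among such fields the remaining
    freedom is a radial substitution z -> zH, w -> wH, a rescaling of time and a
    change of parameters.  With L = H^2 the substitution maps s to sL, and it
    produces the ratio p/q of radial and angular speed, with
    p = a s^N + sum_(i < N) chi_i s^i and q = 1 + b s^N, exactly if
    2 L p(sL) = P (2L + Eu L) q(sL), where Eu = 2 s d/ds.  Give the parameters the
    weight 2N + 1.  As P = a s^N up to higher weight with a <> 0, the linear part of
    this equation for the unknowns L, chi_i, b is diagonal: the coefficient of
    s^k mu^n determines that of mu^n in chi_k for k < N, and for k >= N that of
    s^(k - N) mu^n in L, multiplied by 2a (2N - k).  The latter factor vanishes for
    k = 2N; there b takes over.  So the coefficients of s^N in L are free, and
    once they are prescribed there is a unique solution ([core_exists],
    [core_unique]).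

    For existence ([core_conjugation], [first_level_reduces]) solve the equation
    and write the substitution by H, composed with the first level
    transformation, as the exponential of a state solution ([expd_surj]).  The
    linear parts of the chi_i in the parameters are obtained from the matrix
    A^(1) by triangular matrices ([core_linear]), so genericity allows to take the
    chi_i as new parameters: an invertible linear map followed by a change near
    the identity ([normal_reduces]).  The permutation is the identity.

    For uniqueness ([normal_unique]) compare two reductions of v^(0).  The
    conjugation K between the two forms commutes with the rotation
    ([equivariant]), hence K z = zH with H radial, now complex.  The modulus
    L = |H|^2 solves the equation of the second form for the field of the first
    one, whose angular speed is changed by p Im (Eu H / H) = p Eu beta.  The flow
    of the radial vector field of the first form for the time beta + c(mu) is a
    symmetry of its trajectories, and solves the same equation with the data
    chi, b of the first form ([flowL_core]); c can be chosen such that it has the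
    coefficients of s^N of L ([flowL_prescribe]).  As solutions are unique, the
    data agree, and since the chi_i are the parameters of the normal form up to the
    change of parameters, so do the parameter transformations and the coefficients.

    All this takes place in the commutative ring of formal series in z, w and mu.
    The fields of the state space are the real ones, z-component f and
    w-component the conjugate of f, and act on the ring as derivations; exp (ad y)
    is then conjugation by the automorphism exp y ([expd_exp_ad]). *)

Set Implicit Arguments.
Unset Strict Implicit.
Unset Printing Implicit Defensive.
Import Order.TTheory GRing.Theory Num.Theory.
Local Open Scope ring_scope.

(** * The ring of formal series in z, w and mu *)

Definition idx (m : nat) : Type := (nat * nat * 'X_{1..m})%type.
HB.instance Definition _ m := Equality.on (idx m).

Definition ixadd m (x y : idx m) : idx m :=
  ((x.1.1 + y.1.1)%N, (x.1.2 + y.1.2)%N, (x.2 + y.2)%MM).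

Lemma ixaddA m : associative (@ixadd m).
Proof. by move=> x y z; rewrite /ixadd /= !addnA addmA. Qed.

Lemma ixaddC m : commutative (@ixadd m).
Proof. by move=> x y; congr (_, _, _); rewrite ?(addnC x.1.1) ?(addnC x.1.2) // addmC. Qed.

(** Boxes are finite pieces of the index set; over a box that contains the target
    index, the infinite convolution sums become finite. *)
Definition box (m D : nat) : Type := ('I_D * 'I_D * 'X_{1..m < D})%type.
HB.instance Definition _ m D := Finite.on (box m D).

Definition ix m D (x : box m D) : idx m := (x.1.1 : nat, x.1.2 : nat, bmnm x.2).
Definition inbox m D (x : idx m) : bool :=
  [&& x.1.1 < D, x.1.2 < D & mdeg x.2 < D]%N.

Lemma inbox_ix m D (x : box m D) : inbox D (ix x).
Proof. by case: x => [[a b] c]; rewrite /inbox /= !ltn_ord bmdeg. Qed.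

Lemma ix_inj m D : injective (@ix m D).
Proof.
move=> [[a b] c] [[a' b'] c'] [] /val_inj -> /val_inj -> e.
by congr (_, _); apply/val_inj.
Qed.

Lemma inbox_ixP m D (g : idx m) : inbox D g -> exists x : box m D, ix x = g.
Proof.
case: g => [[a b] c] /and3P /= [ha hb hc].
by exists (Ordinal ha, Ordinal hb, BMultinom hc).
Qed.

Lemma bmnm_sum_delta (V : nmodType) m D (F : 'X_{1..m} -> V) g :
  \sum_(c : 'X_{1..m < D}) F (bmnm c) *+ (bmnm c == g) =
  F g *+ (mdeg g < D)%N.
Proof.
case: ltnP => h.
  rewrite (bigD1 (BMultinom h)) //= eqxx mulr1n big1 ?addr0 // => c.
  by rewrite bmeqP /= => /negbTE ->; rewrite mulr0n.
rewrite big1 // => c _; case: eqP => [e|]; rewrite ?mulr0n //.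
by have := bmdeg c; rewrite e ltnNge h.
Qed.

Lemma bmnm_sum_widen (V : nmodType) m D D' (F : 'X_{1..m} -> V) :
  (D <= D')%N -> (forall c, (D <= mdeg c)%N -> F c = 0) ->
  \sum_(c : 'X_{1..m < D'}) F (bmnm c) = \sum_(c : 'X_{1..m < D}) F (bmnm c).
Proof.
move=> hD hF.
transitivity (\sum_(c : 'X_{1..m < D'}) \sum_(d : 'X_{1..m < D})
    F (bmnm d) *+ (bmnm d == bmnm c)).
  apply: eq_bigr => c _; rewrite bmnm_sum_delta.
  by case: ltnP => // h; rewrite mulr0n hF.
rewrite exchange_big; apply: eq_bigr => d _ /=.
under eq_bigr do rewrite eq_sym.
by rewrite (bmnm_sum_delta D' (fun=> F d)) (leq_trans (bmdeg d)).
Qed.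

Section SumLemmas.
Variables (V : nmodType) (m : nat).

Lemma box_sum_delta D (F : idx m -> V) g :
  \sum_(x : box m D) F (ix x) *+ (ix x == g) = F g *+ inbox D g.
Proof.
case: (boolP (inbox D g)) => h.
  have [x0 hx0] := inbox_ixP h.
  rewrite (bigD1 x0) //= hx0 eqxx mulr1n big1 ?addr0 // => x.
  by rewrite -hx0 (inj_eq (@ix_inj _ _)) => /negbTE ->; rewrite mulr0n.
rewrite big1 // => x _; case: eqP => [e|]; rewrite ?mulr0n //.
by move: (inbox_ix x); rewrite e (negbTE h).
Qed.

Lemma box_sum D (F : idx m -> V) :
  \sum_(x : box m D) F (ix x) =
  \sum_(a < D) \sum_(b < D) \sum_(c : 'X_{1..m < D}) F (a : nat, b : nat, bmnm c).
Proof.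
rewrite (pair_bigA _ (fun (a b : 'I_D) => \sum_(c : 'X_{1..m < D}) F (a : nat, b : nat, bmnm c))) /=.
by rewrite (pair_bigA _ (fun (ab : 'I_D * 'I_D) (c : 'X_{1..m < D}) => F (ab.1 : nat, ab.2 : nat, bmnm c))).
Qed.

Lemma ord_sum_widen D D' (F : nat -> V) : (D <= D')%N ->
  (forall a, (D <= a)%N -> F a = 0) -> \sum_(a < D') F a = \sum_(a < D) F a.
Proof.
move=> h hF; rewrite -(big_mkord xpredT F) (big_cat_nat (leq0n D) h) /=.
rewrite big_mkord -[RHS]addr0; congr (_ + _).
by rewrite big_nat big1 // => i /andP[hi _]; exact: hF.
Qed.

Lemma box_sum_widen D D' (F : idx m -> V) : (D <= D')%N ->
  (forall x, ~~ inbox D x -> F x = 0) ->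
  \sum_(x : box m D') F (ix x) = \sum_(x : box m D) F (ix x).
Proof.
move=> h hF; rewrite !box_sum.
rewrite (ord_sum_widen (F := fun a => \sum_(b < D') \sum_(c : 'X_{1..m < D'}) F (a, b : nat, bmnm c)) h); last first.
  move=> a ha; rewrite big1 // => b _; rewrite big1 // => c _.
  by apply: hF; rewrite /inbox /= ltnNge ha.
apply: eq_bigr => a _.
rewrite (ord_sum_widen (F := fun b => \sum_(c : 'X_{1..m < D'}) F (a : nat, b, bmnm c)) h); last first.
  move=> b hb; rewrite big1 // => c _.
  by apply: hF; rewrite /inbox /= (ltnNge b) hb andbF.
apply: eq_bigr => b _.
apply: (bmnm_sum_widen (F := fun c => F (a : nat, b : nat, c))) => // c hc.
by apply: hF; rewrite /inbox /= (ltnNge (mdeg c)) hc !andbF.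
Qed.

End SumLemmas.

Definition co (R : realType) m (f : zwseries R m) (x : idx m) : R[i] :=
  f x.1.1 x.1.2 x.2.

Section SeriesRing.
Variables (R : realType) (m : nat).
Local Notation C := R[i].
Implicit Types (f g h : zwseries R m) (x y z : idx m).

Lemma co_inj f g : (forall x, co f x = co g x) -> f = g.
Proof.
by move=> h; apply/funext => j; apply/funext => k; apply/funext => n; exact: (h (j, k, n)).
Qed.

(** As a sum over pairs of indices, without subtraction of multi-indices, the
    product is visibly symmetric, and associativity is an exchange of sums. *)
Lemma smul_box f g D x : inbox D x ->
  co (smul f g) x = \sum_(a : box m D) \sum_(b : box m D)
     (co f (ix a) * co g (ix b)) *+ (ixadd (ix a) (ix b) == x).
Proof.
case: x => [[j k] n] hx; have /and3P[/= hj hk hn] := hx.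
pose le (a : idx m) := [&& (a.1.1 <= j)%N, (a.1.2 <= k)%N & (a.2 <= n)%MM].
pose G (a : idx m) := (co f a * co g ((j - a.1.1)%N, (k - a.1.2)%N, (n - a.2)%MM)) *+ le a.
transitivity (\sum_(a : box m D) G (ix a)); last first.
  apply: eq_bigr => a _; rewrite /G.
  rewrite -mulrnAr -[in LHS](_ : (le (ix a) && inbox D ((j - (ix a).1.1)%N, (k - (ix a).1.2)%N, (n - (ix a).2)%MM)) = le (ix a)); last first.
    by apply: andb_idr => _; rewrite /inbox /= !(leq_ltn_trans (leq_subr _ _)) //=
       (leq_ltn_trans (mdegB _ _)).
  rewrite -mulnb mulnC mulrnA -box_sum_delta -sumrMnl.
  rewrite mulr_sumr; apply: eq_bigr => b _.
  rewrite -mulrnA mulnb -mulrnAr; congr (_ * (_ *+ nat_of_bool _)).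
  move: (ix a) (ix b) => [[a1 a2] a3] [[b1 b2] b3]; rewrite /le /ixadd /=.
  apply/andP/eqP => [[/eqP[-> -> ->] /and3P[h1 h2 h3]]|[<- <- <-]].
    by rewrite !subnKC // -[in RHS](submK h3) addmC.
  by rewrite !addKn (addmC a3) addmK !leq_addr lem_addl eqxx.
rewrite box_sum /co /smul /=.
pose H a b c := G (a, b, c).
have HE a b c : (a < j.+1)%N -> (b < k.+1)%N -> (c <= n)%MM ->
    H a b c = f a b c * g (j - a)%N (k - b)%N (n - c)%MM.
  by rewrite !ltnS /H /G /le /= => -> -> ->.
rewrite [RHS](ord_sum_widen (F := fun a => \sum_(b < D) \sum_(c : 'X_{1..m < D}) H a b c) hj); last first.
  by move=> a ha; rewrite big1 // => b _; rewrite big1 // => c _; rewrite /H /G /le /= leqNgt ha.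
under [RHS]eq_bigr => a _.
  rewrite (ord_sum_widen (F := fun b => \sum_(c : 'X_{1..m < D}) H a b c) hk); last first.
    by move=> b hb; rewrite big1 // => c _; rewrite /H /G /le /= (leqNgt b) hb andbF.
  over.
apply: eq_bigr => a _ /=.
apply: eq_bigr => b _ /=.
transitivity (\sum_(c : 'X_{1..m < (mdeg n).+1}) H a b (bmnm c)); last first.
  symmetry; apply: (bmnm_sum_widen (F := H a b)) => // c hc.
  rewrite /H /G /le /=; case: (boolP (c <= n)%MM) => h; last by rewrite !andbF.
  by move: hc; rewrite ltnNge -(submK h) mdegD leq_addl.
rewrite big_mkcond /=; apply: eq_bigr => c _.
case: ifP => h; first by rewrite HE.
by rewrite /H /G /le /= h !andbF.
Qed.

Lemma inbox_exists x : exists D, inbox D x.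
Proof.
exists (maxn x.1.1 (maxn x.1.2 (mdeg x.2))).+1.
by rewrite /inbox !ltnS !leq_max !leqnn !orbT.
Qed.

Lemma smulC f g : smul f g = smul g f.
Proof.
apply: co_inj => x; have [D hx] := inbox_exists x.
rewrite !(smul_box _ _ hx) exchange_big; apply: eq_bigr => b _; apply: eq_bigr => a _.
by rewrite mulrC ixaddC.
Qed.

Lemma inbox_addr D x y : inbox D (ixadd x y) -> inbox D y.
Proof. by rewrite /inbox /ixadd /= mdegD; lia. Qed.

Lemma smul3_box f g h D x : inbox D x ->
  co (smul f (smul g h)) x =
  \sum_(a : box m D) \sum_(b : box m D) \sum_(c : box m D)
     (co f (ix a) * co g (ix b) * co h (ix c))
       *+ (ixadd (ix a) (ixadd (ix b) (ix c)) == x).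
Proof.
move=> hx; rewrite (smul_box _ _ hx); apply: eq_bigr => a _.
transitivity (\sum_(d : box m D) \sum_(b : box m D) \sum_(c : box m D)
   (co f (ix a) * co g (ix b) * co h (ix c))
     *+ (ixadd (ix a) (ix d) == x) *+ (ix d == ixadd (ix b) (ix c))).
  apply: eq_bigr => d _; rewrite (smul_box _ _ (inbox_ix d)).
  rewrite mulr_sumr -sumrMnl; apply: eq_bigr => b _.
  rewrite mulr_sumr -sumrMnl; apply: eq_bigr => c _.
  by rewrite mulrnAr mulrA mulrnAC (eq_sym (ix d)).
rewrite exchange_big; apply: eq_bigr => b _ /=.
rewrite exchange_big; apply: eq_bigr => c _ /=.
rewrite (box_sum_delta D (fun d => (co f (ix a) * co g (ix b) * co h (ix c))
     *+ (ixadd (ix a) d == x))).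
case: eqP => [e|_]; last by rewrite mul0rn.
by rewrite (@inbox_addr _ (ix a)) // e.
Qed.

Lemma smulA f g h : smul f (smul g h) = smul (smul f g) h.
Proof.
apply: co_inj => x; have [D hx] := inbox_exists x.
rewrite [in RHS]smulC !(smul3_box _ _ _ hx) [RHS]exchange_big /=.
apply: eq_bigr => a _; rewrite [RHS]exchange_big /=.
apply: eq_bigr => b _; apply: eq_bigr => c _.
by rewrite [in RHS]ixaddC -ixaddA [in RHS](mulrC (co h _)) [in RHS]mulrAC.
Qed.

Lemma smulDl f g h : smul (f + g) h = smul f h + smul g h.
Proof.
apply: co_inj => x; have [D hx] := inbox_exists x.
transitivity (co (smul f h) x + co (smul g h) x) => //.
rewrite (smul_box (f + g) h hx) (smul_box f h hx) (smul_box g h hx) -big_split /=.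
apply: eq_bigr => a _; rewrite -big_split; apply: eq_bigr => b _ /=.
by rewrite [co (f + g) _]/(co f _ + co g _) mulrDl mulrnDl.
Qed.

Lemma co_smono b x : co (smono b.1.1 b.1.2 b.2 : zwseries R m) x = (x == b)%:R.
Proof.
case: x b => [[j k] n] [[j' k'] n']; rewrite /co /smono /=.
by rewrite !xpair_eqE andbA.
Qed.

Lemma co_smono_mul D b f x : inbox D x ->
  co (smul (smono b.1.1 b.1.2 b.2) f) x =
  \sum_(a : box m D) co f (ix a) *+ (ixadd b (ix a) == x).
Proof.
move=> hx; rewrite (smul_box _ _ hx) exchange_big; apply: eq_bigr => a _ /=.
transitivity (\sum_(c : box m D) (co f (ix a) *+ (ixadd (ix c) (ix a) == x)) *+ (ix c == b)).
  by apply: eq_bigr => c _; rewrite co_smono mulr_natl -!mulrnA mulnC.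
rewrite (box_sum_delta D (fun c => (co f (ix a) *+ (ixadd c (ix a) == x)))).
case: eqP => [e|_]; last by rewrite mul0rn.
by rewrite (@inbox_addr _ (ix a)) // ixaddC e.
Qed.

Lemma ixadd_inj (b : idx m) : injective (ixadd b).
Proof.
move=> [[j k] n] [[j' k'] n'] e.
have /= /addnI -> := congr1 (fun y : idx m => y.1.1) e.
have /= /addnI -> := congr1 (fun y : idx m => y.1.2) e.
have /= := congr1 (fun y : idx m => (y.2 - b.2)%MM) e.
by rewrite ![(b.2 + _)%MM]addmC !addmK => ->.
Qed.

Lemma co_smono_mulE b f x :
  co (smul (smono b.1.1 b.1.2 b.2) f) (ixadd b x) = co f x.
Proof.
have [D hx] := inbox_exists (ixadd b x).
rewrite (co_smono_mul _ _ hx).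
under eq_bigr => a _ do rewrite (inj_eq (@ixadd_inj b)).
by rewrite box_sum_delta (inbox_addr hx).
Qed.

Lemma co_smono_mul0 b f x : (forall y, ixadd b y <> x) ->
  co (smul (smono b.1.1 b.1.2 b.2) f) x = 0.
Proof.
move=> h; have [D hx] := inbox_exists x.
rewrite (co_smono_mul _ _ hx) big1 // => a _.
by case: eqP => // e; case: (h _ e).
Qed.

Lemma smul1 f : smul (smono 0 0 0%MM) f = f.
Proof.
apply: co_inj => x; rewrite -[x in LHS](_ : ixadd (0%N, 0%N, 0%MM) x = x).
  exact: (co_smono_mulE (0%N, 0%N, 0%MM)).
by case: x => [[j k] n]; congr (_, _, _); rewrite add0m.
Qed.

Lemma smono0_neq0 : (smono 0 0 0%MM : zwseries R m) != 0.
Proof.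
apply/eqP => /(congr1 (fun f => co f (0%N, 0%N, 0%MM))).
rewrite (co_smono (0%N, 0%N, 0%MM)) eqxx => /eqP.
by rewrite -[co 0 _]/(0 : C) oner_eq0.
Qed.

End SeriesRing.

(** An alias, since functions already carry the pointwise product. *)
Definition ser (R : realType) (m : nat) : Type := zwseries R m.
HB.instance Definition _ R m := GRing.Zmodule.copy (ser R m) (zwseries R m).
HB.instance Definition _ R m := GRing.Zmodule_isComNzRing.Build (ser R m)
  (@smulA R m) (@smulC R m) (@smul1 R m) (@smulDl R m) (@smono0_neq0 R m).

(** * Weights, monomials and density *)

Section Weights.
Variables (R : realType) (m : nat).
Local Notation C := R[i].
Local Notation A := (ser R m).
Implicit Types (f g h : A) (x y : idx m) (a p q : nat).

(** The order of a monomial when parameters weigh [a]: the total degree for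
    [a = 1], which governs convergence, and for [a = alpha] the grade of the
    corresponding state term, raised by one. *)
Definition wt a x := (x.1.1 + x.1.2 + a * mdeg x.2)%N.

Lemma wtD a x y : wt a (ixadd x y) = (wt a x + wt a y)%N.
Proof. by rewrite /wt /= mdegD mulnDr; lia. Qed.

Lemma coD f g x : co (f + g) x = co f x + co g x. Proof. by []. Qed.
Lemma coN f x : co (- f) x = - co f x. Proof. by []. Qed.
Lemma coB f g x : co (f - g) x = co f x - co g x. Proof. by []. Qed.
Lemma co0 x : co (0 : A) x = 0. Proof. by []. Qed.

Lemma co_sum I r P (F : I -> A) x :
  co (\sum_(i <- r | P i) F i) x = \sum_(i <- r | P i) co (F i) x.
Proof. exact: (big_morph (fun f : A => co f x)). Qed.

Lemma coMn f k x : co (f *+ k) x = co f x *+ k.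
Proof. by elim: k => // k IH; rewrite !mulrS coD IH. Qed.

Lemma ser_eqP f g : (forall x, co f x = co g x) -> f = g.
Proof. exact: co_inj. Qed.

Lemma coM_eq0 f g x :
  (forall y z, ixadd y z = x -> co f y * co g z = 0) -> co (f * g) x = 0.
Proof.
move=> h; have [D hx] := inbox_exists x.
rewrite [LHS](smul_box f g hx) big1 // => y _; rewrite big1 // => z _.
by case: eqP => // e; rewrite h.
Qed.

Definition mono x : A := smono x.1.1 x.1.2 x.2.
Definition cst (c : C) : A := sscale c (1 : A).
Definition zz : A := smono 1 0 0%MM.
Definition ww : A := smono 0 1 0%MM.
Definition mu (i : 'I_m) : A := smono 0 0 U_(i)%MM.

Lemma co_mono x y : co (mono x) y = (y == x)%:R. Proof. exact: co_smono. Qed.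

Lemma coM_mono b f x : co (mono b * f) (ixadd b x) = co f x.
Proof. exact: co_smono_mulE. Qed.

Lemma coM_mono0 b f x : (forall y, ixadd b y <> x) -> co (mono b * f) x = 0.
Proof. exact: co_smono_mul0. Qed.

Lemma mono0 : mono (0%N, 0%N, 0%MM) = 1. Proof. by []. Qed.

Lemma co1 x : co (1 : A) x = (x == (0%N, 0%N, 0%MM))%:R.
Proof. by rewrite -mono0 co_mono. Qed.

Lemma monoD x y : mono (ixadd x y) = mono x * mono y.
Proof.
apply: ser_eqP => z; rewrite co_mono; case: (pselect (exists t, ixadd x t = z)).
  by case=> t <-; rewrite coM_mono co_mono (inj_eq (@ixadd_inj _ x)).
move=> h; rewrite coM_mono0; last by move=> t e; apply: h; exists t.
by case: eqP => // e; case: h; exists y.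
Qed.

Lemma coZ c f x : co (cst c * f) x = c * co f x.
Proof.
suff -> : cst c * f = sscale c f by [].
rewrite -[f in RHS]mul1r; apply: ser_eqP => y; have [D hy] := inbox_exists y.
rewrite [LHS](smul_box _ _ hy).
transitivity (c * co (1 * f) y) => //; rewrite [co (1 * f) y](smul_box _ _ hy).
rewrite mulr_sumr; apply: eq_bigr => u _; rewrite mulr_sumr; apply: eq_bigr => v _.
by rewrite mulrnAr mulrA.
Qed.

Lemma sscaleE c f : sscale c f = cst c * f.
Proof. by apply: ser_eqP => x; rewrite coZ. Qed.

Lemma co_cst c x : co (cst c) x = c * (x == (0%N, 0%N, 0%MM))%:R.
Proof. by rewrite -co1 -coZ mulr1. Qed.

Lemma cstB : {morph cst : c d / c - d}.
Proof. by move=> c d; apply: ser_eqP => x; rewrite coB !co_cst mulrBl. Qed.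
HB.instance Definition _ := GRing.isZmodMorphism.Build C A cst cstB.

Lemma cst_monoid : monoid_morphism cst.
Proof.
split; first by apply: ser_eqP => x; rewrite co_cst mul1r co1.
by move=> c d; apply: ser_eqP => x; rewrite coZ !co_cst mulrA.
Qed.
HB.instance Definition _ := GRing.isMonoidMorphism.Build C A cst cst_monoid.

Record flt a p f : Prop := Flt { flt_co :> forall x, (wt a x < p)%N -> co f x = 0 }.

Lemma flt_0 a f : flt a 0 f. Proof. by split. Qed.
Lemma flt0 a p : flt a p 0. Proof. by split. Qed.
Lemma fltW a p q f : (p <= q)%N -> flt a q f -> flt a p f.
Proof. by move=> h hf; split=> x hx; apply: hf; apply: leq_trans hx h. Qed.
Lemma flt_le a p q f : flt a q f -> (p <= q)%N -> flt a p f.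
Proof. by move=> h hpq; apply: fltW hpq h. Qed.
Lemma fltD a p f g : flt a p f -> flt a p g -> flt a p (f + g).
Proof. by move=> hf hg; split=> x hx; rewrite coD (flt_co hf) ?(flt_co hg) ?addr0. Qed.
Lemma fltN a p f : flt a p f -> flt a p (- f).
Proof. by move=> hf; split=> x hx; rewrite coN (flt_co hf) ?oppr0. Qed.
Lemma fltB a p f g : flt a p f -> flt a p g -> flt a p (f - g).
Proof. by move=> hf hg; apply: fltD => //; apply: fltN. Qed.
Lemma flt_sum a p I r (P : pred I) (F : I -> A) :
  (forall i, P i -> flt a p (F i)) -> flt a p (\sum_(i <- r | P i) F i).
Proof. by move=> h; elim/big_ind: _ => //; apply: fltD. Qed.
Lemma fltM a p q f g : flt a p f -> flt a q g -> flt a (p + q) (f * g).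
Proof.
move=> hf hg; split=> x hx; apply: coM_eq0 => y z e.
case: (ltnP (wt a y) p) => hy; first by rewrite (flt_co hf) ?mul0r.
by rewrite (flt_co hg) ?mulr0 //; move: hx; rewrite -e wtD; lia.
Qed.
Lemma fltMl a p f g : flt a p f -> flt a p (f * g).
Proof. by move=> hf; rewrite -[p]addn0; apply: fltM. Qed.
Lemma fltMr a p f g : flt a p g -> flt a p (f * g).
Proof. by rewrite mulrC; apply: fltMl. Qed.
Lemma fltX a p k f : flt a p f -> flt a (p * k) (f ^+ k).
Proof.
move=> hf; elim: k => [|k IH]; first by rewrite muln0.
by rewrite exprS mulnS; apply: fltM.
Qed.
Lemma flt_mono a x : flt a (wt a x) (mono x).
Proof.
by split=> y hy; rewrite co_mono; case: eqP => // e; move: hy; rewrite e ltnn.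
Qed.

Lemma flt_eq a f g : (forall p, flt a p (f - g)) -> f = g.
Proof.
move=> h; apply: ser_eqP => x; apply/eqP; rewrite -subr_eq0 -coB.
by rewrite (flt_co (h (wt a x).+1)).
Qed.

Definition trunc D f : A := \sum_(x : box m D) cst (co f (ix x)) * mono (ix x).

Lemma co_trunc D f x : co (trunc D f) x = co f x *+ inbox D x.
Proof.
rewrite co_sum -(box_sum_delta D (fun y => co f y)); apply: eq_bigr => y _.
by rewrite coZ co_mono mulr_natr eq_sym.
Qed.

Lemma flt_trunc D f : flt 1 D (f - trunc D f).
Proof.
split=> x hx; rewrite coB co_trunc.
have -> : inbox D x by move: hx; rewrite /wt /inbox mul1n => hx; apply/and3P; split; lia.
by rewrite mulr1n subrr.
Qed.

(** Linear maps that respect the order of series are continuous, hence determined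
    by their values on monomials. *)
Record oper (T : A -> A) : Prop := Oper {
  operD : forall f g, T (f + g) = T f + T g;
  operZ : forall c f, T (cst c * f) = cst c * T f;
  operF : forall p f, flt 1 p f -> flt 1 p (T f) }.

Lemma oper0 T : oper T -> T 0 = 0.
Proof.
move=> h; have e : (0 : A) = cst 0 * 0 by rewrite mulr0.
by rewrite {1}e (operZ h) rmorph0 mul0r.
Qed.

Lemma operN T f : oper T -> T (- f) = - T f.
Proof.
move=> h; apply/eqP; rewrite eq_sym -subr_eq0 -opprD oppr_eq0.
by rewrite -(operD h) subrr (oper0 h).
Qed.

Lemma operB T f g : oper T -> T (f - g) = T f - T g.
Proof. by move=> h; rewrite (operD h) (operN _ h). Qed.

Lemma oper_sum T I r P (F : I -> A) : oper T ->
  T (\sum_(i <- r | P i) F i) = \sum_(i <- r | P i) T (F i).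
Proof. by move=> h; apply: (big_morph T (operD h) (oper0 h)). Qed.

Lemma oper_trunc T D f : oper T ->
  T (trunc D f) = \sum_(x : box m D) cst (co f (ix x)) * T (mono (ix x)).
Proof. by move=> h; rewrite (oper_sum _ _ _ h); apply: eq_bigr => x _; rewrite (operZ h). Qed.

Lemma oper_ext T T' : oper T -> oper T' ->
  (forall x, T (mono x) = T' (mono x)) -> forall f, T f = T' f.
Proof.
move=> h h' e f; apply: (@flt_eq 1) => p.
have ht : T (trunc p f) = T' (trunc p f).
  by rewrite (oper_trunc _ _ h) (oper_trunc _ _ h'); apply: eq_bigr => x _; rewrite e.
have -> : T f - T' f = T (f - trunc p f) - T' (f - trunc p f).
  by rewrite (operB _ _ h) (operB _ _ h') ht opprB addrA addrNK.
by apply: fltB; [apply: (operF h)|apply: (operF h')]; apply: flt_trunc.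
Qed.

Lemma oper_id : oper id. Proof. by []. Qed.
Lemma oper_comp T T' : oper T -> oper T' -> oper (T \o T').
Proof.
move=> h h'; split => [f g|c f|p f hf] /=.
- by rewrite (operD h') (operD h).
- by rewrite (operZ h') (operZ h).
by apply: (operF h); apply: (operF h').
Qed.
Lemma oper_add T T' : oper T -> oper T' -> oper (fun f => T f + T' f).
Proof.
move=> h h'; split => [f g|c f|p f hf].
- by rewrite (operD h') (operD h) addrACA.
- by rewrite (operZ h') (operZ h) mulrDr.
by apply: fltD; [apply: (operF h)|apply: (operF h')].
Qed.
Lemma oper_mul T g : oper T -> oper (fun f => T f * g).
Proof.
move=> h; split => [f f'|c f|p f hf].
- by rewrite (operD h) mulrDl.
- by rewrite (operZ h) mulrA.
by apply: fltMl; apply: (operF h).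
Qed.
Lemma oper_opp T : oper T -> oper (fun f => - T f).
Proof.
move=> h; split => [f f'|c f|p f hf].
- by rewrite (operD h) opprD.
- by rewrite (operZ h) mulrN.
by apply: fltN; apply: (operF h).
Qed.

(** Monomials are products of the variables, so multiplicative identities need
    only be checked on the variables. *)
Lemma mono_par_ind (Q : A -> Prop) : Q 1 -> (forall f g, Q f -> Q g -> Q (f * g)) ->
  (forall i, Q (mu i)) -> forall n, Q (mono (0%N, 0%N, n)).
Proof.
move=> h1 hM hm n.
elim: {n}(mdeg n) {-2}n (erefl (mdeg n)) => [|d IH] n hn.
  by have /eqP -> : n == 0%MM by rewrite -mdeg_eq0 hn.
have /existsP [i hi] : [exists i, n i != 0%N].
  rewrite -negb_forall; apply/negP => /forallP h0.
  by move: hn; rewrite mdegE big1 // => i _; apply/eqP.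
have hle : (U_(i) <= n)%MM by rewrite lep1mP.
have -> : (0%N, 0%N, n) = ixadd (0%N, 0%N, U_(i)%MM) (0%N, 0%N, (n - U_(i))%MM).
  by rewrite /ixadd /= addmC submK.
rewrite monoD; apply: (hM); [exact: hm|apply: IH].
move: (mdegD (n - U_(i))%MM U_(i)%MM); rewrite submK // mdeg1 hn addn1.
by case=> <-.
Qed.

Lemma monoE j k n : mono (j, k, n) = zz ^+ j * ww ^+ k * mono (0%N, 0%N, n).
Proof.
have -> : (j, k, n) = ixadd (j, 0%N, 0%MM) (ixadd (0%N, k, 0%MM) (0%N, 0%N, n)).
  by rewrite /ixadd /= !addn0 !add0n !add0m.
rewrite !monoD mulrA; congr (_ * _ * _).
  elim: j => // j IH; rewrite exprS -IH -[zz]/(mono (1%N, 0%N, 0%MM)) -monoD.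
  by rewrite /ixadd /= add0m.
elim: k => // k IH; rewrite exprS -IH -[ww]/(mono (0%N, 1%N, 0%MM)) -monoD.
by rewrite /ixadd /= add0m.
Qed.

Lemma mono_ind (Q : A -> Prop) : Q 1 -> (forall f g, Q f -> Q g -> Q (f * g)) ->
  Q zz -> Q ww -> (forall i, Q (mu i)) -> forall x, Q (mono x).
Proof.
move=> h1 hM hz hw hm [[j k] n]; rewrite monoE.
apply: (hM); last exact: mono_par_ind.
apply: (hM); first by elim: j => // j IH; rewrite exprS; apply: (hM).
by elim: k => // k IH; rewrite exprS; apply: (hM).
Qed.

(** * Algebra endomorphisms and derivations *)

Record alg (T : A -> A) : Prop := Alg {
  algO :> oper T;
  alg1 : T 1 = 1;
  algM : forall f g, T (f * g) = T f * T g }.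

Lemma algX T f k : alg T -> T (f ^+ k) = T f ^+ k.
Proof.
by move=> h; elim: k => [|k IH]; rewrite ?(alg1 h) // !exprS (algM h) IH.
Qed.

Lemma alg_cst T c : alg T -> T (cst c) = cst c.
Proof. by move=> h; rewrite -[cst c]mulr1 (operZ h) (alg1 h). Qed.

Lemma alg_comp T T' : alg T -> alg T' -> alg (T \o T').
Proof.
move=> h h'; split=> [||f g] /=.
- exact: oper_comp (algO h) (algO h').
- by rewrite (alg1 h') (alg1 h).
by rewrite (algM h') (algM h).
Qed.

Lemma alg_ext T T' : alg T -> alg T' -> T zz = T' zz -> T ww = T' ww ->
  (forall i, T (mu i) = T' (mu i)) -> forall f, T f = T' f.
Proof.
move=> h h' hz hw hm; apply: oper_ext => [||x]; [exact: algO h|exact: algO h'|].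
apply: (mono_ind (Q := fun f => T f = T' f)) => //; first by rewrite (alg1 h) (alg1 h').
by move=> f g ef eg; rewrite (algM h) (algM h') ef eg.
Qed.

(** Derivations along an endomorphism: both sides of a conjugation identity
    [d (T f) = T (d' f)] are of this kind, so it suffices to compare them on the
    variables. *)
Record der (T d : A -> A) : Prop := Der {
  derO :> oper d;
  derM : forall f g, d (f * g) = d f * T g + T f * d g }.

Lemma der1 T d : alg T -> der T d -> d 1 = 0.
Proof.
move=> h h'; apply: (@addrI _ (d 1)); rewrite addr0.
by rewrite -[in RHS](mulr1 1) (derM h') (alg1 h) mulr1 mul1r.
Qed.

Lemma der_ext T d d' : alg T -> der T d -> der T d' -> d zz = d' zz -> d ww = d' ww ->
  (forall i, d (mu i) = d' (mu i)) -> forall f, d f = d' f.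
Proof.
move=> h hd hd' hz hw hm; apply: oper_ext => [||x]; [exact: derO hd | exact: derO hd' |].
apply: (mono_ind (Q := fun f => d f = d' f)) => //; first by rewrite !(der1 h).
by move=> f g ef eg; rewrite (derM hd) (derM hd') ef eg.
Qed.

Lemma alg_id : alg id. Proof. by []. Qed.

Lemma der_compl T d S : alg S -> der T d -> der (S \o T) (S \o d).
Proof.
move=> hS hd; split=> [|f g] /=; first exact: oper_comp (algO hS) (derO hd).
by rewrite (derM hd) (operD hS) !(algM hS).
Qed.

Lemma der_compr T d S : alg S -> der T d -> der (T \o S) (d \o S).
Proof.
move=> hS hd; split=> [|f g] /=; first exact: oper_comp (derO hd) (algO hS).
by rewrite (algM hS) (derM hd).
Qed.

Lemma der_scale T d g : der T d -> der T (fun f => d f * g).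
Proof.
move=> hd; split=> [|f f']; first exact: oper_mul (derO hd).
by rewrite (derM hd); ring.
Qed.

End Weights.
Arguments zz R m : clear implicits.
Arguments ww R m : clear implicits.

(** * Partial derivatives and vector fields *)

Section Derivations.
Variables (R : realType) (m : nat).
Local Notation C := R[i].
Local Notation A := (ser R m).
Implicit Types (f g h : A) (x y : idx m) (a p q : nat) (v : vfield R m).
Local Notation zz := (zz R m).
Local Notation ww := (ww R m).

Lemma ixadd_z j k (n : 'X_{1..m}) : ixadd (1%N, 0%N, 0%MM) (j, k, n) = (j.+1, k, n).
Proof. by rewrite /ixadd /= add0m. Qed.
Lemma ixadd_w j k (n : 'X_{1..m}) : ixadd (0%N, 1%N, 0%MM) (j, k, n) = (j, k.+1, n).
Proof. by rewrite /ixadd /= add0m. Qed.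

Lemma zz_inj f g : zz * f = zz * g -> f = g.
Proof.
move=> e; apply: ser_eqP => x; rewrite -(coM_mono (1%N, 0%N, 0%MM) f).
by rewrite -(coM_mono (1%N, 0%N, 0%MM) g); congr (co _ _).
Qed.
Lemma ww_inj f g : ww * f = ww * g -> f = g.
Proof.
move=> e; apply: ser_eqP => x; rewrite -(coM_mono (0%N, 1%N, 0%MM) f).
by rewrite -(coM_mono (0%N, 1%N, 0%MM) g); congr (co _ _).
Qed.

(** The operators z d/dz and w d/dw act diagonally on monomials, which makes the
    Leibniz rule for them immediate; [pz] and [pw] inherit it by cancellation. *)
Definition thz f : A := fun j k n => f j k n *+ j.
Definition thw f : A := fun j k n => f j k n *+ k.

Lemma co_thz f x : co (thz f) x = co f x *+ x.1.1. Proof. by []. Qed.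
Lemma co_thw f x : co (thw f) x = co f x *+ x.1.2. Proof. by []. Qed.

(** [dz] and [dw] at the type carrying the product of series. *)
Definition pz f : A := dz f.
Definition pw f : A := dw f.

Lemma co_pz f x : co (pz f) x = co f (x.1.1.+1, x.1.2, x.2) *+ x.1.1.+1.
Proof. by []. Qed.
Lemma co_pw f x : co (pw f) x = co f (x.1.1, x.1.2.+1, x.2) *+ x.1.2.+1.
Proof. by []. Qed.

Lemma zz_pz f : zz * pz f = thz f.
Proof.
apply: ser_eqP => -[[[|j] k] n].
  rewrite [LHS](@coM_mono0 _ _ (1%N, 0%N, 0%MM)) //.
by rewrite -ixadd_z [LHS](coM_mono (1%N, 0%N, 0%MM)) ixadd_z.
Qed.
Lemma ww_pw f : ww * pw f = thw f.
Proof.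
apply: ser_eqP => -[[j [|k]] n].
  rewrite [LHS](@coM_mono0 _ _ (0%N, 1%N, 0%MM)) //.
by rewrite -ixadd_w [LHS](coM_mono (0%N, 1%N, 0%MM)) ixadd_w.
Qed.

Lemma thzM f g : thz (f * g) = thz f * g + f * thz g.
Proof.
apply: ser_eqP => x; rewrite coD co_thz; have [D hx] := inbox_exists x.
rewrite -[co (f * g) x]/(co (smul f g) x) -[co (_ * g) x]/(co (smul _ g) x).
rewrite -[co (_ * thz g) x]/(co (smul f _) x) !(smul_box _ _ hx).
rewrite -sumrMnl -big_split; apply: eq_bigr => b _ /=.
rewrite -sumrMnl -big_split; apply: eq_bigr => c _ /=.
case: eqP => [<-|]; rewrite ?mulr0n ?addr0 ?mul0rn // !mulr1n !co_thz.
by rewrite mulrnAl mulrnAr -mulrnDr.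
Qed.
Lemma thwM f g : thw (f * g) = thw f * g + f * thw g.
Proof.
apply: ser_eqP => x; rewrite coD co_thw; have [D hx] := inbox_exists x.
rewrite -[co (f * g) x]/(co (smul f g) x) -[co (_ * g) x]/(co (smul _ g) x).
rewrite -[co (_ * thw g) x]/(co (smul f _) x) !(smul_box _ _ hx).
rewrite -sumrMnl -big_split; apply: eq_bigr => b _ /=.
rewrite -sumrMnl -big_split; apply: eq_bigr => c _ /=.
case: eqP => [<-|]; rewrite ?mulr0n ?addr0 ?mul0rn // !mulr1n !co_thw.
by rewrite mulrnAl mulrnAr -mulrnDr.
Qed.

Lemma pzM f g : pz (f * g) = pz f * g + f * pz g :> A.
Proof. by apply: zz_inj; rewrite zz_pz thzM -!zz_pz; ring. Qed.
Lemma pwM f g : pw (f * g) = pw f * g + f * pw g :> A.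
Proof. by apply: ww_inj; rewrite ww_pw thwM -!ww_pw; ring. Qed.

Lemma pzD f g : pz (f + g) = pz f + pz g :> A.
Proof. by apply: ser_eqP => x; rewrite [LHS]mulrnDl. Qed.
Lemma pwD f g : pw (f + g) = pw f + pw g :> A.
Proof. by apply: ser_eqP => x; rewrite [LHS]mulrnDl. Qed.

Lemma pz_cst c f : pz (cst c * f) = cst c * pz f.
Proof. by apply: ser_eqP => x; rewrite coZ !co_pz coZ mulrnAr. Qed.
Lemma pw_cst c f : pw (cst c * f) = cst c * pw f.
Proof. by apply: ser_eqP => x; rewrite coZ !co_pw coZ mulrnAr. Qed.

Lemma flt_pz a p f : flt a p.+1 f -> flt a p (pz f).
Proof.
by move=> h; split=> x hx; rewrite co_pz (flt_co h) ?mul0rn //.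
Qed.
Lemma flt_pw a p f : flt a p.+1 f -> flt a p (pw f).
Proof.
move=> h; split=> x hx; rewrite co_pw (flt_co h) ?mul0rn //.
by move: hx; rewrite /wt /= addnS.
Qed.

(** A field as a derivation; locked so that rewriting does not see a sum. *)
Fact vder_key : unit. Proof. exact: tt. Qed.
Definition vder v f : A := locked_with vder_key (pz f * (v.1 : A) + pw f * (v.2 : A)).

Lemma vderE v f : vder v f = pz f * (v.1 : A) + pw f * (v.2 : A).
Proof. exact: locked_withE. Qed.

Definition vflt a p v := flt a p v.1 /\ flt a p v.2.

Lemma flt_vder a p q v f : vflt a q.+1 v -> flt a p f -> flt a (p + q) (vder v f).
Proof.
case: p => [|p] [h1 h2] hf; rewrite vderE.
  by apply: (@fltW _ _ _ _ q.+1) => //; apply: fltD; apply: fltMr.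
by rewrite addSnnS; apply: fltD; apply: fltM => //; [apply: flt_pz|apply: flt_pw].
Qed.

Lemma vder_oper v : vflt 1 1 v -> oper (vder v).
Proof.
move=> hv; split=> [f g|c f|p f hf].
- by rewrite !vderE pzD pwD; ring.
- by rewrite !vderE pz_cst pw_cst; ring.
by rewrite -[p]addn0; apply: flt_vder.
Qed.

Lemma vderM v f g : vder v (f * g) = vder v f * g + f * vder v g.
Proof. by rewrite !vderE pzM pwM; ring. Qed.

Lemma vder_der v : vflt 1 1 v -> der id (vder v).
Proof. by move=> h; split; [exact: vder_oper|exact: vderM]. Qed.

Lemma thz_mono x : thz (mono R x) = mono R x *+ x.1.1.
Proof.
apply: ser_eqP => y; rewrite co_thz coMn co_mono.
by case: eqP => [->|] //; rewrite !mul0rn.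
Qed.
Lemma thw_mono x : thw (mono R x) = mono R x *+ x.1.2.
Proof.
apply: ser_eqP => y; rewrite co_thw coMn co_mono.
by case: eqP => [->|] //; rewrite !mul0rn.
Qed.

Lemma vder_zz v : vder v zz = v.1.
Proof.
have e1 : pz zz = 1 by apply: zz_inj; rewrite zz_pz (thz_mono (1%N, 0%N, 0%MM)) mulr1.
have e2 : pw zz = 0 by apply: ww_inj; rewrite ww_pw (thw_mono (1%N, 0%N, 0%MM)) mulr0.
by rewrite vderE e1 e2 mul1r mul0r addr0.
Qed.
Lemma vder_ww v : vder v ww = v.2.
Proof.
have e1 : pz ww = 0 by apply: zz_inj; rewrite zz_pz (thz_mono (0%N, 1%N, 0%MM)) mulr0.
have e2 : pw ww = 1 by apply: ww_inj; rewrite ww_pw (thw_mono (0%N, 1%N, 0%MM)) mulr1.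
by rewrite vderE e1 e2 mul1r mul0r add0r.
Qed.
Lemma vder_mu v i : vder v (mu R i) = 0.
Proof.
have e1 : pz (mu R i) = 0.
  by apply: zz_inj; rewrite zz_pz (thz_mono (0%N, 0%N, U_(i)%MM)) mulr0.
have e2 : pw (mu R i) = 0.
  by apply: ww_inj; rewrite ww_pw (thw_mono (0%N, 0%N, U_(i)%MM)) mulr0.
by rewrite vderE e1 e2 !mul0r addr0.
Qed.

Lemma thz_der : der id thz.
Proof.
split; last exact: thzM; split=> [f g|c f|p f hf].
- by apply: ser_eqP => x; rewrite coD !co_thz coD mulrnDl.
- by apply: ser_eqP => x; rewrite !coZ !co_thz coZ mulrnAr.
by split=> x hx; rewrite co_thz (flt_co hf) // mul0rn.
Qed.
Lemma thw_der : der id thw.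
Proof.
split; last exact: thwM; split=> [f g|c f|p f hf].
- by apply: ser_eqP => x; rewrite coD !co_thw coD mulrnDl.
- by apply: ser_eqP => x; rewrite !coZ !co_thw coZ mulrnAr.
by split=> x hx; rewrite co_thw (flt_co hf) // mul0rn.
Qed.

(** The real structure: the second component of a field is the image of the
    first one under [star]. *)
Definition star f : A := fun j k n => (f k j n)^*%C.

Definition swap x : idx m := (x.1.2, x.1.1, x.2).
Lemma co_star f x : co (star f) x = (co f (swap x))^*%C. Proof. by []. Qed.
Lemma swapK : involutive swap. Proof. by case=> [[]]. Qed.
Lemma wt_swap a x : wt a (swap x) = wt a x. Proof. by rewrite /wt /= (addnC x.1.2). Qed.

Lemma starD f g : star (f + g) = star f + star g.
Proof. by apply: ser_eqP => x; rewrite coD !co_star coD rmorphD. Qed.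
Lemma starN f : star (- f) = - star f.
Proof. by apply: ser_eqP => x; rewrite coN !co_star coN rmorphN. Qed.
Lemma starB f g : star (f - g) = star f - star g.
Proof. by rewrite starD starN. Qed.
Lemma star0 : star 0 = 0.
Proof. by apply: ser_eqP => x; rewrite co_star !co0 rmorph0. Qed.
Lemma starK : involutive star.
Proof. by move=> f; apply: ser_eqP => x; rewrite !co_star swapK conjcK. Qed.
Lemma starZ c f : star (cst c * f) = cst c^*%C * star f.
Proof. by apply: ser_eqP => x; rewrite co_star !coZ co_star rmorphM. Qed.
Lemma star_mono x : star (mono R x) = mono R (swap x).
Proof.
apply: ser_eqP => y; rewrite co_star !co_mono.
by rewrite -{1}(swapK x) (inj_eq (can_inj swapK)); case: eqP; rewrite ?rmorph1 ?rmorph0.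
Qed.
Lemma star1 : star 1 = 1. Proof. exact: (star_mono (0%N, 0%N, 0%MM)). Qed.
Lemma star_zz : star zz = ww. Proof. exact: (star_mono (1%N, 0%N, 0%MM)). Qed.
Lemma star_ww : star ww = zz. Proof. exact: (star_mono (0%N, 1%N, 0%MM)). Qed.
Lemma star_mu i : star (mu R i) = mu R i. Proof. exact: (star_mono (0%N, 0%N, U_(i)%MM)). Qed.
Lemma star_cst c : star (cst c) = cst c^*%C.
Proof. by rewrite -[cst c]mulr1 starZ star1 mulr1. Qed.

Lemma flt_star a p f : flt a p f -> flt a p (star f).
Proof. by move=> h; split=> x hx; rewrite co_star (flt_co h) ?rmorph0 // wt_swap. Qed.

Lemma starM f g : star (f * g) = star f * star g.
Proof.
apply: ser_eqP => x; rewrite co_star; have [D hx] := inbox_exists x.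
have hx' : inbox D (swap x) by move: hx; rewrite /inbox /= andbCA.
rewrite [in LHS](smul_box _ _ hx') [RHS](smul_box _ _ hx) rmorph_sum /=.
pose sw (b : box m D) : box m D := (b.1.2, b.1.1, b.2).
have swi : involutive sw by case=> [[]].
rewrite (reindex_inj (inv_inj swi)); apply: eq_bigr => b _ /=.
rewrite rmorph_sum /= (reindex_inj (inv_inj swi)); apply: eq_bigr => c _ /=.
rewrite rmorphMn rmorphM /=; congr (_ *+ nat_of_bool _).
by rewrite -(inj_eq (can_inj swapK)) swapK.
Qed.

Lemma starX f k : star (f ^+ k) = star f ^+ k.
Proof. by elim: k => [|k IH]; rewrite ?star1 // !exprS starM IH. Qed.

Lemma star_pz f : star (pz f) = pw (star f) :> A.
Proof. by apply: ser_eqP => x; rewrite co_star /pz /pw /dz /dw /co /star /= rmorphMn. Qed.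
Lemma star_pw f : star (pw f) = pz (star f) :> A.
Proof. by rewrite -[pz _]starK star_pz starK. Qed.

Definition fld f : vfield R m := (f, star f).

Lemma star_vder f g : star (vder (fld f) g) = vder (fld f) (star g).
Proof. by rewrite !vderE starD !starM star_pz star_pw /= starK addrC. Qed.

Lemma vflt_fld a p f : flt a p f -> vflt a p (fld f).
Proof. by move=> h; split=> //; apply: flt_star. Qed.

Lemma star_conj T : oper T -> oper (fun f => star (T (star f))).
Proof.
move=> h; split=> [f g|c f|p f hf].
- by rewrite starD (operD h) starD.
- by rewrite starZ (operZ h) starZ conjcK.
by apply: flt_star; apply: (operF h); apply: flt_star.
Qed.

Lemma star_alg T : alg T -> alg (fun f => star (T (star f))).
Proof.
move=> h; split=> [||f g]; first exact/star_conj/algO.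
  by rewrite star1 (alg1 h) star1.
by rewrite starM (algM h) starM.
Qed.

End Derivations.

(** * Infinite sums, flows and fixed points *)

Section Flows.
Variables (R : realType) (m : nat).
Local Notation C := R[i].
Local Notation A := (ser R m).
Implicit Types (f g h : A) (x y : idx m) (a p q : nat) (v : vfield R m).
Implicit Types (F G : nat -> A) (T X : A -> A) (D : nat).
Local Notation cst := (@cst R m).

(** The sum of a series of series whose orders tend to infinity, [F l] being of
    order at least [l]; only finitely many terms reach a given coefficient. *)
Definition osum F : A := fun j k n => \sum_(l < (j + k + mdeg n).+1) F l j k n.
Definition smb F := forall l, flt 1 l (F l).

Lemma co_osumE F x : co (osum F) x = \sum_(l < (wt 1 x).+1) co (F l) x.
Proof. by rewrite /wt mul1n. Qed.

Lemma co_osum D F x : smb F -> (wt 1 x < D)%N ->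
  co (osum F) x = \sum_(l < D) co (F l) x.
Proof.
move=> h hx; rewrite co_osumE.
by symmetry; apply: (ord_sum_widen (F := fun l => co (F l) x)) => // l; apply: h.
Qed.

Lemma flt_osum D F : smb F -> flt 1 D (osum F - \sum_(l < D) F l).
Proof. by move=> h; split=> x hx; rewrite coB co_sum (co_osum h hx) subrr. Qed.

Lemma eq_osum F G : (forall l, F l = G l) -> osum F = osum G.
Proof. by move=> e; congr osum; apply/funext. Qed.

Lemma smb_oper T F : oper T -> smb F -> smb (T \o F).
Proof. by move=> hT h l; apply: (operF hT). Qed.

Lemma oper_osum T F : oper T -> smb F -> T (osum F) = osum (T \o F).
Proof.
move=> hT h; apply: (@flt_eq _ _ 1) => p.
rewrite -(subrK (\sum_(l < p) F l) (osum F)) (operD hT) (oper_sum _ _ _ hT) -addrA.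
apply: fltD; first by apply: (operF hT); apply: flt_osum.
have := fltN (flt_osum p (smb_oper hT h)); by rewrite opprB.
Qed.

Lemma osumD F G : osum (fun l => F l + G l) = osum F + osum G.
Proof.
by apply: ser_eqP => x; rewrite coD !co_osumE -big_split.
Qed.

Lemma osum_recl F : smb F -> osum F = F 0 + osum (fun l => F l.+1).
Proof.
move=> h; apply: ser_eqP => x; rewrite coD (@co_osum (wt 1 x).+2) ?ltnS //; last first.
rewrite (@co_osum (wt 1 x).+1 (fun l => F l.+1)) //.
  by rewrite big_ord_recl.
by move=> l; apply: (@fltW _ _ _ _ l.+1).
Qed.

Lemma flt_osum_ge a p F : (forall l, flt a p (F l)) -> flt a p (osum F).
Proof.
move=> h; split=> x hx; rewrite co_osumE big1 // => l _.
exact: h.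
Qed.

Lemma triangle_sum (V : nmodType) D (c : nat -> nat -> V) :
  (forall l k, (D <= l + k)%N -> c l k = 0) ->
  \sum_(l < D) \sum_(k < D) c l k = \sum_(n < D) \sum_(k < n.+1) c (n - k)%N k.
Proof.
move=> h; rewrite exchange_big /=.
transitivity (\sum_(n < D) \sum_(k < D | (k < n.+1)%N) c (n - k)%N k); last first.
  apply: eq_bigr => n _.
  by rewrite (big_ord_widen D (fun k => c (n - k)%N k)) ?ltn_ord.
rewrite [RHS](exchange_big_dep xpredT) //=; apply: eq_bigr => k _.
transitivity (\sum_(k <= n < D) c (n - k)%N k); last first.
  rewrite -(big_mkord (fun n => k < n.+1)%N (fun n => c (n - k)%N k)).
  by rewrite (big_nat_widenl k 0) //; apply: eq_bigl => n; rewrite ltnS.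
rewrite -[X in \sum_(X <= _ < _) _]add0n big_addn big_mkord.
rewrite (@ord_sum_widen _ (D - k) D (fun l => c l k)) ?leq_subr //; last first.
  by move=> l hl; apply: h; lia.
by apply: eq_bigr => l _; rewrite addnK.
Qed.

Lemma osum2 (b : nat -> nat -> A) : (forall l k, flt 1 (l + k) (b l k)) ->
  osum (fun l => osum (b l)) = osum (fun n => \sum_(k < n.+1) b (n - k)%N k).
Proof.
move=> hb; apply: ser_eqP => x.
have hl l : smb (b l) by move=> k; apply: (flt_le (hb l k)); apply: leq_addl.
rewrite !(@co_osum (wt 1 x).+1) //; last 2 first.
- by move=> n; apply: flt_sum => k _; apply: (flt_le (hb _ _)); rewrite subnK // -ltnS.
- by move=> l; apply: flt_osum_ge => k; apply: (flt_le (hb l k)); apply: leq_addr.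
under eq_bigr => l _ do rewrite (co_osum (hl l) (ltnSn _)).
under [RHS]eq_bigr => n _ do rewrite co_sum.
apply: (@triangle_sum _ _ (fun l k => co (b l k) x)) => l k hlk.
by apply: hb.
Qed.

(** [flow g X] is the flow of the derivation [X] for the time [g], where [g] is
    treated as a constant in the exponential series.  Both exponentials of
    derivations ([g = 1]) and flows for a non-constant time are instances. *)
Definition ifac (l : nat) : A := cst ((l`!%:R)^-1 : R)%:C%C.
Definition flow g X f : A := osum (fun l => ifac l * g ^+ l * iter l X f).

Definition raising X := forall p f, flt 1 p f -> flt 1 p.+1 (X f).

Lemma flt_iter X p l f : raising X -> flt 1 p f -> flt 1 (p + l) (iter l X f).
Proof.
move=> hX hf; elim: l => [|l IH] /=; first by rewrite addn0.
by rewrite addnS; apply: hX.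
Qed.

Lemma smb_flow g X f : raising X -> smb (fun l => ifac l * g ^+ l * iter l X f).
Proof. by move=> hX l; apply: fltMr; rewrite -[l in flt _ l]add0n; apply: flt_iter. Qed.

Lemma ifac0 : ifac 0 = 1.
Proof. by rewrite /ifac fact0 invr1 !rmorph1. Qed.

Lemma ifacS l : ifac l = ifac l.+1 *+ l.+1.
Proof.
rewrite /ifac -rmorphMn -rmorphMn; congr (cst (_%:C)%C).
rewrite factS natrM invfM -[RHS]mulr_natr mulrC mulrA mulfV ?mul1r //.
by rewrite pnatr_eq0.
Qed.

Lemma ifac_bin n k : (k <= n)%N -> ifac (n - k) * ifac k = ifac n *+ 'C(n, k).
Proof.
move=> h; rewrite /ifac -!rmorphM -!rmorphMn /=; congr (cst (_%:C)%C).
rewrite -(bin_fact h) -[RHS]mulr_natr !natrM.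
have e k' : (k'`!%:R : R) != 0 by rewrite pnatr_eq0 -lt0n fact_gt0.
have e' : ('C(n, k)%:R : R) != 0 by rewrite pnatr_eq0 -lt0n bin_gt0.
by field; rewrite !e e'.
Qed.

Lemma pascal_sum (V : nmodType) n (a : nat -> V) :
  \sum_(k < n.+1) (a k + a k.+1) *+ 'C(n, k) = \sum_(k < n.+2) a k *+ 'C(n.+1, k).
Proof.
under eq_bigr => k _ do rewrite mulrnDl.
rewrite big_split /= big_ord_recl [X in _ + X]big_ord_recr /= [RHS]big_ord_recl.
rewrite [X in _ = _ + X]big_ord_recr /= bin0 !binn !mulr1n -!addrA; congr (_ + _).
rewrite addrA -big_split /=; congr (_ + _).
by apply: eq_bigr => k _; rewrite /bump /= add1n -mulrnDr binS.
Qed.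

Lemma operMn X u c : oper X -> X (u *+ c) = X u *+ c.
Proof.
move=> hX; elim: c => [|c IH]; first by rewrite !mulr0n (oper0 hX).
by rewrite !mulrS (operD hX) IH.
Qed.

Lemma iter_der X n f g : der id X ->
  iter n X (f * g) = \sum_(k < n.+1) (iter (n - k) X f * iter k X g) *+ 'C(n, k).
Proof.
move=> hX; elim: n => [|n IH]; first by rewrite big_ord1 bin0 mulr1n.
rewrite iterS IH (oper_sum _ _ _ (derO hX)).
rewrite -(pascal_sum _ (fun k => iter (n.+1 - k) X f * iter k X g)).
apply: eq_bigr => k _; rewrite (operMn _ _ (derO hX)).
by rewrite (derM hX) subSS subSn // -ltnS.
Qed.

Lemma flow_oper g X : oper X -> raising X -> oper (flow g X).
Proof.
move=> hX hr; split=> [f f'|c f|p f hf].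
- rewrite -osumD; apply: eq_osum => l; rewrite -mulrDr; congr (_ * _).
  by elim: l => //= l ->; rewrite (operD hX).
- rewrite [RHS]mulrC /flow (oper_osum (oper_mul _ (@oper_id _ _)) (smb_flow _ _ hr)).
  apply: eq_osum => l /=.
  have -> : iter l X (cst c * f) = cst c * iter l X f.
    by elim: l => //= l ->; rewrite (operZ hX).
  ring.
apply: flt_osum_ge => l; apply: fltMr.
by apply: (flt_le (flt_iter l hr hf)); apply: leq_addr.
Qed.

Lemma flow_alg g X : der id X -> raising X -> alg (flow g X).
Proof.
move=> hX hr; split=> [||f f']; first exact: flow_oper (derO hX) hr.
  rewrite /flow osum_recl; last exact: smb_flow.
  rewrite ifac0 /= expr0 !mul1r (_ : osum _ = 0) ?addr0 //.
  apply: ser_eqP => x; rewrite co_osumE big1 // => l _.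
  rewrite -iterS iterSr (der1 (@alg_id _ _) hX).
  have -> : iter l X 0 = 0 by elim: (nat_of_ord l) => //= k ->; exact: oper0 (derO hX).
  by rewrite mulr0.
pose t l u := ifac l * g ^+ l * iter l X u.
have ht u : smb (t^~ u) by exact: smb_flow.
transitivity (osum (fun l => osum (fun k => t l f * t k f'))); last first.
  rewrite /flow (oper_osum (oper_mul _ (@oper_id _ _)) (ht f)).
  apply: eq_osum => l /=; rewrite mulrC (oper_osum (oper_mul _ (@oper_id _ _)) (ht f')).
  by apply: eq_osum => k /=; rewrite mulrC.
rewrite osum2; last by move=> l k; apply: fltM; apply: ht.
apply: eq_osum => n; rewrite iter_der // mulr_sumr; apply: eq_bigr => k _.
have hk : (k <= n)%N by rewrite -ltnS.
rewrite /t mulrnAr -mulrnAl -mulrnAl -ifac_bin //.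
have -> : g ^+ n = g ^+ (n - k) * g ^+ k by rewrite -exprD subnK.
ring.
Qed.

(** Besides the transport of [X f], differentiating the time inside the
    exponential produces the factor [X g]. *)
Lemma flow_conj g X f : der id X -> raising X ->
  X (flow g X f) = (1 + X g) * flow g X (X f).
Proof.
move=> hX hr; have hO := derO hX.
rewrite mulrDl mul1r /flow (oper_osum hO (smb_flow _ _ hr)).
rewrite [X in _ = _ + X]mulrC (oper_osum (oper_mul _ (@oper_id _ _)) (smb_flow _ _ hr)).
pose e l := ifac l * g ^+ l.
have eS l : X (e l.+1) = e l * X g.
  have he u : X (ifac l.+1 * u) = ifac l.+1 * X u by exact: operZ hO _ _.
  rewrite /e he (ifacS l); have -> : X (g ^+ l.+1) = g ^+ l * X g *+ l.+1.
    elim: l {he} => [|l IH]; first by rewrite expr0 mul1r.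
    by rewrite exprS (derM hX) IH mulrnAr mulrA -exprS [in RHS]mulrS mulrC.
  by rewrite mulrnAr !mulrnAl mulrA.
have e0 : X (e 0%N) = 0 by rewrite /e ifac0 expr0 mul1r (der1 (@alg_id _ _) hX).
transitivity (osum (fun l => X (e l) * iter l X f + e l * iter l X (X f))).
  apply: eq_osum => l /=; rewrite (derM hX) -iterSr //.
rewrite osumD addrC; congr (_ + _); rewrite osum_recl; last first.
  move=> l; apply: fltMr.
  by rewrite -[l in flt _ l]add0n; apply: flt_iter.
rewrite e0 mul0r add0r; apply: eq_osum => l /=.
by rewrite eS -iterS iterSr /e; ring.
Qed.

Definition closed (P : A -> Prop) a :=
  forall f, (forall p, exists2 g, P g & flt a p (f - g)) -> P f.

(** The iterates of a map that raises the order of differences stabilize order by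
    order; their limit stays in any class that is closed under limits. *)
Lemma fixpt (P : A -> Prop) a T f0 : P f0 -> closed P a ->
  (forall f, P f -> P (T f)) ->
  (forall p f g, P f -> P g -> flt a p (f - g) -> flt a p.+1 (T f - T g)) ->
  exists2 f, P f & T f = f.
Proof.
move=> h0 hc hP hT; pose u n := iter n T f0.
have Pu n : P (u n) by elim: n => //= n; apply: hP.
have hu n : flt a n (u n.+1 - u n).
  by elim: n => [|n IH]; [exact: flt_0|exact: (hT _ _ _ (Pu _) (Pu _) IH)].
have hun n k : flt a n (u (n + k)%N - u n).
  elim: k => [|k IH]; first by rewrite addn0 subrr; exact: flt0.
  rewrite addnS -(subrK (u (n + k)%N) (u _.+1)) -addrA; apply: fltD => //.
  by apply: (flt_le (hu _)); apply: leq_addr.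
pose f : A := fun j k n => u (wt a (j, k, n)).+1 j k n.
have hf n : flt a n (f - u n).
  split=> x hx; rewrite coB.
  have -> : co f x = co (u (wt a x).+1) x by case: x hx => [[]].
  have := hun (wt a x).+1 (n - (wt a x).+1)%N; rewrite subnKC // => h.
  by apply/eqP; rewrite -oppr_eq0 opprB -coB (flt_co h).
have Pf : P f by apply: hc => n; exists (u n).
exists f => //; apply: (@flt_eq _ _ a) => n; apply: (@fltW _ _ _ _ n.+1) => //.
rewrite -(subrK (T (u n)) (T f)) -addrA; apply: fltD; first exact: (hT _ _ _ Pf (Pu n) (hf n)).
by rewrite -opprB; apply: fltN; exact: (hf n.+1).
Qed.

Lemma closed_flt a b p : closed (flt b p) a.
Proof.
move=> f h; split=> x hx; have [g hg hfg] := h (wt a x).+1.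
by have := flt_co hfg (ltnSn _); rewrite coB (flt_co hg) ?subr0.
Qed.

Lemma closedI P Q a : closed P a -> closed Q a -> closed (fun f => P f /\ Q f) a.
Proof.
by move=> hP hQ f h; split; [apply: hP|apply: hQ] => p; have [g [] *] := h p; exists g.
Qed.

End Flows.
Arguments ifac R m l : clear implicits.

(** * Exponentials of fields *)

Section Exponential.
Variables (R : realType) (m : nat).
Local Notation A := (ser R m).
Implicit Types (f g h y : A) (x : idx m) (a p q : nat) (u v : vfield R m).
Implicit Types (F G : nat -> A) (T X : A -> A).

Lemma raising_vder v : vflt 1 2 v -> raising (vder v).
Proof. by move=> hv p f hf; rewrite -(addn1 p); apply: flt_vder. Qed.

Lemma vflt_le a p q v : vflt a q v -> (p <= q)%N -> vflt a p v.
Proof. by move=> [h1 h2] h; split; exact: (fltW h). Qed.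

Lemma bracket1 u v : (bracket u v).1 = vder v u.1 - vder u v.1.
Proof. by rewrite !vderE. Qed.
Lemma bracket2 u v : (bracket u v).2 = vder v u.2 - vder u v.2.
Proof. by rewrite !vderE. Qed.

Lemma vflt_bracket a p q u v : vflt a p.+1 u -> vflt a q.+1 v ->
  vflt a (p + q).+1 (bracket u v).
Proof.
move=> hu hv; split; rewrite ?bracket1 ?bracket2.
  apply: fltB; first by rewrite -addSn; apply: flt_vder => //; case: hu.
  by rewrite addnC -addSn; apply: flt_vder => //; case: hv.
apply: fltB; first by rewrite -addSn; apply: flt_vder => //; case: hu.
by rewrite addnC -addSn; apply: flt_vder => //; case: hv.
Qed.

(** The bracket of fields is the commutator of the derivations, reversed. *)
Lemma vder_bracket u v f : vflt 1 1 u -> vflt 1 1 v ->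
  vder (bracket u v) f = vder v (vder u f) - vder u (vder v f).
Proof.
move=> hu hv; have du := vder_der hu; have dv := vder_der hv.
move: f; apply: (der_ext (@alg_id R m)); first exact/vder_der/(vflt_bracket hu hv).
- split=> [|f g]; last first.
  rewrite !vderM !(operD (derO du)) !(operD (derO dv)) !vderM; ring.
  apply: oper_add; first exact: (oper_comp (derO dv) (derO du)).
  exact/oper_opp/(oper_comp (derO du) (derO dv)).
- by rewrite !vder_zz bracket1.
- by rewrite !vder_ww bracket2.
by move=> i; rewrite !vder_mu (oper0 (derO du)) (oper0 (derO dv)) subrr.
Qed.

Lemma vflt_iter_bracket k u v : vflt 1 2 u -> vflt 1 1 v ->
  vflt 1 k.+1 (iter k (bracket u) v).
Proof.
by move=> hu hv; elim: k => [|k IH] //=; apply: (@vflt_bracket 1 1 k).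
Qed.

(** The binomial formula for moving a derivation across a power of another one;
    the commutators that arise are iterated brackets. *)
Lemma vder_iter n u v f : vflt 1 2 u -> vflt 1 1 v ->
  vder v (iter n (vder u) f) =
  \sum_(k < n.+1) iter (n - k) (vder u) (vder (iter k (bracket u) v) f) *+ 'C(n, k).
Proof.
move=> hu hv; have hu1 : vflt 1 1 u by apply: (vflt_le hu).
have dX := derO (vder_der hu1).
elim: n f => [|n IH] f; first by rewrite big_ord1 bin0 mulr1n.
rewrite iterSr IH.
rewrite -(pascal_sum _ (fun k => iter (n.+1 - k) (vder u) (vder (iter k (bracket u) v) f))).
apply: eq_bigr => k _; congr (_ *+ _); have hk : (k <= n)%N by rewrite -ltnS.
rewrite subSS subSn // iterSr.
set B := iter k (bracket u) v.
have -> : vder B (vder u f) = vder u (vder B f) + vder (iter k.+1 (bracket u) v) f.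
  rewrite iterS vder_bracket //; first by rewrite addrC subrK.
  by apply: (vflt_le (vflt_iter_bracket k hu hv)).
by elim: (n - k)%N => //= l ->; rewrite (operD dX).
Qed.

Definition expd y f : A := flow 1 (vder (fld y)) f.

Lemma expdE y f : expd y f = osum (fun l => ifac R m l * iter l (vder (fld y)) f).
Proof. by apply: eq_osum => l; rewrite expr1n mulr1. Qed.

Lemma expd_alg y : flt 1 2 y -> alg (expd y).
Proof.
move=> hy; apply: flow_alg; first by apply: vder_der; apply: vflt_fld; apply: (flt_le hy).
by apply: raising_vder; apply: vflt_fld.
Qed.

Lemma exp_ad1 u v :
  (exp_ad u v).1 = osum (fun l => ifac R m l * ((iter l (bracket u) v).1 : A)).
Proof.
apply: ser_eqP => x; rewrite co_osumE; under [RHS]eq_bigr do rewrite -sscaleE.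
by rewrite /wt mul1n.
Qed.
Lemma exp_ad2 u v :
  (exp_ad u v).2 = osum (fun l => ifac R m l * ((iter l (bracket u) v).2 : A)).
Proof.
apply: ser_eqP => x; rewrite co_osumE; under [RHS]eq_bigr do rewrite -sscaleE.
by rewrite /wt mul1n.
Qed.

Lemma vder_osum (U : nat -> vfield R m) f (u : vfield R m) :
  u.1 = osum (fun l => (U l).1) -> u.2 = osum (fun l => (U l).2) ->
  (forall l, vflt 1 l (U l)) -> vder u f = osum (fun l => vder (U l) f).
Proof.
move=> e1 e2 hU; rewrite vderE e1 e2 ![pz f * _]mulrC ![pw f * _]mulrC.
rewrite !(oper_osum (oper_mul _ (@oper_id _ _))); try by move=> l; case: (hU l).
rewrite -osumD; apply: eq_osum => l /=.
by rewrite vderE mulrC; congr (_ + _); rewrite mulrC.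
Qed.

(** Conjugation by an exponential: exp (ad y) is transport along the
    automorphism exp y of the ring of series. *)
Lemma expd_exp_ad y v f : flt 1 2 y -> vflt 1 1 v ->
  expd y (vder (exp_ad (fld y) v) f) = vder v (expd y f).
Proof.
move=> hy hv; have hu : vflt 1 2 (fld y) by apply: vflt_fld.
have dX := derO (vder_der (vflt_le hu (isT : (1 <= 2)%N))).
have dv := derO (vder_der hv).
pose U l : vfield R m := (ifac R m l * ((iter l (bracket (fld y)) v).1 : A),
                          ifac R m l * ((iter l (bracket (fld y)) v).2 : A)).
have hU l : vflt 1 l.+1 (U l).
  by have [h1 h2] := vflt_iter_bracket l hu hv; split; apply: fltMr.
have hr := raising_vder hu.
have vU l : vder (U l) f = ifac R m l * vder (iter l (bracket (fld y)) v) f.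
  by rewrite !vderE /U /=; ring.
have fU l : flt 1 l (vder (U l) f).
  rewrite vderE; apply: fltD; apply: fltMr; have [h1 h2] := hU l.
    exact: (flt_le h1).
  exact: (flt_le h2).
rewrite (@vder_osum U) ?exp_ad1 ?exp_ad2 //; last first.
  by move=> l; apply: (vflt_le (hU l)).
rewrite !expdE (oper_osum dv); last first.
  move=> l; apply: fltMr; rewrite -[l in flt _ l]add0n; exact: flt_iter.
transitivity (osum (fun l => osum (fun k =>
    ifac R m l * iter l (vder (fld y)) (vder (U k) f)))).
  apply: eq_osum => l.
  have oi : oper (iter l (vder (fld y))).
    by elim: l => [|l IH]; [exact: oper_id | exact: (oper_comp dX IH)].
  have ho : oper (fun g => iter l (vder (fld y)) g * ifac R m l) by exact: oper_mul.
  have hs : smb (fun k => vder (U k) f) by [].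
  rewrite mulrC (oper_osum ho hs); apply: eq_osum => k /=; exact: mulrC.
rewrite osum2; last first.
  by move=> l k; apply: fltMr; rewrite addnC; apply: flt_iter.
apply: eq_osum => n /=; rewrite (operZ dv) vder_iter // mulr_sumr.
apply: eq_bigr => k _; have hk : (k <= n)%N by rewrite -ltnS.
rewrite vU; set W := vder _ f.
have -> : iter (n - k) (vder (fld y)) (ifac R m k * W) =
   ifac R m k * iter (n - k) (vder (fld y)) W.
  by elim: (n - k)%N => //= l ->; rewrite (operZ dX).
by rewrite mulrA ifac_bin // mulrnAl mulrnAr.
Qed.

End Exponential.

(** * Supports, real and radial series *)

Section Supports.
Variables (R : realType) (m : nat).
Local Notation C := R[i].
Local Notation A := (ser R m).
Implicit Types (f g h : A) (x y : idx m) (a p q : nat).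
Implicit Types (T X : A -> A) (B : pred (idx m)).
Local Notation zz := (zz R m).
Local Notation ww := (ww R m).
Local Notation cst := (@cst R m).

Record supp B f : Prop := Supp { supp_co : forall x, ~~ B x -> co f x = 0 }.

Lemma supp0 B : supp B 0. Proof. by split. Qed.
Lemma suppD B f g : supp B f -> supp B g -> supp B (f + g).
Proof. by move=> hf hg; split=> x hx; rewrite coD (supp_co hf) ?(supp_co hg) ?addr0. Qed.
Lemma suppN B f : supp B f -> supp B (- f).
Proof. by move=> hf; split=> x hx; rewrite coN (supp_co hf) ?oppr0. Qed.
Lemma suppB B f g : supp B f -> supp B g -> supp B (f - g).
Proof. by move=> hf hg; apply: suppD => //; apply: suppN. Qed.
Lemma supp_sum B I r (P : pred I) (F : I -> A) :
  (forall i, P i -> supp B (F i)) -> supp B (\sum_(i <- r | P i) F i).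
Proof. by move=> h; elim/big_ind: _ => //; apply: suppD. Qed.
Lemma suppM B B1 B2 f g : (forall x y, B1 x -> B2 y -> B (ixadd x y)) ->
  supp B1 f -> supp B2 g -> supp B (f * g).
Proof.
move=> hB hf hg; split=> x hx; apply: coM_eq0 => y z e.
case: (boolP (B1 y)) => h1; last by rewrite (supp_co hf) ?mul0r.
case: (boolP (B2 z)) => h2; last by rewrite (supp_co hg) ?mulr0.
by move: hx; rewrite -e hB.
Qed.
Lemma suppZ B c f : supp B f -> supp B (cst c * f).
Proof. by move=> hf; split=> x hx; rewrite coZ (supp_co hf) ?mulr0. Qed.
Lemma supp_mono B x : B x -> supp B (mono R x).
Proof. by move=> h; split=> y hy; rewrite co_mono; case: eqP => // e; rewrite e h in hy. Qed.
Lemma closed_supp B a : closed (supp B) a.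
Proof.
move=> f h; split=> x hx; have [g hg hfg] := h (wt a x).+1.
by have := flt_co hfg (ltnSn _); rewrite coB (supp_co hg) ?subr0.
Qed.
Lemma supp_osum B (F : nat -> A) : (forall l, supp B (F l)) -> supp B (osum F).
Proof. by move=> h; split=> x hx; rewrite co_osumE big1 // => l _; rewrite (supp_co (h _)). Qed.

Lemma supp_oper B B' T f : oper T -> (forall x, B x -> supp B' (T (mono R x))) ->
  supp B f -> supp B' (T f).
Proof.
move=> hT h hf; apply: (@closed_supp B' 1) => p; exists (T (trunc p f)); last first.
  by rewrite -(operB _ _ hT); apply: (operF hT); apply: flt_trunc.
rewrite (oper_trunc _ _ hT); apply: supp_sum => x _.
case: (boolP (B (ix x))) => hx; first exact/suppZ/h.
by rewrite (supp_co hf) // rmorph0 mul0r; exact: supp0.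
Qed.

Lemma oper_ext_supp B T T' f : oper T -> oper T' ->
  (forall x, B x -> T (mono R x) = T' (mono R x)) -> supp B f -> T f = T' f.
Proof.
move=> h h' e hf; apply: (@flt_eq _ _ 1) => p.
have ht : T (trunc p f) = T' (trunc p f).
  rewrite (oper_trunc _ _ h) (oper_trunc _ _ h'); apply: eq_bigr => x _.
  case: (boolP (B (ix x))) => hx; first by rewrite e.
  by rewrite (supp_co hf) // rmorph0 !mul0r.
have -> : T f - T' f = T (f - trunc p f) - T' (f - trunc p f).
  by rewrite (operB _ _ h) (operB _ _ h') ht opprB addrA addrNK.
by apply: fltB; [apply: (operF h)|apply: (operF h')]; apply: flt_trunc.
Qed.

(** Radial series are the series in s = zw and mu, parametric series those in
    mu alone, and [moving] series those without terms in mu alone: the components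
    of state terms, which vanish at z = w = 0. *)
Definition rad := supp (fun x => x.1.1 == x.1.2).
Definition par := supp (fun x => (x.1.1 + x.1.2)%N == 0%N).
Definition moving := supp (fun x => (x.1.1 + x.1.2)%N != 0%N).

Lemma rad_co f i j n : rad f -> i != j -> co f (i, j, n) = 0.
Proof. by move=> h hij; apply: (supp_co h (x := (i, j, n))). Qed.
Lemma radM f g : rad f -> rad g -> rad (f * g).
Proof. by apply: suppM => x y /= /eqP -> /eqP ->. Qed.
Lemma parM f g : par f -> par g -> par (f * g).
Proof. by apply: suppM => x y /=; lia. Qed.
Lemma movingMl f g : moving f -> moving (f * g).
Proof.
move=> hf; apply: (@suppM _ (fun x => (x.1.1 + x.1.2)%N != 0%N) predT) hf _.
  by move=> x y /=; lia.
by split.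
Qed.
Lemma movingMr f g : moving g -> moving (f * g).
Proof. by rewrite mulrC; apply: movingMl. Qed.
Lemma rad1 : rad 1. Proof. exact: (@supp_mono _ (0%N, 0%N, 0%MM)). Qed.
Lemma par1 : par 1. Proof. exact: (@supp_mono _ (0%N, 0%N, 0%MM)). Qed.
Lemma rad_cst c : rad (cst c). Proof. by rewrite -[cst c]mulr1; apply/suppZ/rad1. Qed.
Lemma par_cst c : par (cst c). Proof. by rewrite -[cst c]mulr1; apply/suppZ/par1. Qed.
Lemma radX f k : rad f -> rad (f ^+ k).
Proof. by move=> h; elim: k => [|k IH]; rewrite ?exprS; [exact: rad1|exact: radM]. Qed.
Lemma par_rad f : par f -> rad f.
Proof. by move=> h; split=> x hx; apply: (supp_co h); move: hx; apply: contra; lia. Qed.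
Lemma rad_mu i : rad (mu R i). Proof. exact: (@supp_mono _ (0%N, 0%N, _)). Qed.
Lemma par_mu i : par (mu R i). Proof. exact: (@supp_mono _ (0%N, 0%N, _)). Qed.
Lemma moving_zz : moving zz. Proof. exact: (@supp_mono _ (1%N, 0%N, 0%MM)). Qed.
Lemma moving_ww : moving ww. Proof. exact: (@supp_mono _ (0%N, 1%N, 0%MM)). Qed.
Lemma moving_star f : moving f -> moving (star f).
Proof.
move=> h; split=> x hx; rewrite co_star (supp_co h) ?rmorph0 //.
by move: hx; rewrite /= addnC.
Qed.
Lemma rad_star f : rad f -> rad (star f).
Proof.
by move=> h; split=> x hx; rewrite co_star (supp_co h) ?rmorph0 //= eq_sym.
Qed.
(** The real ones among the radial and the parametric series: these are the time
    and the parameter transformations. *)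
Definition rr f := rad f /\ star f = f.
Definition rp f := par f /\ star f = f.

Lemma rp_rr f : rp f -> rr f. Proof. by case=> h e; split=> //; apply: par_rad. Qed.
Lemma rr0 : rr 0. Proof. by split; [exact: supp0|exact: star0]. Qed.
Lemma rr1 : rr 1. Proof. by split; [exact: rad1|exact: star1]. Qed.
Lemma rrD f g : rr f -> rr g -> rr (f + g).
Proof. by move=> [h e] [h' e']; split; [exact: suppD|rewrite starD e e']. Qed.
Lemma rrN f : rr f -> rr (- f).
Proof. by move=> [h e]; split; [exact: suppN|rewrite starN e]. Qed.
Lemma rrB f g : rr f -> rr g -> rr (f - g).
Proof. by move=> h h'; apply: rrD => //; apply: rrN. Qed.
Lemma rrM f g : rr f -> rr g -> rr (f * g).
Proof. by move=> [h e] [h' e']; split; [exact: radM|rewrite starM e e']. Qed.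
Lemma rrX f k : rr f -> rr (f ^+ k).
Proof. by move=> [h e]; split; [exact: radX|rewrite starX e]. Qed.
Lemma rp_mu i : rp (mu R i). Proof. by split; [exact: par_mu|exact: star_mu]. Qed.
Lemma rpD f g : rp f -> rp g -> rp (f + g).
Proof. by move=> [h e] [h' e']; split; [exact: suppD|rewrite starD e e']. Qed.
Lemma rpN f : rp f -> rp (- f).
Proof. by move=> [h e]; split; [exact: suppN|rewrite starN e]. Qed.
Lemma rpB f g : rp f -> rp g -> rp (f - g).
Proof. by move=> h h'; apply: rpD => //; apply: rpN. Qed.
Lemma rpM f g : rp f -> rp g -> rp (f * g).
Proof. by move=> [h e] [h' e']; split; [exact: parM|rewrite starM e e']. Qed.
Lemma rp_cst (c : R) : rp (cst c%:C%C).
Proof. by split; [exact: par_cst|rewrite star_cst conjc_real]. Qed.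
Lemma rr_cst (c : R) : rr (cst c%:C%C). Proof. exact/rp_rr/rp_cst. Qed.
Lemma rr_sum I r (P : pred I) (F : I -> A) :
  (forall i, P i -> rr (F i)) -> rr (\sum_(i <- r | P i) F i).
Proof. by move=> h; apply: (big_ind rr rr0 rrD). Qed.

Lemma closed_star a : closed (fun f => star f = f) a.
Proof.
move=> f h; apply: (@flt_eq _ _ a) => p; have [g eg hg] := h p.
rewrite -(subrK g f) starD eg opprD addrACA subrr addr0.
by apply: fltB => //; apply: flt_star.
Qed.
Lemma closed_rr a : closed rr a.
Proof. exact: closedI (@closed_supp _ _) (@closed_star a). Qed.
Lemma closed_rp a : closed rp a.
Proof. exact: closedI (@closed_supp _ _) (@closed_star a). Qed.

Lemma rr_real f k n : star f = f -> (complex.Re (f k k n))%:C%C = f k k n.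
Proof.
move=> e; have : (f k k n)^*%C = f k k n by rewrite -{2}e.
case: (f k k n) => re im /= [] /eqP; rewrite -subr_eq0 -opprD oppr_eq0 -mulr2n.
by rewrite mulrn_eq0 /= => /eqP ->.
Qed.

Lemma rr_time f : rr f -> exists t, f = time_series t.
Proof.
move=> [hf e]; exists (fun k n => complex.Re (f k k n)).
apply: ser_eqP => -[[j k] n]; rewrite /time_series /co /=.
by case: eqP => [->|/eqP h]; [rewrite rr_real|exact: (supp_co hf (x := (j, k, n)) h)].
Qed.

Lemma time_rr (t : time_space R m) : rr (time_series t).
Proof.
split; first by split=> -[[j k] n] /= h; rewrite /co /time_series /= (negbTE h).
apply: ser_eqP => -[[j k] n]; rewrite co_star /co /time_series /= eq_sym.
by case: eqP => [->|]; rewrite ?conjc_real ?rmorph0.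
Qed.

Lemma rp_param f : rp f -> exists q : pseries R m, f = param_series q.
Proof.
move=> [hf e]; exists (fun n => complex.Re (f 0%N 0%N n)).
apply: ser_eqP => -[[j k] n]; rewrite /param_series /co /=.
case: andP => [[/eqP -> /eqP ->]|h]; first by rewrite rr_real.
by apply: (supp_co hf (x := (j, k, n))); rewrite /= addn_eq0; apply/andP.
Qed.

Lemma param_rp (p : pseries R m) : rp (param_series p).
Proof.
split; first by split=> -[[j k] n] /= h; rewrite /co /param_series /= -addn_eq0 (negbTE h).
apply: ser_eqP => -[[j k] n]; rewrite co_star /co /param_series /= andbC.
by case: ifP; rewrite ?conjc_real ?rmorph0.
Qed.

Definition ss : A := zz * ww.

Lemma star_ss : star ss = ss. Proof. by rewrite starM star_zz star_ww mulrC. Qed.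

Lemma mono_rad k n : mono R (k, k, n) = ss ^+ k * mono R (0%N, 0%N, n).
Proof. by rewrite monoE exprMn. Qed.

Lemma ssE k : ss ^+ k = mono R (k, k, 0%MM).
Proof. by rewrite mono_rad mono0 mulr1. Qed.

Lemma rr_ss : rr ss.
Proof. by split; [rewrite -[ss]expr1 ssE; exact: supp_mono|exact: star_ss]. Qed.

Lemma alg_fix_par T f : alg T -> (forall i, T (mu R i) = mu R i) -> par f -> T f = f.
Proof.
move=> h hm; apply: (oper_ext_supp (T' := id)) => [||[[j k] n] /=]; [exact: algO|by []|].
rewrite addn_eq0 => /andP[/eqP -> /eqP ->].
apply: (mono_par_ind (Q := fun f => T f = f)) => //; first by rewrite (alg1 h).
by move=> u v eu ev; rewrite (algM h) eu ev.
Qed.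

Lemma alg_rad T f : alg T -> rad (T ss) -> (forall i, rad (T (mu R i))) -> rad f -> rad (T f).
Proof.
move=> h hs hm; apply: supp_oper => [|[[j k] n] /= /eqP ->]; first exact: algO.
rewrite mono_rad (algM h) (algX _ _ h); apply: radM; first exact: radX.
apply: (mono_par_ind (Q := fun f => rad (T f))) => //.
  by rewrite (alg1 h); exact: rad1.
by move=> u v eu ev; rewrite (algM h); exact: radM.
Qed.

Lemma alg_par T f : alg T -> (forall i, par (T (mu R i))) -> par f -> par (T f).
Proof.
move=> h hm; apply: supp_oper => [|[[j k] n] /=]; first exact: algO.
rewrite addn_eq0 => /andP[/eqP -> /eqP ->].
apply: (mono_par_ind (Q := fun f => par (T f))) => //.
  by rewrite (alg1 h); exact: par1.
by move=> u v eu ev; rewrite (algM h); exact: parM.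
Qed.

Lemma alg_moving T f : alg T -> moving (T zz) -> moving (T ww) -> moving f -> moving (T f).
Proof.
move=> h hz hw; apply: supp_oper => [|[[j k] n] /=]; first exact: algO.
rewrite monoE (algM h) => hjk; apply: movingMl.
rewrite (algM h) !(algX _ _ h); case: j hjk => [|j] hjk.
  by case: k hjk => // k _; rewrite exprS; apply/movingMr/movingMl.
by rewrite exprS; do 2!apply: movingMl.
Qed.

Lemma alg_star T f : alg T -> T ww = star (T zz) ->
  (forall i, star (T (mu R i)) = T (mu R i)) -> star (T f) = T (star f).
Proof.
move=> h hw hm; rewrite -{1}(starK f); move: (star f) => {}f.
apply: (alg_ext (star_alg h) h); rewrite ?star_zz ?star_ww ?hw ?starK //.
by move=> i; rewrite star_mu.
Qed.

(** Endomorphisms of this kind are invertible: [T f = g] is the fixed point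
    equation [f = g - (T f - f)] of a contraction. *)
Definition near T := forall p f, flt 1 p f -> flt 1 p.+1 (T f - f).

Lemma mono_inj : injective (@mono R m).
Proof.
move=> x y e; have := co_mono R x x; rewrite e co_mono eqxx.
by case: eqP => // _ /eqP; rewrite eq_sym oner_eq0.
Qed.

Lemma alg_near T : alg T -> flt 1 2 (T zz - zz) -> flt 1 2 (T ww - ww) ->
  (forall i, flt 1 2 (T (mu R i) - mu R i)) -> near T.
Proof.
move=> h hz hw hm p f hf.
have hmono x : flt 1 (wt 1 x).+1 (T (mono R x) - mono R x).
  pose Q g := exists2 y, g = mono R y & flt 1 (wt 1 y).+1 (T g - g).
  suff [y /mono_inj <-] : Q (mono R x) by [].
  have gen y g : g = mono R y -> wt 1 y = 1%N -> flt 1 2 (T g - g) -> Q g.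
    by move=> e ey hg; exists y => //; rewrite ey.
  apply: mono_ind.
  - by exists (0%N, 0%N, 0%MM); rewrite ?(alg1 h) ?subrr //; exact: flt0.
  - move=> _ _ [y -> hy] [y' -> hy']; exists (ixadd y y'); first by rewrite monoD.
    rewrite (algM h) wtD.
    have -> : T (mono R y) * T (mono R y') - mono R y * mono R y' =
      (T (mono R y) - mono R y) * T (mono R y') + mono R y * (T (mono R y') - mono R y').
      by ring.
    apply: fltD; first by rewrite -addSn; apply: fltM => //; apply: (operF h); exact: flt_mono.
    by rewrite -addnS; apply: fltM => //; exact: flt_mono.
  - by apply: (gen (1%N, 0%N, 0%MM)) => //; rewrite /wt /= mdeg0.
  - by apply: (gen (0%N, 1%N, 0%MM)) => //; rewrite /wt /= mdeg0.
  by move=> i; apply: (gen (0%N, 0%N, U_(i)%MM)) => //; rewrite /wt /= mdeg1.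
have -> : T f - f = (T (f - trunc p.+1 f) - (f - trunc p.+1 f)) +
     (T (trunc p.+1 f) - trunc p.+1 f) by rewrite (operB _ _ h); ring.
apply: fltD; first by apply: fltB; [apply: (operF h)|]; exact: flt_trunc.
rewrite (oper_trunc _ _ h) -sumrB; apply: flt_sum => x _; rewrite -mulrBr.
case: (ltnP (wt 1 (ix x)) p) => hx.
  by rewrite (flt_co hf) // rmorph0 mul0r; exact: flt0.
by apply: fltMr; apply: (flt_le (hmono _)).
Qed.

Lemma near_inj T f g : oper T -> near T -> T f = T g -> f = g.
Proof.
move=> hT hn e; apply: (@flt_eq _ _ 1); elim=> [|p IH]; first exact: flt_0.
by have := hn _ _ IH; rewrite (operB _ _ hT) e subrr sub0r => /fltN; rewrite opprK.
Qed.

Lemma near_surj (P : A -> Prop) T g : oper T -> near T ->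
  closed P 1 -> (forall f h, P f -> P h -> P (f - h)) -> (forall f, P f -> P (T f)) ->
  P g -> exists2 f, P f & T f = g.
Proof.
move=> hT hn hc hB hP hg.
have [f Pf e] : exists2 f, P f & g - (T f - f) = f.
  apply: (@fixpt _ _ P 1 (fun f => g - (T f - f)) g) => // [f Pf|p f h Pf Ph hfh].
    by apply: (hB _ _ hg); apply: (hB _ _ (hP _ Pf) Pf).
  have -> : g - (T f - f) - (g - (T h - h)) = - (T (f - h) - (f - h)).
    by rewrite (operB _ _ hT); ring.
  exact/fltN/hn.
exists f => //; apply/eqP; rewrite eq_sym -subr_eq0.
have -> : g - T f = g - (T f - f) - f by ring.
by rewrite e subrr.
Qed.

End Supports.
Arguments ss R m : clear implicits.

(** * Substitutions *)

Section Substitution.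
Variables (R : realType) (m : nat).
Local Notation C := R[i].
Local Notation A := (ser R m).
Implicit Types (f g h : A) (x y : idx m) (p q : nat).
Local Notation zz := (zz R m).
Local Notation ww := (ww R m).

Section Sub.
Variables (f1 f2 : A) (phi : 'I_m -> A).

Definition submono x : A :=
  f1 ^+ x.1.1 * f2 ^+ x.1.2 * \prod_(i < m) phi i ^+ x.2 i.

Definition Sub f : A := fun j k n =>
  \sum_(x : box m (wt 1 (j, k, n)).+1) co f (ix x) * co (submono (ix x)) (j, k, n).

Hypotheses (h1 : flt 1 1 f1) (h2 : flt 1 1 f2) (h3 : forall i, flt 1 1 (phi i)).

Lemma submonoD x y : submono (ixadd x y) = submono x * submono y.
Proof.
rewrite /submono /ixadd /= !exprD.
under eq_bigr => i _ do rewrite mnmDE exprD.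
rewrite big_split /=; ring.
Qed.

Lemma flt_submono x : flt 1 (wt 1 x) (submono x).
Proof.
rewrite /wt mul1n; apply: fltM; first apply: fltM.
- by have := fltX x.1.1 h1; rewrite mul1n.
- by have := fltX x.1.2 h2; rewrite mul1n.
rewrite mdegE; elim/big_rec2: _ => [|i n f _ IH]; first exact: flt_0.
by apply: fltM => //; have := fltX (x.2 i) (h3 i); rewrite mul1n.
Qed.

Lemma inbox_wt D x : (wt 1 x < D)%N -> inbox D x.
Proof. by rewrite /wt /inbox mul1n => h; apply/and3P; split; lia. Qed.

Lemma co_Sub D f x : (wt 1 x < D)%N ->
  co (Sub f) x = \sum_(y : box m D) co f (ix y) * co (submono (ix y)) x.
Proof.
case: x => [[j k] n] hD; symmetry.
apply: (box_sum_widen (F := fun y => co f y * co (submono y) (j, k, n))) => // y hy.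
rewrite (flt_co (flt_submono y)) ?mulr0 //.
by rewrite ltnNge; apply: contra hy => hy; apply: inbox_wt.
Qed.

Lemma Sub_mono y : Sub (mono R y) = submono y.
Proof.
apply: ser_eqP => x; rewrite (@co_Sub (wt 1 x + wt 1 y).+1) ?ltnS ?leq_addr //.
transitivity (\sum_(z : box m (wt 1 x + wt 1 y).+1) co (submono (ix z)) x *+ (ix z == y)).
  by apply: eq_bigr => z _; rewrite co_mono mulr_natl.
by rewrite (box_sum_delta _ (fun z => co (submono z) x)) inbox_wt // ltnS leq_addl.
Qed.

Lemma Sub_oper : oper Sub.
Proof.
split=> [f g|c f|p f hf].
- apply: ser_eqP => x; rewrite coD !(co_Sub _ (ltnSn _)) -big_split.
  by apply: eq_bigr => y _; rewrite coD mulrDl.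
- apply: ser_eqP => x; rewrite coZ !(co_Sub _ (ltnSn _)) mulr_sumr.
  by apply: eq_bigr => y _; rewrite coZ mulrA.
split=> x hx; rewrite (co_Sub _ (ltnSn _)) big1 // => y _.
case: (ltnP (wt 1 (ix y)) p) => hy; first by rewrite (flt_co hf) ?mul0r.
by rewrite (flt_co (flt_submono _)) ?mulr0 // (leq_trans hx).
Qed.

Lemma Sub_alg : alg Sub.
Proof.
have hS := Sub_oper; split=> [//||f g].
  rewrite -[1]mono0 Sub_mono /submono !expr0 !mul1r big1 // => i _.
  by rewrite mnm0E expr0.
have oM h : oper (fun f => f * h) by exact: (oper_mul h (@oper_id _ _)).
move: f; apply: oper_ext; [exact: (oper_comp hS (oM g)) | exact: oper_mul |] => x /=.
have oM' h T : oper T -> oper (fun f => h * T f).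
  move=> hT; have -> : (fun f => h * T f) = (fun f => T f * h).
    by apply/funext => f; exact: mulrC.
  exact: oper_mul.
move: g; apply: oper_ext => [||y].
- exact: (oper_comp hS (oM' (mono R x) id (@oper_id _ _))).
- exact: oM'.
by rewrite -monoD !Sub_mono submonoD.
Qed.

Lemma Sub_zz : Sub zz = f1.
Proof.
rewrite -[zz]/(mono R (1%N, 0%N, 0%MM)) Sub_mono /submono /= expr0 expr1 mulr1.
by rewrite big1 ?mulr1 // => i _; rewrite mnm0E expr0.
Qed.
Lemma Sub_ww : Sub ww = f2.
Proof.
rewrite -[ww]/(mono R (0%N, 1%N, 0%MM)) Sub_mono /submono /= expr0 expr1 mul1r.
by rewrite big1 ?mulr1 // => i _; rewrite mnm0E expr0.
Qed.
Lemma Sub_mu i : Sub (mu R i) = phi i.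
Proof.
rewrite -[mu R i]/(mono R (0%N, 0%N, U_(i)%MM)) Sub_mono /submono /= !expr0 !mul1r.
rewrite (bigD1 i) //= mnm1E eqxx expr1 big1 ?mulr1 // => j hj.
by rewrite mnm1E eq_sym (negbTE hj) expr0.
Qed.

End Sub.

Local Notation pser := (@param_series R m).

Lemma flt_zz : flt 1 1 zz.
Proof. by have := @flt_mono R m 1 (1%N, 0%N, 0%MM); rewrite /wt mdeg0 /= muln0. Qed.
Lemma flt_ww : flt 1 1 ww.
Proof. by have := @flt_mono R m 1 (0%N, 1%N, 0%MM); rewrite /wt mdeg0 /= muln0. Qed.
Lemma flt_mu (i : 'I_m) : flt 1 1 (mu R i).
Proof. by have := @flt_mono R m 1 (0%N, 0%N, U_(i)%MM); rewrite /wt mdeg1 /= muln1. Qed.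

Lemma pserM (p q : pseries R m) : pser (pmul p q) = (pser p : A) * (pser q : A) :> A.
Proof.
apply: ser_eqP => -[[j k] n].
case: (boolP ((j + k)%N == 0%N)) => h; last first.
  rewrite (supp_co (parM (proj1 (param_rp p)) (proj1 (param_rp q)))) //.
  by rewrite (supp_co (proj1 (param_rp (pmul p q)))).
move: h; rewrite addn_eq0 => /andP[/eqP -> /eqP ->].
rewrite /co /= -[RHS]/(smul _ _ _ _ _) /smul !big_ord1 /param_series /= /pmul.
by rewrite rmorph_sum; apply: eq_bigr => c _; rewrite rmorphM.
Qed.

Lemma pser1 : pser (pone R (m := m)) = 1 :> A.
Proof.
apply: ser_eqP => -[[j k] n]; rewrite co1 /co /param_series /= /pone !xpair_eqE.
by case: (j == 0%N) => //=; case: (k == 0%N) => //=; case: (n == _); rewrite ?rmorph1 ?rmorph0.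
Qed.

Lemma pser_iter (p : pseries R m) k : pser (iter k (pmul p) (pone R (m := m))) = (pser p : A) ^+ k.
Proof.
elim: k => [|k IH]; first exact: pser1.
by rewrite iterS pserM IH exprS.
Qed.

Lemma pser_monomial (phi : param_space R m) c :
  pser (pmonomial phi c) = \prod_(i < m) (pser (phi i) : A) ^+ c i.
Proof.
rewrite /pmonomial; elim/big_rec2: _ => [|i x y _ e]; first exact: pser1.
by rewrite pserM e pser_iter.
Qed.

Lemma ord_sum_delta (V : nmodType) D (F : nat -> V) a :
  \sum_(i < D) F i *+ (nat_of_ord i == a) = F a *+ (a < D)%N.
Proof.
case: ltnP => h.
  rewrite (bigD1 (Ordinal h)) //= eqxx mulr1n big1 ?addr0 // => i hi.
  have /negbTE -> : (nat_of_ord i != a) by exact: hi.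
  by rewrite mulr0n.
by rewrite big1 // => i _; rewrite ltn_eqF ?mulr0n // (leq_trans (ltn_ord i)).
Qed.

(** The substitution of parameters is the endomorphism that fixes z and w: the
    product of the powers of the phi_i has order at least |c|, so that the two
    ways of truncating the sum agree. *)
Lemma ssubstE (phi : param_space R m) f : (forall i, flt 1 1 (pser (phi i))) ->
  ssubst phi f = Sub zz ww (fun i => pser (phi i)) f.
Proof.
move=> hphi; apply: ser_eqP => -[[j k] n].
set D := (wt 1 (j, k, n)).+1.
rewrite (@co_Sub _ _ _ flt_zz flt_ww hphi D) //.
have hj : (j < D)%N by rewrite /D /wt /=; lia.
have hk : (k < D)%N by rewrite /D /wt /=; lia.
have hn : (mdeg n < D)%N by rewrite /D /wt /=; lia.
rewrite (@box_sum _ m D (fun y => co f y * co (submono zz ww (fun i => pser (phi i)) y) (j, k, n))).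
pose F c := (pmonomial phi c n)%:C%C.
have hF a b c : co (submono zz ww (fun i => pser (phi i)) (a, b, c)) (j, k, n) =
    F c *+ (a == j) *+ (b == k).
  rewrite /submono /= -pser_monomial.
  have -> : zz ^+ a * ww ^+ b = mono R (a, b, 0%MM) by rewrite monoE mono0 mulr1.
  case: (a =P j) => [->|hne].
    case: (b =P k) => [->|hne].
      rewrite !mulr1n; have -> : (j, k, n) = ixadd (j, k, 0%MM) (0%N, 0%N, n).
        by rewrite /ixadd /= !addn0 add0m.
      by rewrite coM_mono.
    rewrite mulr0n; apply: coM_eq0 => y z e; rewrite co_mono.
    case: eqP => ey; last by rewrite mul0r.
    rewrite (supp_co (proj1 (param_rp _))) ?mulr0 //.
    apply/negP => /eqP hz; apply: hne; move: e; rewrite ey /ixadd /= => -[] _ <- _.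
    by move: hz; lia.
  rewrite mulr0n mul0rn; apply: coM_eq0 => y z e; rewrite co_mono.
  case: eqP => ey; last by rewrite mul0r.
  rewrite (supp_co (proj1 (param_rp _))) ?mulr0 //.
  apply/negP => /eqP hz; apply: hne; move: e; rewrite ey /ixadd /= => -[] <- _ _.
  by move: hz; lia.
transitivity (\sum_(a < D) (\sum_(b < D) (\sum_(c : 'X_{1..m < D})
   co f (nat_of_ord a, nat_of_ord b, bmnm c) * F (bmnm c)) *+ (nat_of_ord b == k)) *+ (nat_of_ord a == j)); last first.
  apply: eq_bigr => a _; rewrite -sumrMnl; apply: eq_bigr => b _.
  rewrite -!sumrMnl; apply: eq_bigr => c _.
  by rewrite hF -!mulrnAr mulrnAC.
rewrite (@ord_sum_delta _ D (fun a => \sum_(b < D) (\sum_(c : 'X_{1..m < D})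
   co f (a, nat_of_ord b, bmnm c) * F (bmnm c)) *+ (nat_of_ord b == k))) hj mulr1n.
rewrite (@ord_sum_delta _ D (fun b => (\sum_(c : 'X_{1..m < D})
   co f (j, b, bmnm c) * F (bmnm c)))) hk mulr1n.
symmetry; apply: (bmnm_sum_widen (F := fun c => co f (j, k, c) * F c)) => // c hc.
suff -> : F c = 0 by rewrite mulr0.
have := flt_co (flt_submono flt_zz flt_ww hphi (0%N, 0%N, c)) (x := (0%N, 0%N, n)).
rewrite /submono /= !expr0 !mul1r -pser_monomial /wt /=; apply.
by rewrite !add0n !mul1n.
Qed.

(** The changes of parameters; they fix s = zw, hence act separately on the
    coefficients of its powers. *)
Record psub (T : A -> A) : Prop := Psub {
  psub_alg :> alg T;
  psub_zz : T zz = zz;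
  psub_ww : T ww = ww;
  psub_mu : forall i, rp (T (mu R i)) }.

Lemma psub_Sub (phi : 'I_m -> A) : (forall i, flt 1 1 (phi i)) ->
  (forall i, rp (phi i)) -> psub (Sub zz ww phi).
Proof.
move=> h hr; have ha := Sub_alg flt_zz flt_ww h; split=> // [||i].
- exact: (Sub_zz flt_zz flt_ww h).
- exact: (Sub_ww flt_zz flt_ww h).
by rewrite (Sub_mu flt_zz flt_ww h).
Qed.

Lemma psub_ss T : psub T -> T (ss R m) = ss R m.
Proof. by move=> h; rewrite (algM h) (psub_zz h) (psub_ww h). Qed.

Lemma psub_star T f : psub T -> star (T f) = T (star f).
Proof.
move=> h; apply: (alg_star f h); first by rewrite (psub_zz h) (psub_ww h) star_zz.
by move=> i; have [] := psub_mu h i.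
Qed.

Lemma psub_rad T f : psub T -> rad f -> rad (T f).
Proof.
move=> h; apply: (alg_rad h); first by rewrite (psub_ss h); have [] := rr_ss R m.
by move=> i; apply: par_rad; have [] := psub_mu h i.
Qed.

Lemma psub_rr T f : psub T -> rr f -> rr (T f).
Proof. by move=> h [hf e]; split; [exact: psub_rad|rewrite psub_star // e]. Qed.

Lemma psub_rp T f : psub T -> rp f -> rp (T f).
Proof.
move=> h [hf e]; split; last by rewrite psub_star // e.
by apply: (alg_par h) hf => i; have [] := psub_mu h i.
Qed.

Lemma psub_comp T T' : psub T -> psub T' -> psub (T \o T').
Proof.
move=> h h'; split=> [|||i] /=; first exact: (alg_comp (psub_alg h) (psub_alg h')).
- by rewrite (psub_zz h') (psub_zz h).
- by rewrite (psub_ww h') (psub_ww h).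
exact: (psub_rp h (psub_mu h' i)).
Qed.

Lemma psub_ext T T' f : psub T -> psub T' ->
  (forall i, T (mu R i) = T' (mu R i)) -> T f = T' f.
Proof.
move=> h h' e; apply: (alg_ext h h') => //; first by rewrite (psub_zz h) (psub_zz h').
by rewrite (psub_ww h) (psub_ww h').
Qed.

Lemma psub_id : psub id.
Proof. by split=> // i; exact: rp_mu. Qed.

Lemma psub_near T : psub T -> (forall i, flt 1 2 (T (mu R i) - mu R i)) -> near T.
Proof.
move=> h hm; apply: (alg_near h) => //.
  by rewrite (psub_zz h) subrr; exact: flt0.
by rewrite (psub_ww h) subrr; exact: flt0.
Qed.

Lemma psub_inv T : psub T -> (forall i, flt 1 2 (T (mu R i) - mu R i)) ->
  exists T', [/\ psub T', forall f, T (T' f) = f, forall f, T' (T f) = f &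
    forall i, flt 1 2 (T' (mu R i) - mu R i)].
Proof.
move=> h hm; have hn := psub_near h hm; have hO := algO h.
have : forall i, exists g, rp g /\ T g = mu R i.
  move=> i; have [|||g] := @near_surj _ _ (@rp R m) T (mu R i) hO hn (@closed_rp _ _ 1).
  - exact: rpB.
  - by move=> f; exact: psub_rp.
  - exact: rp_mu.
  by exists g.
move=> /choice [phi hphi].
have hf i : flt 1 2 (phi i - mu R i).
  have [_ e] := hphi i; rewrite -e -opprB; apply/fltN.
  have h0 : flt 1 1 (phi i).
    have hd : flt 1 1 (T (phi i) - phi i) by apply: hn; exact: flt_0.
    have -> : phi i = mu R i - (T (phi i) - phi i) by rewrite e; ring.
    by apply: fltB => //; exact: flt_mu.
  exact: hn.
have h1 i : flt 1 1 (phi i).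
  rewrite -(subrK (mu R i) (phi i)); apply: fltD; first by apply: (flt_le (hf i)).
  exact: flt_mu.
have hP := psub_Sub h1 (fun i => proj1 (hphi i)).
have eP i : Sub zz ww phi (mu R i) = phi i by exact: (Sub_mu flt_zz flt_ww h1).
have e1 f : T (Sub zz ww phi f) = f.
  apply: (psub_ext f (psub_comp h hP) psub_id) => i /=; rewrite eP.
  by case: (hphi i).
exists (Sub zz ww phi); split=> // [f|i]; last by rewrite eP.
by apply: (near_inj hO hn); rewrite e1.
Qed.

End Substitution.

(** * Near-identity maps as exponentials, inverses and square roots *)

Section NearIdentity.
Variables (R : realType) (m : nat).
Local Notation C := R[i].
Local Notation A := (ser R m).
Implicit Types (f g h y : A) (x : idx m) (p q : nat).
Local Notation zz := (zz R m).
Local Notation cst := (@cst R m).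

Lemma osumB (F G : nat -> A) : osum (fun l => F l - G l) = osum F - osum G.
Proof. by apply: ser_eqP => x; rewrite coB !co_osumE -sumrB. Qed.

Definition exp_tail y : A :=
  osum (fun l => ifac R m l.+2 * iter l.+2 (vder (fld y)) zz).

Lemma flt_iter_zz y l : flt 1 2 y -> flt 1 l.+1 (iter l (vder (fld y)) zz).
Proof.
by move=> hy; rewrite -(add1n l); apply: flt_iter; [apply/raising_vder/vflt_fld|exact: flt_zz].
Qed.

Lemma expd_zz y : flt 1 2 y -> expd y zz = zz + y + exp_tail y.
Proof.
move=> hy; rewrite expdE osum_recl; last first.
  by move=> l; apply/fltMr/(flt_le (flt_iter_zz l hy)).
rewrite osum_recl; last first.
  by move=> l; apply/fltMr/(flt_le (flt_iter_zz l.+1 hy)); lia.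
rewrite addrA ifac0 mul1r /= vder_zz /=.
have -> : ifac R m 1 = 1 by have := ifacS R m 0; rewrite ifac0.
by rewrite mul1r.
Qed.

Lemma moving_vder y f : moving y -> moving (vder (fld y) f).
Proof.
by move=> hy; rewrite vderE; apply: suppD; apply: movingMr => //; exact: moving_star.
Qed.

Lemma flt_iter_vderB y y' p l : flt 1 2 y -> flt 1 2 y' -> flt 1 p.+1 (y - y') ->
  flt 1 (p + l) (iter l (vder (fld y)) zz - iter l (vder (fld y')) zz).
Proof.
move=> hy hy' hp; have hr := raising_vder (vflt_fld hy).
have hO := derO (vder_der (vflt_le (vflt_fld hy) (isT : (1 <= 2)%N))).
elim: l => [|l IH] /=; first by rewrite subrr; exact: flt0.
set u := iter l _ zz; set u' := iter l _ zz.
have -> : vder (fld y) u - vder (fld y') u' = vder (fld y) (u - u') + vder (fld (y - y')) u'.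
  by rewrite (operB _ _ hO) !vderE /= starB; ring.
rewrite addnS; apply: fltD; first exact: hr.
rewrite addnC -addSn; apply: flt_vder; first exact: vflt_fld.
exact: flt_iter_zz.
Qed.

(** The logarithm of a near-identity map: its generator [y] is the fixed point of
    [y = g - z - (terms of order at least two in y)]. *)
Lemma expd_surj g : flt 1 2 (g - zz) -> moving g ->
  exists y, [/\ flt 1 2 y, moving y & expd y zz = g].
Proof.
move=> hg mg.
have [||||y [hy my] e] := @fixpt _ _ (fun y => flt 1 2 y /\ moving y) 1
   (fun y => g - zz - exp_tail y) 0.
- by split; [exact: flt0|exact: supp0].
- exact: closedI (@closed_flt _ _ _ _ _) (@closed_supp _ _ _ _).
- move=> y [hy my]; split.
    apply: fltB => //; apply: flt_osum_ge => l; apply: fltMr.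
    by apply: (flt_le (flt_iter_zz _ hy)).
  apply: suppB; first by apply: suppB => //; exact: moving_zz.
  by apply: supp_osum => l; apply: movingMr; exact: moving_vder.
- move=> p y y' [hy _] [hy' _] hp.
  have -> : g - zz - exp_tail y - (g - zz - exp_tail y') = - (exp_tail y - exp_tail y').
    by ring.
  rewrite -osumB; apply: fltN; apply: flt_osum_ge => l.
  rewrite -mulrBr; apply: fltMr.
  case: p hp => [|p] hp.
    by apply: fltB; apply: (flt_le (flt_iter_zz _ _)).
  by apply: (flt_le (flt_iter_vderB l.+2 hy hy' hp)); lia.
by exists y; split=> //; rewrite expd_zz // -{1}e; ring.
Qed.

Lemma expd_near y : flt 1 2 y -> near (expd y).
Proof.
move=> hy; have ha := expd_alg hy.
have htail f : expd y f = f + osum (fun l => ifac R m l.+1 * iter l.+1 (vder (fld y)) f).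
  rewrite expdE osum_recl ?ifac0 ?mul1r // => l; apply: fltMr.
  by rewrite -[l in flt _ l]add0n; apply: flt_iter (flt_0 _ _); apply/raising_vder/vflt_fld.
move=> p f hf; rewrite htail [f + _]addrC addrK.
apply: flt_osum_ge => l; apply: fltMr; apply: (@fltW _ _ _ _ (p + l.+1)); first lia.
by apply: flt_iter => //; apply/raising_vder/vflt_fld.
Qed.

Lemma expd_mu y i : flt 1 2 y -> expd y (mu R i) = mu R i.
Proof.
move=> hy; rewrite expdE osum_recl; last first.
  move=> l; apply: fltMr; rewrite -[l in flt _ l]add0n.
  by apply: flt_iter (flt_0 _ _); apply/raising_vder/vflt_fld.
rewrite ifac0 mul1r /= -[RHS]addr0; congr (_ + _).
apply: ser_eqP => x; rewrite co_osumE big1 // => l _.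
rewrite -iterS iterSr vder_mu.
have hO := derO (vder_der (vflt_le (vflt_fld hy) (isT : (1 <= 2)%N))).
have -> : iter l (vder (fld y)) 0 = 0 by elim: (nat_of_ord l) => //= k ->; exact: oper0.
by rewrite mulr0.
Qed.

Lemma star_expd y f : star (expd y f) = expd y (star f).
Proof.
rewrite !expdE; transitivity (osum (fun l => star (ifac R m l * iter l (vder (fld y)) f))).
  apply: ser_eqP => x; rewrite co_star !co_osumE wt_swap rmorph_sum.
  by apply: eq_bigr.
apply: eq_osum => l; rewrite starM star_cst conjc_real; congr (_ * _).
by elim: l => //= l <-; rewrite star_vder.
Qed.

(** Units and square roots inside a class of series that is closed under the
    ring operations and under limits. *)
Record good (P : A -> Prop) : Prop := Good {
  good1 : P 1;
  goodB : forall f g, P f -> P g -> P (f - g);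
  goodM : forall f g, P f -> P g -> P (f * g);
  goodC : closed P 1 }.

Lemma good_rr : good (@rr R m).
Proof. by split; [exact: rr1|exact: rrB|exact: rrM|exact: closed_rr]. Qed.
Lemma good_rad : good (@rad R m).
Proof. by split; [exact: rad1|exact: suppB|exact: radM|exact: closed_supp]. Qed.

Lemma inv_exists P f : good P -> P f -> flt 1 1 (f - 1) ->
  exists g, [/\ P g, f * g = 1 & flt 1 1 (g - 1)].
Proof.
move=> gP Pf hf.
(* The inverse is the fixed point of g = 1 - (f - 1) g. *)
have [||g Pg e] := @fixpt _ _ P 1 (fun g => 1 - (f - 1) * g) 1 (good1 gP) (goodC gP).
- move=> g Pg; apply: (goodB gP (good1 gP)); apply: (goodM gP) => //.
  by apply: (goodB gP) => //; exact: good1.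
- move=> p g h _ _ hp; rewrite opprB addrC addrA subrK -mulrBr -(add1n p).
  by apply: fltM => //; rewrite -opprB; exact: fltN.
have e' : f * g = 1.
  have -> : f * g = (f - 1) * g + g by ring.
  by rewrite -{2}e addrC subrK.
exists g; split=> //; have -> : g - 1 = - ((f - 1) * g) by rewrite -{1}e; ring.
by apply/fltN/fltMl.
Qed.

Lemma sqrt_exists f : rr f -> flt 1 1 (f - 1) ->
  exists g, [/\ rr g, g * g = f & flt 1 1 (g - 1)].
Proof.
move=> rf hf; set c : A := cst ((2%:R)^-1 : R)%:C%C.
have ec : c + c = 1.
  rewrite /c -rmorphD -rmorphD /=; have -> : (2^-1 + 2^-1 : R) = 1 by field.
  by rewrite !rmorph1.
(* The root is 1 + h with h = (f - 1 - h^2) / 2. *)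
have [||||h [rh hh] e] := @fixpt _ _ (fun h => rr h /\ flt 1 1 h) 1
   (fun h => c * (f - 1 - h * h)) 0.
- by split; [exact: rr0|exact: flt0].
- exact: closedI (@closed_rr _ _ _) (@closed_flt _ _ _ _ _).
- move=> h [rh hh]; split; last by apply/fltMr/fltB => //; exact: fltMr.
  apply: rrM; first exact: rr_cst.
  by apply: rrB; [apply: rrB => //; exact: rr1|exact: rrM].
- move=> p h k [_ hh] [_ hk] hp; rewrite -mulrBr; apply: fltMr.
  have -> : f - 1 - h * h - (f - 1 - k * k) = - ((h + k) * (h - k)) by ring.
  by apply: fltN; rewrite -(add1n p); apply: fltM => //; apply: fltD.
exists (1 + h); split; [by apply: rrD => //; exact: rr1| |by rewrite addrC addKr].
have eh : h + h = f - 1 - h * h by rewrite -{1 2}e -mulrDl ec mul1r.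
have -> : (1 + h) * (1 + h) = 1 + (h + h) + h * h by ring.
by rewrite eh; ring.
Qed.

End NearIdentity.

(** * Equivariance *)

Section Equivariance.
Variables (R : realType) (m : nat).
Local Notation C := R[i].
Local Notation A := (ser R m).
Implicit Types (f g h P Q U V W H : A) (x y : idx m) (p q : nat).
Local Notation zz := (zz R m).
Local Notation cst := (@cst R m).
Local Notation ss := (ss R m).

(** On radial series this is 2 s d/ds. *)
Definition Eu f : A := thz f + thw f.

Lemma co_Eu f x : co (Eu f) x = co f x *+ (x.1.1 + x.1.2).
Proof. by rewrite mulrnDr. Qed.

Lemma Eu_der : der id Eu.
Proof.
have hz := thz_der R m; have hw := thw_der R m.
split=> [|f g]; first exact: oper_add (derO hz) (derO hw).
by rewrite /Eu (derM hz) (derM hw); ring.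
Qed.

Lemma EuM f g : Eu (f * g) = Eu f * g + f * Eu g. Proof. exact: derM Eu_der f g. Qed.
Lemma EuD f g : Eu (f + g) = Eu f + Eu g. Proof. exact: operD (derO Eu_der) f g. Qed.
Lemma EuB f g : Eu (f - g) = Eu f - Eu g. Proof. exact: operB f g (derO Eu_der). Qed.

Lemma Eu_mono x : Eu (mono R x) = mono R x *+ (x.1.1 + x.1.2).
Proof. by rewrite /Eu thz_mono thw_mono -mulrnDr. Qed.

Lemma Eu_ss : Eu ss = ss *+ 2.
Proof. by rewrite -[ss]expr1 ssE; exact: (Eu_mono (1%N, 1%N, 0%MM)). Qed.

Lemma Eu_par f : par f -> Eu f = 0.
Proof.
move=> h; apply: ser_eqP => x; rewrite co_Eu.
case: (boolP ((x.1.1 + x.1.2)%N == 0%N)) => hx; first by rewrite (eqP hx) mulr0n.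
by rewrite (supp_co h) // mul0rn.
Qed.

Lemma flt_Eu a p f : flt a p f -> flt a p (Eu f).
Proof. by move=> h; split=> x hx; rewrite co_Eu (flt_co h) // mul0rn. Qed.
Lemma rad_Eu f : rad f -> rad (Eu f).
Proof. by move=> h; split=> x hx; rewrite co_Eu (supp_co h) // mul0rn. Qed.
Lemma star_Eu f : star (Eu f) = Eu (star f).
Proof. by apply: ser_eqP => x; rewrite co_star !co_Eu co_star rmorphMn /= addnC. Qed.
Lemma rr_Eu f : rr f -> rr (Eu f).
Proof. by move=> [h e]; split; [exact: rad_Eu|rewrite star_Eu e]. Qed.

Lemma thzw_rad f : rad f -> thz f = thw f.
Proof.
move=> h; apply: ser_eqP => x; rewrite co_thz co_thw.
case: (boolP (x.1.1 == x.1.2)) => hx; first by rewrite (eqP hx).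
by rewrite (supp_co h) // !mul0rn.
Qed.

Definition ii : A := cst 'i%C.
Lemma ii2 : ii * ii = -1.
Proof.
rewrite /ii -rmorphM /= -expr2 (_ : 'i%C ^+ 2 = -1); first by rewrite rmorphN1.
exact: sqr_i.
Qed.
Lemma star_ii : star ii = - ii.
Proof. by rewrite star_cst -rmorphN; congr cst; apply/eqP; rewrite eq_complex /= oppr0 !eqxx. Qed.
Lemma rad_ii : rad ii. Proof. exact: rad_cst. Qed.

(** An equivariant field z U d/dz + conjugate; here U = P + iQ with P, Q real,
    so that P is the radial speed and Q the angular speed. *)
Lemma vder_equi U f : vder (fld (zz * U)) f = thz f * U + thw f * star U.
Proof.
rewrite vderE /= starM star_zz !mulrA [pz f * _]mulrC [pw f * _]mulrC.
by rewrite zz_pz ww_pw.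
Qed.

Lemma vder_equi_rad P Q f : rr P -> rr Q -> rad f ->
  vder (fld (zz * (P + ii * Q))) f = P * Eu f.
Proof.
move=> [_ eP] [_ eQ] hf; rewrite vder_equi starD starM eP eQ star_ii /Eu thzw_rad //.
ring.
Qed.

Lemma vder_equi_zz P Q H : rr P -> rr Q -> rad H ->
  vder (fld (zz * (P + ii * Q))) (zz * H) = zz * ((P + ii * Q) * H + P * Eu H).
Proof.
move=> hP hQ hH; rewrite vderM vder_zz /= vder_equi_rad //; ring.
Qed.

Lemma flt_vder_equi_tail U p f : flt 1 1 (U - ii) -> flt 1 p f ->
  flt 1 p.+1 (thz f * (U - ii) + thw f * star (U - ii)).
Proof.
move=> hU hf; rewrite -(addn1 p); apply: fltD; apply: fltM => //; try exact: flt_star.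
  by apply: (operF (derO (thz_der R m))).
by apply: (operF (derO (thw_der R m))).
Qed.

(** The indices of z times a radial series: the eigenvectors of the rotation that
    have the same eigenvalue as z. *)
Definition ch1 : pred (idx m) := fun x => x.1.1 == x.1.2.+1.

(** The rotation is the semisimple part of an equivariant field, so a conjugation
    between two equivariant fields commutes with it.  The induction is on the
    precision: the remainders [U - ii] and [V - ii] raise the order, so that
    comparing both sides of the conjugation leaves, at an index of the wrong
    eigenvalue, a nonzero multiple of the coefficient of [K f]. *)
Lemma equivariant_aux (K : A -> A) U V : oper K -> rad U -> rad V ->
  flt 1 1 (U - ii) -> flt 1 1 (V - ii) ->
  (forall f, K (vder (fld (zz * U)) f) = vder (fld (zz * V)) (K f)) ->
  forall d p f x, flt 1 p f -> supp ch1 f -> ~~ ch1 x -> (wt 1 x < p + d)%N ->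
  co (K f) x = 0.
Proof.
move=> hK rU rV hU hV e; elim=> [|d IH] p f x hf sf nx hx.
  by rewrite addn0 in hx; rewrite (flt_co (operF hK hf)).
have split_der W g : rad W -> vder (fld (zz * W)) g =
   ii * (thz g - thw g) + (thz g * (W - ii) + thw g * star (W - ii)).
  by move=> rW; rewrite vder_equi starB star_ii; ring.
have rot1 : thz f - thw f = f.
  apply: ser_eqP => y; rewrite coB co_thz co_thw.
  case: (boolP (ch1 y)) => [/eqP -> | hy]; first by rewrite mulrS addrK.
  by rewrite (supp_co sf) // !mul0rn subrr.
have sM g W : supp ch1 g -> rad W -> supp ch1 (g * W).
  by apply: suppM => y z /=; rewrite /ch1 /= => /eqP -> /eqP ->.
have sth g : supp ch1 g -> supp ch1 (thz g) /\ supp ch1 (thw g).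
  by move=> hg; split; split=> y hy; rewrite ?co_thz ?co_thw (supp_co hg) // mul0rn.
have := e f; rewrite !split_der // rot1 (operD hK) (operZ hK) => /(congr1 (fun g : A => co g x)).
rewrite !coD !coZ coB co_thz co_thw.
have -> : co (K (thz f * (U - ii) + thw f * star (U - ii))) x = 0.
  apply: (IH p.+1); [exact: flt_vder_equi_tail| | by [] | by rewrite addSnnS].
  have [s1 s2] := sth f sf.
  have rW : rad (U - ii) by apply: suppB => //; exact: rad_ii.
  by apply: suppD; apply: sM => //; exact: rad_star.
have tail g W : rad W -> flt 1 1 W -> (forall y, ~~ ch1 y -> (wt 1 y < p + d)%N -> co g y = 0) ->
    co (g * W) x = 0.
  move=> rW hW hg; apply: coM_eq0 => y z exy.
  case: (boolP (z.1.1 == z.1.2)) => hz; last by rewrite (supp_co rW) ?mulr0.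
  case: (ltnP (wt 1 z) 1) => hz1; first by rewrite (flt_co hW) ?mulr0.
  rewrite hg ?mul0r //; first by move: nx hz; rewrite -exy /ch1 /=; lia.
  by move: hx; rewrite -exy wtD; lia.
have IHf y : ~~ ch1 y -> (wt 1 y < p + d)%N -> co (K f) y = 0 by exact: IH hf sf.
have rW : rad (V - ii) by apply: suppB => //; exact: rad_ii.
rewrite !tail //; try exact: rad_star; try exact: flt_star.
- rewrite !addr0; move: (co (K f) x) => c h0.
  have i0 : 'i%C != 0 :> C.
    by apply/eqP => /(congr1 (@complex.Im R)) /eqP; rewrite /= oner_eq0.
  have h := mulfI i0 h0.
  have : c *+ x.1.2.+1 == c *+ x.1.1 by rewrite mulrS {1}h subrK.
  rewrite -[c *+ x.1.2.+1]mulr_natr -[c *+ x.1.1]mulr_natr.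
  rewrite -subr_eq0 -mulrBr mulf_eq0 => /orP[/eqP //|].
  by rewrite subr_eq0 eqr_nat eq_sym => h1; move: nx; rewrite /ch1 h1.
- by move=> y hy hd; rewrite co_thw IHf // mul0rn.
by move=> y hy hd; rewrite co_thz IHf // mul0rn.
Qed.

Lemma ch1_zz g : supp ch1 g -> exists2 H, rad H & g = zz * H.
Proof.
move=> hg; exists ((fun j k n => g j.+1 k n) : A).
  split=> -[[j k] n] /= hjk; apply: (supp_co hg (x := (j.+1, k, n))).
  by rewrite /ch1 /= eqSS.
apply: ser_eqP => -[[[|j] k] n].
  by rewrite (supp_co hg) // [RHS](@coM_mono0 _ _ (1%N, 0%N, 0%MM)).
by rewrite -ixadd_z [RHS](coM_mono (1%N, 0%N, 0%MM)) ixadd_z.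
Qed.

Lemma equivariant (K : A -> A) U V : oper K -> rad U -> rad V ->
  flt 1 1 (U - ii) -> flt 1 1 (V - ii) ->
  (forall f, K (vder (fld (zz * U)) f) = vder (fld (zz * V)) (K f)) ->
  exists2 H, rad H & K zz = zz * H.
Proof.
move=> hK rU rV hU hV e; apply: ch1_zz; split=> x hx.
apply: (@equivariant_aux K U V hK rU rV hU hV e (wt 1 x).+1 0) => //.
exact: (@supp_mono _ _ _ (1%N, 0%N, 0%MM)).
Qed.

Lemma flt_zz_cancel p f : flt 1 p.+1 (zz * f) -> flt 1 p f.
Proof.
move=> h; split=> x hx; rewrite -(coM_mono (1%N, 0%N, 0%MM)) (flt_co h) // wtD /wt /=.
by move: hx; rewrite /wt mdeg0; lia.
Qed.

(** [Eu] multiplies z^j w^k mu^n by j + k, which vanishes on parametric terms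
    only. *)
Lemma Eu_primitive f : rr f -> (forall n, co f (0%N, 0%N, n) = 0) ->
  exists2 g, rr g & Eu g = f.
Proof.
move=> [rf sf] h0.
exists ((fun j k n => ((j + k)%:R^-1 : C) * f j k n) : A).
  split; first by split=> -[[j k] n] hx; rewrite /co /=; have := supp_co rf hx; rewrite /co /= => ->; rewrite mulr0.
  apply: ser_eqP => -[[j k] n]; rewrite co_star /co /= rmorphM fmorphV rmorph_nat addnC.
  by congr (_ * _); have := congr1 (fun g => co g (j, k, n)) sf.
apply: ser_eqP => -[[j k] n]; rewrite co_Eu /co /=.
case: (posnP (j + k)) => hjk.
  rewrite hjk mulr0n; have [-> ->] : j = 0%N /\ k = 0%N by lia.
  by rewrite [RHS]h0.
by rewrite -[LHS]mulr_natl mulrA mulfV ?mul1r // pnatr_eq0 -lt0n.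
Qed.

End Equivariance.
Arguments ii R m : clear implicits.

(** * Coefficients of the powers of s *)

Section Slots.
Variables (R : realType) (m : nat).
Local Notation A := (ser R m).
Implicit Types (f g h : A) (x y : idx m) (c p q k : nat).
Local Notation ss := (ss R m).

Lemma co_ss k f x : co (ss ^+ k * f) (ixadd (k, k, 0%MM) x) = co f x.
Proof. by rewrite ssE coM_mono. Qed.

Lemma ixadd_ss k i j (n : 'X_{1..m}) : ixadd (k, k, 0%MM) (i, j, n) = ((k + i)%N, (k + j)%N, n).
Proof. by rewrite /ixadd /= add0m. Qed.

Lemma co_ss_lt k f i j n : (i < k)%N -> co (ss ^+ k * f) (i, j, n) = 0.
Proof.
move=> h; rewrite ssE coM_mono0 // => y /(congr1 (fun t : idx m => t.1.1)) /= e.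
by move: h; rewrite -e ltnNge leq_addr.
Qed.

Lemma flt_ss c k : flt c (2 * k) (ss ^+ k).
Proof.
by have := @flt_mono R m c (k, k, 0%MM); rewrite -ssE /wt /= mdeg0 muln0 addn0 addnn mul2n.
Qed.

Lemma flt_ssM c p k f : flt c p f -> flt c (2 * k + p) (ss ^+ k * f).
Proof. by move=> h; apply: fltM => //; exact: flt_ss. Qed.

Lemma co_ss_par k i f n : par f ->
  co (ss ^+ i * f) (k, k, n) = co f (0%N, 0%N, n) *+ (k == i).
Proof.
move=> hf; case: (ltngtP k i) => h; first by rewrite co_ss_lt.
  rewrite -(subnKC (ltnW h)) -ixadd_ss co_ss mulr0n (supp_co hf) //=.
  by rewrite addn_eq0 subn_eq0 leqNgt h.
by rewrite h -[in (i, i, n)](addn0 i) -ixadd_ss co_ss.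
Qed.

(** [slot k f] is the coefficient of s^k in a radial series f, and [shift k f]
    the quotient of its part of order at least k in s by s^k. *)
Definition slot k f : A := fun i j n =>
  if (i + j == 0)%N then co f (k, k, n) else 0.
Definition shift k f : A := fun i j n => co f ((k + i)%N, (k + j)%N, n).

Lemma co_slot k f n : co (slot k f) (0%N, 0%N, n) = co f (k, k, n).
Proof. by []. Qed.

Lemma slotB k f g : slot k (f - g) = slot k f - slot k g.
Proof.
apply: ser_eqP => -[[i j] n]; rewrite coB /co /slot /=.
by case: ifP; rewrite ?subrr.
Qed.
Lemma shiftB k f g : shift k (f - g) = shift k f - shift k g.
Proof. by apply: ser_eqP => -[[i j] n]. Qed.

Lemma slot_rp k f : rr f -> rp (slot k f).
Proof.
move=> [hf e]; split; first by split=> -[[i j] n] /= hx; rewrite /co /slot /= (negbTE hx).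
apply: ser_eqP => -[[i j] n]; rewrite co_star /co /slot /= addnC.
case: ifP => _; last by rewrite rmorph0.
by rewrite -[in RHS]e co_star.
Qed.
Lemma shift_rr k f : rr f -> rr (shift k f).
Proof.
move=> [hf e]; split.
  by split=> -[[i j] n] /= hx; rewrite /co /shift /= (supp_co hf) //= eqn_add2l.
apply: ser_eqP => -[[i j] n]; rewrite co_star /co /shift /=.
by rewrite -[in RHS]e co_star.
Qed.

Lemma flt_slot c p k f : flt c p f -> flt c p (ss ^+ k * slot k f).
Proof.
move=> h; split=> -[[i j] n] hw.
have hs : par (slot k f) by split=> -[[i' j'] n'] /= hx; rewrite /co /slot /= (negbTE hx).
case: (i =P j) => [e|/eqP e]; last first.
  apply: (supp_co (radM (radX k (proj1 (rr_ss R m))) (par_rad hs))); exact: e.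
rewrite -{}e {j} in hw *; rewrite co_ss_par //; case: (i =P k) => [e|//].
by rewrite -e co_slot mulr1n (flt_co h).
Qed.

Lemma flt_slot_drop c p k f : flt c (2 * k + p) f -> flt c p (slot k f).
Proof.
move=> h; split=> -[[i j] n] hw; rewrite {1}/co /slot /=; case: ifP => // hij.
by rewrite (flt_co h) //; move: hw hij; rewrite /wt /=; lia.
Qed.

Lemma flt_shift c p k f : flt c (2 * k + p) f -> flt c p (shift k f).
Proof.
move=> h; split=> -[[i j] n] hw; rewrite /co /shift /= (flt_co h) //.
by move: hw; rewrite /wt /=; lia.
Qed.

End Slots.

(** * The normal form equation *)

Section Core.
Variables (R : realType) (m N : nat).
Hypothesis hN : (1 <= N)%N.
Local Notation C := R[i].
Local Notation A := (ser R m).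
Implicit Types (f g h P Q L b : A) (x y : idx m) (p q k : nat) (chi : 'I_N -> A).
Implicit Types (a : R).
Local Notation cst := (@cst R m).
Local Notation ss := (ss R m).
Local Notation al := (2 * N + 1)%N.

(** At [f = s] this is the radial speed of the normal form: an unfolding of s^N by
    the functions [chi] of the parameters. *)
Definition unf a chi f : A := cst a%:C%C * f ^+ N + \sum_(i < N) chi i * f ^+ i.

(** Let z (P + iQ) be an equivariant field.  The substitution z -> zH, w -> wH,
    with H real radial and L = H^2, maps s to sL, and the transformed field has
    the ratio p/q of radial and angular speed, where p = [unf a chi] and
    q = 1 + b s^N, exactly if 2 L p(sL) Q = P (2L + Eu L) q(sL). *)
Definition core a P Q L chi b : A :=
  L * unf a chi (ss * L) * Q *+ 2 - P * (L *+ 2 + Eu L) * (1 + b * (ss * L) ^+ N).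

(** The linearization at L = 1, chi = 0, b = 0.  Its coefficients of s^k mu^n
    involve, up to a factor, chi_k alone for k < N and the coefficient of
    s^(k - N) in L alone for k >= N, except that the latter drops out for
    k = 2N, where b takes its place. *)
Definition core_lin a chi L b : A :=
  (\sum_(i < N) ss ^+ i * chi i) *+ 2 + cst a%:C%C * (ss ^+ N * (L *+ (2 * N) - Eu L))
  - cst a%:C%C * (ss ^+ (N + N) * b) *+ 2.

Section Congruence.
Variable c : nat.
Definition cg p f g := flt c p (f - g).

Lemma eq_flt p f g : flt c p f -> g = f -> flt c p g.
Proof. by move=> h ->. Qed.
Lemma fltMn p f k : flt c p f -> flt c p (f *+ k).
Proof. by move=> h; rewrite -mulr_natr; exact: fltMl. Qed.
Lemma cg_refl p f : cg p f f. Proof. by rewrite /cg subrr; exact: flt0. Qed.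
Lemma cg_trans p f g h : cg p f g -> cg p g h -> cg p f h.
Proof. by move=> h1 h2; have := fltD h1 h2; rewrite addrA subrK. Qed.
Lemma cgD p f g f' g' : cg p f g -> cg p f' g' -> cg p (f + f') (g + g').
Proof. by move=> h1 h2; have := fltD h1 h2; rewrite /cg opprD addrACA. Qed.
Lemma cgN p f g : cg p f g -> cg p (- f) (- g).
Proof. by move=> h; have := fltN h; rewrite /cg opprB opprK addrC. Qed.
Lemma cgMn p f g k : cg p f g -> cg p (f *+ k) (g *+ k).
Proof.
move=> h; rewrite /cg -mulrnBl; elim: k => [|k IH]; first exact: flt0.
by rewrite mulrS; apply: fltD.
Qed.
Lemma cg_sum p I r (F G : I -> A) : (forall i, cg p (F i) (G i)) ->
  cg p (\sum_(i <- r) F i) (\sum_(i <- r) G i).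
Proof. by move=> h; rewrite /cg -sumrB; apply: flt_sum => i _; exact: h. Qed.

Lemma cg_mul1 p f g : flt c p f -> cg 1 g 1 -> cg p.+1 (f * g) f.
Proof.
move=> hf hg; rewrite /cg; have -> : f * g - f = f * (g - 1) by ring.
by rewrite -(addn1 p); apply: fltM.
Qed.

Lemma cg1M f g : cg 1 f 1 -> cg 1 g 1 -> cg 1 (f * g) 1.
Proof.
move=> hf hg; rewrite /cg; have -> : f * g - 1 = (f - 1) * g + (g - 1) by ring.
by apply: fltD => //; apply: fltMl.
Qed.
Lemma cg1X f k : cg 1 f 1 -> cg 1 (f ^+ k) 1.
Proof.
move=> hf; elim: k => [|k IH]; first exact: cg_refl.
by rewrite exprS; exact: cg1M.
Qed.
Lemma cg_powB q k f g : cg 1 f 1 -> cg 1 g 1 -> flt c q (f - g) ->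
  cg q.+1 (f ^+ k - g ^+ k) ((f - g) *+ k).
Proof.
move=> hf hg h; elim: k => [|k IH]; first by rewrite !expr0 subrr mulr0n; exact: cg_refl.
have -> : f ^+ k.+1 - g ^+ k.+1 = (f - g) * f ^+ k + (f ^+ k - g ^+ k) * g.
  by rewrite !exprS; ring.
rewrite mulrS; apply: cgD; first by apply: cg_mul1 => //; exact: cg1X.
apply: (cg_trans _ IH); apply: cg_mul1 => //.
rewrite -(subrK ((f - g) *+ k) (_ - _)); apply: fltD; last exact: fltMn.
exact: (flt_le IH).
Qed.
End Congruence.

Section CoreEquation.
Variables (a : R) (P Q : A).
Hypotheses (hP : flt al al (P - cst a%:C%C * ss ^+ N)) (hQ : flt al 1 (Q - 1)).
Local Notation ca := (cst a%:C%C).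
Local Notation E := (core a P Q).

(** With parameters of weight 2N + 1, everything but the linear part is of higher
    weight: the chi_i outweigh s^N, and L and Q are 1 up to positive weight. *)
Lemma core_diff q L chi b L' chi' b' :
  flt al 1 (L - 1) -> flt al 1 (L' - 1) ->
  (forall i, flt al al (chi' i)) ->
  flt al q (L - L') -> flt al q (ss ^+ N * (b - b')) ->
  (forall i : 'I_N, flt al (2 * N + q) (ss ^+ i * (chi i - chi' i))) ->
  flt al (2 * N + q).+1 (E L chi b - E L' chi' b' -
    core_lin a (fun i => chi i - chi' i) (L - L') (b - b')).
Proof.
move=> hL hL' hchi' hd hb hchi; set d := L - L'.
have eE M ch e : E M ch e = (ca * (ss ^+ N * M ^+ N.+1)) * Q *+ 2 +
    (\sum_(i < N) ss ^+ i * ch i * M ^+ i.+1 * Q) *+ 2 -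
    P * ((M *+ 2 + Eu M) * (1 + e * (ss ^+ N * M ^+ N))).
  rewrite /core /unf mulrDr mulrDl mulrnDl exprMn mulr_sumr mulr_suml.
  congr (_ *+ 2 + _ *+ 2 - _); [by rewrite exprS; ring| |ring].
  by apply: eq_bigr => i _; rewrite exprMn exprS; ring.
have t1 : cg al (2 * N + q).+1
    (ca * (ss ^+ N * L ^+ N.+1) * Q - ca * (ss ^+ N * L' ^+ N.+1) * Q)
    (ca * (ss ^+ N * (d *+ N.+1))).
  have -> : ca * (ss ^+ N * L ^+ N.+1) * Q - ca * (ss ^+ N * L' ^+ N.+1) * Q =
     ca * (ss ^+ N * ((L ^+ N.+1 - L' ^+ N.+1) * Q)) by ring.
  rewrite /cg -mulrBr -mulrBr -addnS; apply/fltMr/flt_ssM.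
  have h1 := cg_powB N.+1 hL hL' hd.
  apply: (cg_trans _ h1); apply: cg_mul1 => //.
  rewrite -(subrK (d *+ N.+1) (_ - _)); apply: fltD; last exact: fltMn.
  exact: (flt_le h1).
have t2 : cg al (2 * N + q).+1
   (\sum_(i < N) ss ^+ i * chi i * L ^+ i.+1 * Q - \sum_(i < N) ss ^+ i * chi' i * L' ^+ i.+1 * Q)
   (\sum_(i < N) ss ^+ i * (chi i - chi' i)).
  rewrite -sumrB; apply: cg_sum => i.
  have -> : ss ^+ i * chi i * L ^+ i.+1 * Q - ss ^+ i * chi' i * L' ^+ i.+1 * Q =
    ss ^+ i * (chi i - chi' i) * (L ^+ i.+1 * Q) +
    (chi' i * (L ^+ i.+1 - L' ^+ i.+1)) * (ss ^+ i * Q) by ring.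
  rewrite -[X in cg _ _ _ X]addr0; apply: cgD.
    by apply: cg_mul1 => //; apply: cg1M => //; exact: cg1X.
  rewrite /cg subr0; apply: fltMl.
  apply: (@fltW _ _ _ _ (al + q)); first lia.
  apply: fltM => //; rewrite subrXX; exact: fltMl.
have tB : cg al q.+1 ((L *+ 2 + Eu L) * (1 + b * (ss ^+ N * L ^+ N)) -
      (L' *+ 2 + Eu L') * (1 + b' * (ss ^+ N * L' ^+ N)))
    (d *+ 2 + Eu d + (ss ^+ N * (b - b')) *+ 2).
  have -> : (L *+ 2 + Eu L) * (1 + b * (ss ^+ N * L ^+ N)) -
      (L' *+ 2 + Eu L') * (1 + b' * (ss ^+ N * L' ^+ N)) =
    (d *+ 2 + Eu d) * (1 + ss ^+ N * (b * L ^+ N)) +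
    ((ss ^+ N * (b - b')) * L ^+ N * (L' *+ 2 + Eu L') +
     ss ^+ N * (L ^+ N - L' ^+ N) * (b' * (L' *+ 2 + Eu L'))).
    by rewrite /d EuB; ring.
  apply: cgD.
    apply: cg_mul1.
      apply: fltD; last exact: flt_Eu.
      exact: fltMn.
    rewrite /cg addrC addKr; apply: fltMl; apply: (flt_le (flt_ss _ _ _ _)); lia.
  rewrite -[X in cg _ _ _ X]addr0; apply: cgD.
    have h2 : cg al 1 (L' + cst (2^-1 : R)%:C%C * Eu L') 1.
      have e0 : Eu L' = Eu (L' - 1) by rewrite EuB (Eu_par (par1 _ _)) subr0.
      rewrite /cg addrAC; apply: fltD => //; apply: fltMr; rewrite e0.
      exact: flt_Eu.
    have -> : L' *+ 2 + Eu L' = (L' + cst (2^-1 : R)%:C%C * Eu L') *+ 2.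
      rewrite mulrnDl; congr (_ + _); rewrite -mulrnAl -!rmorphMn /=.
      have -> : (2^-1 : R) *+ 2 = 1 by rewrite -[LHS]mulr_natr mulVf // pnatr_eq0.
      by rewrite !rmorph1 mul1r.
    rewrite mulrnAr; apply: cgMn; rewrite -mulrA; apply: cg_mul1 => //.
    by apply: cg1M => //; exact: cg1X.
  rewrite /cg subr0; apply: fltMl; apply: (@fltW _ _ _ _ (2 * N + q)); first lia.
  by apply: flt_ssM; rewrite subrXX; exact: fltMl.
have tP : cg al (2 * N + q).+1
   (P * ((L *+ 2 + Eu L) * (1 + b * (ss ^+ N * L ^+ N)) -
      (L' *+ 2 + Eu L') * (1 + b' * (ss ^+ N * L' ^+ N))))
   (ca * (ss ^+ N * (d *+ 2 + Eu d + (ss ^+ N * (b - b')) *+ 2))).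
  set W := d *+ 2 + _ + _; set V := (X in P * X).
  have hW : flt al q W.
    apply: fltD; last first.
      exact: fltMn.
    apply: fltD; last exact: flt_Eu.
    exact: fltMn.
  rewrite /cg; have -> : P * V - ca * (ss ^+ N * W) =
    (P - ca * ss ^+ N) * W + P * (V - W) by ring.
  apply: fltD; first by apply: (flt_le (fltM hP hW)); lia.
  have hP0 : flt al (2 * N) P.
    rewrite -(subrK (ca * ss ^+ N) P); apply: fltD; first by apply: (flt_le hP); lia.
    by apply: fltMr; exact: flt_ss.
  by apply: (flt_le (fltM hP0 tB)); lia.
have := cgD (cgD (cgMn 2 t1) (cgMn 2 t2)) (cgN tP).
move=> hh; apply: (eq_flt hh).
rewrite !eE /core_lin exprD.
move: (\sum_(i < N) ss ^+ i * chi i * L ^+ i.+1 * Q)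
  (\sum_(i < N) ss ^+ i * chi' i * L' ^+ i.+1 * Q)
  (\sum_(i < N) ss ^+ i * (chi i - chi' i)) => S S' S''.
have -> : d *+ N.+1 = d *+ (2 * N) *+ 1 - d *+ N + d by rewrite mulrS mul2n -addnn mulrnDr; ring.
ring.
Qed.

Lemma co_lin_lo chi L b (i : 'I_N) n : (forall j, par (chi j)) ->
  co (core_lin a chi L b) (i : nat, i : nat, n) = co (chi i) (0%N, 0%N, n) *+ 2.
Proof.
move=> hc; rewrite /core_lin coB coD !coMn !coZ !co_ss_lt ?ltn_addr // !mulr0 mul0rn.
rewrite addr0 subr0; congr (_ *+ 2); rewrite co_sum (bigD1 i) //= co_ss_par // eqxx mulr1n.
rewrite big1 ?addr0 // => j hj; rewrite co_ss_par // (_ : _ == _ = false) ?mulr0n //.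
by apply/negbTE; rewrite eq_sym.
Qed.

Lemma co_lin_hi chi L b j n : (forall j, par (chi j)) -> par b ->
  co (core_lin a chi L b) ((N + j)%N, (N + j)%N, n) =
  a%:C%C * (co L (j, j, n) *+ (2 * N) - co L (j, j, n) *+ (2 * j))
   - (a%:C%C * co b (0%N, 0%N, n) *+ 2) *+ (j == N).
Proof.
move=> hc hb; rewrite /core_lin coB coD !coMn !coZ (@co_ss_par _ _ (N + j) (N + N) b n hb) eqn_add2l.
rewrite co_sum big1 => [|i _]; last first.
  by rewrite co_ss_par // gtn_eqF ?mulr0n // ltn_addr.
rewrite mul0rn add0r -ixadd_ss co_ss coB coMn co_Eu /= addnn.
by rewrite mulrnAr mulrnAC !mul2n.
Qed.

(** The linear part is invertible on unknowns for which the coefficient of s^N in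
    L, the one direction in its kernel, is fixed. *)
Lemma core_step q chi L b : a != 0 -> (forall j, par (chi j)) -> par b -> rad L ->
  (forall n, co L (N, N, n) = 0) -> flt al (2 * N + q).+1 (core_lin a chi L b) ->
  [/\ flt al q.+1 L, flt al q.+1 (ss ^+ N * b) &
      forall i : 'I_N, flt al (2 * N + q).+1 (ss ^+ i * chi i)].
Proof.
move=> a0 hc hb hL hLN h.
have a0' : a%:C%C != 0 :> C by rewrite -(rmorph0 (real_complex R)) (inj_eq (@complexI R)).
split.
- split=> -[[j j'] n] hw; case: (j =P j') => [e|/eqP e]; last exact: (supp_co hL).
  rewrite -{}e {j'} in hw *; case: (j =P N) => [->|/eqP hj]; first exact: hLN.
  have := flt_co h (x := ((N + j)%N, (N + j)%N, n)).
  rewrite co_lin_hi // (negbTE hj) mulr0n subr0 => e.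
  have {}e : a%:C%C * (co L (j, j, n) *+ (2 * N) - co L (j, j, n) *+ (2 * j)) = 0.
    by apply: e; move: hw; rewrite /wt /=; lia.
  move/eqP: e; rewrite mulf_eq0 (negbTE a0') /= -mulr_natr -[_ *+ (2 * j)]mulr_natr.
  rewrite -mulrBr mulf_eq0 => /orP[/eqP //|].
  by rewrite subr_eq0 eqr_nat eqn_mul2l /= eq_sym (negbTE hj).
- split=> -[[j j'] n] hw; case: (j =P j') => [e|/eqP e]; last first.
    apply: (supp_co (radM (radX N (proj1 (rr_ss R m))) (par_rad hb))); exact: e.
  rewrite -{}e {j'} in hw *; rewrite co_ss_par //; case: (j =P N) => [ej|//].
  rewrite mulr1n; have := flt_co h (x := ((N + N)%N, (N + N)%N, n)).
  rewrite co_lin_hi // eqxx mulr1n subrr mulr0 sub0r => e.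
  have {}e : - (a%:C%C * co b (0%N, 0%N, n) *+ 2) = 0.
    by apply: e; move: hw; rewrite ej /wt /=; lia.
  move/eqP: e; rewrite oppr_eq0 mulrn_eq0 /= mulf_eq0 (negbTE a0') /= => /eqP //.
move=> i; split=> -[[j j'] n] hw; case: (j =P j') => [e|/eqP e]; last first.
  apply: (supp_co (radM (radX i (proj1 (rr_ss R m))) (par_rad (hc i)))); exact: e.
rewrite -{}e {j'} in hw *; rewrite co_ss_par //; case: (j =P i) => [ej|//].
rewrite mulr1n; have := flt_co h (x := (nat_of_ord i, nat_of_ord i, n)).
rewrite co_lin_lo // => e; have /eqP : co (chi i) (0%N, 0%N, n) *+ 2 = 0.
  by apply: e; move: hw; rewrite ej.
by rewrite mulrn_eq0 /= => /eqP.
Qed.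

Lemma core_weight L chi b : flt al 1 (L - 1) -> (forall i, flt al al (chi i)) ->
  flt al al (E L chi b).
Proof.
move=> hL hchi.
have hz : flt al al (E 1 (fun _ => 0) 0).
  have -> : E 1 (fun _ => 0) 0 =
     ((ca * ss ^+ N) * (Q - 1) - (P - ca * ss ^+ N)) *+ 2.
    rewrite /core /unf (Eu_par (par1 R m)) mulr1 big1 => [|i _]; last by rewrite mul0r.
    ring.
  apply: fltMn; apply: fltB => //; apply: fltM => //; apply: fltMr; exact: flt_ss.
have hd := @core_diff 0 L chi b 1 (fun _ => 0) 0 hL.
have gen (X Y Z : A) : X = X - Y - Z + Z + Y by ring.
rewrite [E L chi b](gen _ (E 1 (fun _ => 0) 0)
  (core_lin a (fun i => chi i - 0) (L - 1) (b - 0))).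
apply: fltD => //; apply: fltD.
  rewrite -[X in flt _ X _](_ : (2 * N + 0).+1 = al); last lia.
  apply: hd => [|i|||i]; rewrite ?subrr ?subr0; try exact: flt0; try exact: flt_0.
  by apply: fltMr; apply: (flt_le (hchi i)); lia.
rewrite /core_lin; apply: fltB.
  apply: fltD.
    by apply: fltMn; apply: flt_sum => i _; rewrite subr0; apply: fltMr.
  apply: fltMr; rewrite addn1 -addn1; apply: flt_ssM; apply: fltB; first exact: fltMn.
  exact: flt_Eu.
apply: fltMn; apply: fltMr; apply: fltMl; apply: (flt_le (flt_ss _ _ _ _)); lia.
Qed.

Hypotheses (a0 : a != 0) (rP : rr P) (rQ : rr Q).

Record adm L chi b : Prop := Adm {
  admL : rr L; admL1 : flt al 1 (L - 1);
  admc : forall i : 'I_N, rp (chi i); admc1 : forall i, flt al al (chi i);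
  admb : rp b }.

(** The term of lowest weight in the equation is 2 (a' - a) s^N. *)
Lemma core_lead L chi b : adm L chi b -> forall a', core a' P Q L chi b = 0 -> a' = a.
Proof.
move=> h a' e; pose U := L ^+ N.+1 * Q.
have hU : cg al 1 U 1 by apply: cg1M => //; apply: cg1X; exact: (admL1 h).
have e1 : core a' P Q L chi b = E L chi b + cst (a' - a)%:C%C * (ss ^+ N * U) *+ 2.
  rewrite /core /unf rmorphB rmorphB /= exprMn /U exprS; ring.
have h2 : flt al al (cst (a' - a)%:C%C * ss ^+ N *+ 2).
  have -> : cst (a' - a)%:C%C * ss ^+ N *+ 2 = core a' P Q L chi b - E L chi b -
     (cst (a' - a)%:C%C * (ss ^+ N * (U - 1))) *+ 2 by rewrite e1; ring.
  rewrite e sub0r; apply: fltB.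
    by apply/fltN/core_weight; [exact: (admL1 h)|exact: (admc1 h)].
  by apply/fltMn/fltMr/flt_ssM.
have := flt_co h2 (x := (N, N, 0%MM)).
rewrite coMn coZ ssE co_mono eqxx mulr1 => /(_ _)/eqP.
rewrite mulrn_eq0 /= -(rmorph0 (real_complex R)) (inj_eq (@complexI R)) subr_eq0.
by move=> hh; apply/eqP/hh; rewrite /wt /= mdeg0; lia.
Qed.

(** The differences of two solutions satisfy the linearized equation up to higher
    weight, so they vanish weight by weight. *)
Theorem core_unique L chi b L' chi' b' : adm L chi b -> adm L' chi' b' ->
  (forall n, co L (N, N, n) = co L' (N, N, n)) ->
  E L chi b = 0 -> E L' chi' b' = 0 ->
  [/\ L = L', forall i, chi i = chi' i & b = b'].
Proof.
move=> h h' hN' e e'.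
have claim q : [/\ flt al q (L - L'), flt al q (ss ^+ N * (b - b')) &
      forall i : 'I_N, flt al (2 * N + q) (ss ^+ i * (chi i - chi' i))].
  elim: q => [|q [h1 h2 h3]].
    split; try exact: flt_0; move=> i; apply: fltMr; rewrite addn0.
    by apply: fltB; [apply: (flt_le (admc1 h i))|apply: (flt_le (admc1 h' i))]; lia.
  rewrite (addnS (2 * N) q); apply: (@core_step q (fun i => chi i - chi' i)) => //.
  - by move=> j; have [] := rpB (admc h j) (admc h' j).
  - by have [] := rpB (admb h) (admb h').
  - by have [] := rrB (admL h) (admL h').
  - by move=> n; rewrite coB hN' subrr.
  have := core_diff (admL1 h) (admL1 h') (admc1 h') h1 h2 h3.
  by rewrite e e' subrr sub0r => /fltN; rewrite opprK.
have ssinj k f : (forall q, flt al q (ss ^+ k * f)) -> f = 0.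
  move=> hf; apply: ser_eqP => x; rewrite -(co_ss k).
  by rewrite (flt_co (hf _) (ltnSn _)).
split.
- by apply: (@flt_eq _ _ al) => q; have [] := claim q.
- move=> i; apply/eqP; rewrite -subr_eq0; apply/eqP; apply: (ssinj i) => q.
  by have [_ _ hi] := claim q; apply: (flt_le (hi i)); exact: leq_addl.
by apply/eqP; rewrite -subr_eq0; apply/eqP; apply: (ssinj N) => q; have [] := claim q.
Qed.

(** Decoding: a single real radial series codes all unknowns, its coefficient of
    s^k mu^n being the unknown that the coefficient of s^k mu^n of the equation
    determines. *)
Definition decL X : A := 1 + shift N X - ss ^+ N * slot (N + N) X.

Lemma decLB X Y : decL X - decL Y = shift N (X - Y) - ss ^+ N * slot (N + N) (X - Y).
Proof. by rewrite /decL shiftB slotB; ring. Qed.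

Lemma adm_dec X : rr X -> flt al al X -> adm (decL X) (fun i => slot i X) (slot (N + N) X).
Proof.
move=> rX hX; have rs := rp_rr (slot_rp (N + N) rX).
have hd : decL X - 1 = shift N X - ss ^+ N * slot (N + N) X by rewrite /decL; ring.
split=> [||i|i|] //; try exact: slot_rp.
- rewrite /decL; apply: rrB; first by apply: rrD; [exact: rr1|exact: shift_rr].
  by apply: rrM => //; apply: rrX; exact: rr_ss.
- rewrite hd; apply: fltB; first exact: flt_shift.
  by apply: (flt_le (flt_ssM N (flt_0 _ _))); lia.
split=> -[[i' j] n] hw; rewrite /co /slot /=; case: ifP => // hij.
rewrite (flt_co hX) //; move: hw (ltn_ord i); rewrite /wt /=.
by case: (mdeg n) => [|k]; rewrite ?mulnS; lia.
Qed.

(** The diagonal of the linearized equation in the coordinates of the code. *)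
Definition diag k : R :=
  if (k < N)%N then 2 else
  if k == (N + N)%N then - (a *+ 2) else a * ((2 * N)%:R - (2 * (k - N))%:R).

Lemma diag_neq0 k : diag k != 0.
Proof.
rewrite /diag; case: ifP => [_|/negbT hk]; first by rewrite pnatr_eq0.
case: ifP => [_|/negbT hk2]; first by rewrite oppr_eq0 mulrn_eq0.
rewrite mulf_neq0 // subr_eq0 eqr_nat; lia.
Qed.

Definition undiag f : A := fun i j n => ((diag i)^-1)%:C%C * f i j n.

Lemma co_undiag f x : co (undiag f) x = ((diag x.1.1)^-1)%:C%C * co f x.
Proof. by []. Qed.

Lemma undiagB f g : undiag f - undiag g = undiag (f - g).
Proof.
apply: ser_eqP => x; by rewrite coB !co_undiag -mulrBr -coB.
Qed.

Lemma undiag_rr f : rr f -> rr (undiag f).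
Proof.
move=> [hf e]; split.
  split=> -[[i j] n] /= hx; have := rad_co n hf hx.
  by rewrite co_undiag => ->; rewrite mulr0.
apply: ser_eqP => -[[i j] n]; rewrite co_star.
case: (i =P j) => [->|/eqP hx].
  have cj (r : R) (c : C) : (r%:C%C * c)^*%C = r%:C%C * c^*%C.
    by rewrite rmorphM; congr (_ * _); rewrite /= oppr0.
  rewrite !co_undiag cj; congr (_ * _).
  by have := congr1 (fun g : A => co g (j, j, n)) e.
have h1 : co f (i, j, n) = 0 by exact: rad_co.
have h2 : co f (j, i, n) = 0 by apply: rad_co => //; rewrite eq_sym.
by move: h1 h2; rewrite !co_undiag /= => -> ->; rewrite !mulr0 rmorph0.
Qed.

Lemma flt_undiag c p f : flt c p f -> flt c p (undiag f).
Proof.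
move=> h; split=> -[[i j] n] hw.
by have := flt_co h hw; rewrite co_undiag => ->; rewrite mulr0.
Qed.

Lemma undiag_lin X : rr X -> undiag (core_lin a (fun i => slot i X)
  (shift N X - ss ^+ N * slot (N + N) X) (slot (N + N) X)) = X.
Proof.
move=> rX; set Y := core_lin _ _ _ _.
have hp k : par (slot k X) by have [] := slot_rp k rX.
apply: ser_eqP => -[[i j] n]; case: (i =P j) => [<-|/eqP hij]; last first.
  rewrite (rad_co _ (proj1 rX)) //.
  suff hY : rad Y by have := rad_co n hY hij; rewrite co_undiag => ->; rewrite mulr0.
  have rs := proj1 (rr_ss R m).
  rewrite /Y /core_lin; apply: suppB.
    apply: suppD; first by rewrite -mulr_natl -(rmorph_nat cst); apply/suppZ/supp_sum => k _; apply: radM; [exact: radX|exact: par_rad].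
    apply/suppZ/radM; first exact: radX.
    have hL : rad (shift N X - ss ^+ N * slot (N + N) X).
      apply: suppB; first by have [] := shift_rr N rX.
      by apply: radM; [exact: radX|exact: par_rad].
    apply: suppB; last exact: rad_Eu.
    by rewrite -mulr_natl -(rmorph_nat cst); apply/suppZ.
  rewrite -mulr_natl -(rmorph_nat cst); apply/suppZ/suppZ.
  by apply: radM; [exact: radX|exact: par_rad].
have cdiag k (c c' : C) : (diag k)%:C%C * c' = c -> ((diag k)^-1)%:C%C * c = c'.
  by move=> <-; rewrite mulrA -rmorphM mulVf ?diag_neq0 // mul1r.
rewrite co_undiag; apply: cdiag; rewrite /diag; case: (ltnP i N) => hi.
  by rewrite (co_lin_lo _ _ (Ordinal hi)) //= -[RHS]mulr_natl rmorph_nat.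
rewrite -(subnKC hi); move: (i - N)%N => k {hi}.
rewrite co_lin_hi // eqn_add2l addKn coB.
have -> : co (shift N X) (k, k, n) = co X ((N + k)%N, (N + k)%N, n) by [].
rewrite co_ss_par // !co_slot; case: (k =P N) => [->|_].
  by rewrite !mulr1n !subrr mulr0 sub0r rmorphN mulNr rmorphMn mulrnAl.
rewrite !mulr0n !subr0 rmorphM rmorphB !rmorph_nat -mulrA mulrBl !mulr_natl //.
Qed.

Theorem core_exists : exists L chi b, [/\ adm L chi b,
  forall n, co L (N, N, n) = 0 & E L chi b = 0].
Proof.
pose F X := E (decL X) (fun i => slot i X) (slot (N + N) X).
have rF X : rr X -> flt al al X -> rr (F X).
  move=> rX hX; have h := adm_dec rX hX; have rs := rr_ss R m.
  have rsL : rr (ss * decL X) by apply: rrM => //; exact: (admL h).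
  have rb : rr (slot (N + N) X) by apply/rp_rr/slot_rp.
  have r2 f : rr f -> rr (f *+ 2) by move=> hf; rewrite mulr2n; exact: rrD.
  rewrite /F /core /unf; apply: rrB.
    apply/r2/rrM => //; apply: rrM; first exact: (admL h).
    apply: rrD; first by apply: rrM; [exact: rr_cst|exact: rrX].
    by apply: rr_sum => i _; apply: rrM; [apply/rp_rr/slot_rp|exact: rrX].
  apply: rrM; first apply: rrM => //.
    by apply: rrD; [exact: r2 (admL h)|exact: rr_Eu (admL h)].
  by apply: rrD; [exact: rr1|apply: rrM => //; exact: rrX].
have wF X : rr X -> flt al al X -> flt al al (F X).
  by move=> rX hX; have h := adm_dec rX hX; apply: core_weight (admL1 h) (admc1 h).
(* A Newton iteration with the constant diagonal of the linear part. *)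
have [||||X [rX hX] e] := @fixpt _ _ (fun X => rr X /\ flt al al X) al
   (fun X => X - undiag (F X)) 0.
- by split; [exact: rr0|exact: flt0].
- exact: closedI (@closed_rr _ _ _) (@closed_flt _ _ _ _ _).
- move=> X [rX hX]; split; first by apply: rrB => //; apply/undiag_rr/rF.
  by apply: fltB => //; apply/flt_undiag/wF.
- move=> p X Y [rX hX] [rY hY] hXY.
  have -> : X - undiag (F X) - (Y - undiag (F Y)) = (X - Y) - undiag (F X - F Y).
    have gen (x y u v : A) : x - u - (y - v) = x - y - (u - v) by ring.
    by rewrite gen undiagB.
  case: (leqP p (2 * N)) => hp.
    apply: fltB; first by apply: fltB; [apply: (flt_le hX)|apply: (flt_le hY)]; lia.
    by apply: flt_undiag; apply: fltB; [apply: (flt_le (wF X rX hX))|apply: (flt_le (wF Y rY hY))]; lia.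
  have -> : p = (2 * N + (p - 2 * N))%N by lia.
  have {}hXY : flt al (2 * N + (p - 2 * N)) (X - Y) by apply: (flt_le hXY); lia.
  move: (p - 2 * N)%N hXY => q hXY {p hp}.
  rewrite -{1}(undiag_lin (rrB rX rY)) undiagB; apply: flt_undiag.
  have aX := adm_dec rX hX; have aY := adm_dec rY hY.
  rewrite -opprB; apply: fltN.
  have e1 : (fun i : 'I_N => slot i (X - Y)) = (fun i : 'I_N => slot i X - slot i Y).
    by apply/funext => i; rewrite slotB.
  rewrite e1 slotB -slotB -decLB slotB.
  apply: (core_diff (admL1 aX) (admL1 aY) (admc1 aY)).
  - rewrite decLB; apply: fltB; first exact: flt_shift.
    have := flt_slot (N + N) hXY; rewrite exprD -mulrA => h.
    by split=> x hx; rewrite -(co_ss N) (flt_co h) // wtD /wt /= mdeg0; move: hx; rewrite /wt; lia.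
  - rewrite -slotB; have := flt_slot (N + N) hXY; rewrite exprD -mulrA => h.
    by split=> x hx; rewrite -(co_ss N) (flt_co h) // wtD /wt /= mdeg0; move: hx; rewrite /wt; lia.
  by move=> i; rewrite -slotB; exact: flt_slot.
exists (decL X), (fun i => slot i X), (slot (N + N) X); split.
- exact: adm_dec.
- move=> n; rewrite /decL coB coD co_ss_par ?co_slot ?eqxx ?mulr1n.
    rewrite co1 /= !xpair_eqE; have /negbTE -> : N != 0%N by rewrite -lt0n.
    by rewrite /= add0r subrr.
  by have [] := slot_rp (N + N) rX.
have e0 : undiag (F X) = 0.
  have -> : undiag (F X) = X - (X - undiag (F X)) by rewrite opprB addrCA subrr addr0.
  by rewrite e subrr.
apply: ser_eqP => -[[i j] n]; have := congr1 (fun g : A => co g (i, j, n)) e0.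
rewrite co_undiag => /eqP; rewrite mulf_eq0 => /orP[|/eqP //].
by rewrite -(rmorph0 (real_complex R)) (inj_eq (@complexI R)) invr_eq0 (negbTE (diag_neq0 i)).
Qed.

End CoreEquation.
End Core.

(** * Uniqueness of the normal form *)

Section Uniqueness.
Variables (R : realType) (m N : nat).
Hypothesis hN : (1 <= N)%N.
Local Notation C := R[i].
Local Notation A := (ser R m).
Implicit Types (f g h P Q L b t : A) (x : idx m) (p q k : nat) (chi : 'I_N -> A).
Implicit Types (a : R).
Local Notation zz := (zz R m).
Local Notation ww := (ww R m).
Local Notation cst := (@cst R m).
Local Notation ss := (ss R m).
Local Notation ii := (ii R m).
Local Notation al := (2 * N + 1)%N.

Lemma near_inv T : alg T -> near T -> exists T', [/\ alg T', near T',
  forall f, T (T' f) = f & forall f, T' (T f) = f].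
Proof.
move=> h hn; have hO := algO h.
have : forall g, exists f, T f = g.
  move=> g; have [||||f _ e] := @near_surj _ _ (fun _ => True) T g hO hn => //.
  by exists f.
move=> /choice [S hS].
have inj := near_inj hO hn.
have hS' f : S (T f) = f by apply: inj; rewrite hS.
have nS : near S.
  have fS p f : flt 1 p f -> flt 1 p (S f).
    move=> hf; suff : forall k, (k <= p)%N -> flt 1 k (S f) by apply.
    elim=> [|k IH] hk; first exact: flt_0.
    have := hn _ _ (IH (ltnW hk)); rewrite hS => h1.
    have -> : S f = f - (f - S f) by ring.
    by apply: fltB => //; apply: (flt_le hf).
  move=> p f hf; have := hn _ _ (fS _ _ hf); rewrite hS => /fltN.
  by rewrite opprB.
exists S; split=> //; split=> [||f g].
- split=> [f g|c f|p f hf].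
  + by apply: inj; rewrite (operD hO) !hS.
  + by apply: inj; rewrite (operZ hO) !hS.
  rewrite -(subrK f (S f)); apply: fltD => //.
  by apply: (flt_le (nS _ _ hf)).
- by apply: inj; rewrite hS (alg1 h).
by apply: inj; rewrite (algM h) !hS.
Qed.

Lemma flt1_weight c f : (0 < c)%N -> flt 1 1 f -> flt c 1 f.
Proof.
move=> hc h; split=> x hx; rewrite (flt_co h) //.
move: hx; rewrite /wt mul1n !ltnS !leqn0 !addn_eq0 muln_eq0.
by case: c hc.
Qed.

Lemma par_weight c f : par f -> flt 1 1 f -> flt c c f.
Proof.
move=> hp h; split=> -[[j k] n] hx.
case: (boolP ((j + k)%N == 0%N)) => hjk; last exact: (supp_co hp (x := (j, k, n))).
rewrite (flt_co h) //; move: hx hjk; rewrite /wt /= mul1n => hx hjk.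
suff -> : mdeg n = 0%N by lia.
by move: hx; case: (mdeg n) => // d; rewrite mulnS; lia.
Qed.

Lemma alg_unf T a chi f : alg T -> (forall i, T (chi i) = chi i) ->
  T (unf a chi f) = unf a chi (T f).
Proof.
move=> h hc; rewrite /unf (operD h) (operZ h) (algX _ _ h) (oper_sum _ _ _ (algO h)).
by congr (_ + _); apply: eq_bigr => i _; rewrite (algM h) (algX _ _ h) hc.
Qed.

Lemma rr_unf a chi f : (forall i, rp (chi i)) -> rr f -> rr (unf a chi f).
Proof.
move=> hc hf; apply: rrD; first by apply: rrM; [exact: rr_cst|exact: rrX].
by apply: rr_sum => i _; apply: rrM; [exact/rp_rr|exact: rrX].
Qed.

Lemma flt_unf a chi : (forall i, flt 1 1 (chi i)) -> flt 1 1 (unf a chi ss).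
Proof.
move=> hc; apply: fltD; first by apply: fltMr; apply: (flt_le (flt_ss _ _ 1 N)); lia.
by apply: flt_sum => i _; apply: fltMl.
Qed.

Lemma unf_lead a chi : (forall i, flt al al (chi i)) ->
  flt al al (unf a chi ss - cst a%:C%C * ss ^+ N).
Proof.
by move=> hc; rewrite /unf addrC addKr; apply: flt_sum => i _; apply: fltMl.
Qed.

Lemma ss_inj f g : ss * f = ss * g -> f = g.
Proof.
move=> e; apply: ser_eqP => x; rewrite -(co_ss 1 f) -(co_ss 1 g) expr1.
by rewrite e.
Qed.

Lemma moving0 f n : moving f -> co f (0%N, 0%N, n) = 0.
Proof. by move=> h; apply: (supp_co h (x := (0%N, 0%N, n))). Qed.

Lemma moving_Eu f : moving (Eu f).
Proof.
split=> x; rewrite negbK => /eqP hx.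
by rewrite co_Eu hx mulr0n.
Qed.

(** The flow of the radial field [rho Eu] for a time [t] gives a symmetry of the
    normal form equation: it moves points along trajectories. *)
Section Symmetry.
Variables (a : R) (chi : 'I_N -> A) (b qi : A).
Local Notation p := (unf a chi ss).
Local Notation q := (1 + b * ss ^+ N).
Hypotheses (hc : forall i, rp (chi i)) (hc1 : forall i, flt 1 1 (chi i)) (hb : rp b).
Hypotheses (rqi : rr qi) (eqi : q * qi = 1) (qi1 : flt 1 1 (qi - 1)).
Let rho : A := p * qi.

Let X f : A := Eu f * rho.
Let X' f : A := (f *+ 2 + Eu f) * rho.

Lemma rr_rho : rr rho.
Proof. by apply: rrM => //; apply: rr_unf => //; exact: rr_ss. Qed.
Lemma flt_rho : flt 1 1 rho. Proof. by apply/fltMl/flt_unf. Qed.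

Lemma flt_al_chi i : flt al al (chi i).
Proof. by apply: par_weight => //; case: (hc i). Qed.

Lemma rho_lead : flt al al (rho - cst a%:C%C * ss ^+ N).
Proof.
have -> : rho - cst a%:C%C * ss ^+ N = (p - cst a%:C%C * ss ^+ N) * qi +
   (cst a%:C%C * ss ^+ N) * (qi - 1) by rewrite /rho; ring.
apply: fltD; first by apply/fltMl/unf_lead => i; exact: flt_al_chi.
apply: fltM; first by apply/fltMr/flt_ss.
by apply: flt1_weight => //; lia.
Qed.

Lemma flt_al_rho : flt al (2 * N) rho.
Proof.
rewrite -(subrK (cst a%:C%C * ss ^+ N) rho); apply: fltD.
  by apply: (flt_le rho_lead); lia.
by apply/fltMr/flt_ss.
Qed.

Lemma X_der : der id X. Proof. exact: der_scale (Eu_der R m). Qed.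
Lemma X_raising : raising X.
Proof.
by move=> k f hf; rewrite -(addn1 k); apply: fltM; [exact: flt_Eu|exact: flt_rho].
Qed.

Lemma iterX_ss l : iter l X ss = ss * iter l X' 1.
Proof.
elim: l => [|l IH] /=; first by rewrite mulr1.
by rewrite IH /X /X' EuM Eu_ss; ring.
Qed.

(** The flow maps s to s times this series; the conjugated operator [X'] avoids a
    division by s. *)
Definition flowL t : A := flow t X' 1.

Lemma X'_raising : raising X'.
Proof.
move=> k f hf; rewrite -(addn1 k); apply: fltM; last exact: flt_rho.
by apply: fltD; [exact: fltMn|exact: flt_Eu].
Qed.

Lemma flow_ss t : flow t X ss = ss * flowL t.
Proof.
rewrite /flowL /flow [RHS]mulrC.
rewrite (oper_osum (oper_mul ss (@oper_id R m)) (smb_flow _ _ X'_raising)).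
by apply: eq_osum => l; rewrite /= iterX_ss; ring.
Qed.

Lemma flowL1 t : flt 1 1 (flowL t - 1).
Proof.
rewrite /flowL /flow osum_recl; last exact: smb_flow X'_raising.
rewrite ifac0 expr0 !mul1r /= addrC addKr; apply: flt_osum_ge => l; apply: fltMr.
by apply: (flt_le (flt_iter l.+1 X'_raising (flt_0 1 1))); lia.
Qed.

Lemma rr_iterX' l : rr (iter l X' 1).
Proof.
elim: l => [|l IH] /=; first exact: rr1.
apply: rrM; last exact: rr_rho.
by apply: rrD; [rewrite mulr2n; exact: rrD|exact: rr_Eu].
Qed.

Lemma rr_osum (F : nat -> A) : (forall l, rr (F l)) -> rr (osum F).
Proof.
move=> h; split; first by apply: supp_osum => l; case: (h l).
apply: ser_eqP => x; rewrite co_star !co_osumE wt_swap rmorph_sum; apply: eq_bigr => l _.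
by have [_ e] := h l; rewrite -[in RHS]e.
Qed.

Lemma rr_flowL t : rr t -> rr (flowL t).
Proof.
move=> ht; apply: rr_osum => l; apply: rrM; last exact: rr_iterX'.
by apply: rrM; [exact: rr_cst|exact: rrX].
Qed.

Lemma flow_fix t f : X f = 0 -> flow t X f = f.
Proof.
move=> h; rewrite /flow osum_recl; last exact: smb_flow X_raising.
rewrite ifac0 expr0 !mul1r /= -[RHS]addr0; congr (_ + _).
apply: ser_eqP => x; rewrite co_osumE big1 // => l _.
rewrite -iterS iterSr h.
have -> : iter l X 0 = 0 by elim: (nat_of_ord l) => //= k ->; exact: oper0 (derO X_der).
by rewrite mulr0.
Qed.

Lemma X_par f : par f -> X f = 0.
Proof. by move=> h; rewrite /X Eu_par // mul0r. Qed.

(** Applying [X] to the flow of s in two ways, directly and by [flow_conj], gives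
    an equation for [flowL t], in which the derivative of the time acts as a
    change [p * Eu t] of the angular speed. *)
Lemma flowL_core t : core a p (q + p * Eu t) (flowL t) chi b = 0.
Proof.
have hF := flow_alg t X_der X_raising.
set F := flow t X in hF *.
have eS : F ss = ss * flowL t by exact: flow_ss.
have ePar f : par f -> F f = f by move=> hf; apply/flow_fix/X_par.
have eU : F p = unf a chi (ss * flowL t).
  by rewrite (alg_unf _ _ hF) ?eS // => i; apply: ePar; case: (hc i).
have eq' : F q = 1 + b * (ss * flowL t) ^+ N.
  by rewrite (operD hF) (alg1 hF) (algM hF) (algX _ _ hF) eS ePar //; case: hb.
have e := flow_conj t ss X_der X_raising.
have eX : X ss = ss * rho *+ 2 by rewrite /X Eu_ss; ring.
have e1 : (flowL t *+ 2 + Eu (flowL t)) * rho =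
    (1 + Eu t * rho) * (flowL t * F rho) *+ 2.
  apply: ss_inj; rewrite -/F eX (operMn _ _ (algO hF)) (algM hF) eS in e.
  have := e; rewrite /X EuM Eu_ss => e'.
  transitivity ((ss *+ 2 * flowL t + ss * Eu (flowL t)) * rho); first ring.
  by rewrite e'; ring.
have e2 : F rho * F q = F p.
  by rewrite -(algM hF) /rho -mulrA [qi * _]mulrC eqi mulr1.
have e3 : rho * q = p by rewrite /rho -mulrA [qi * _]mulrC eqi mulr1.
rewrite /core -eU -eq' -e2 -{2}e3.
have e4 : p * Eu t = q * (Eu t * rho) by rewrite -{1}e3; ring.
rewrite e4.
have -> : rho * q * (flowL t *+ 2 + Eu (flowL t)) * F q =
   q * F q * ((flowL t *+ 2 + Eu (flowL t)) * rho) by ring.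
by rewrite e1; ring.
Qed.

(** A time c that depends on the parameters alone changes the flow by 2 a c s^N to
    first order, which is the direction left free by the equation. *)
Lemma flowL_prescribe t L : a != 0 -> rr t -> rr L ->
  exists2 c, rp c & forall n, co (flowL (t + c)) (N, N, n) = co L (N, N, n).
Proof.
move=> a0 rt rL.
pose k : A := cst ((a *+ 2)^-1)%:C%C.
have ek f : k * (cst a%:C%C * f *+ 2) = f.
  have -> : cst a%:C%C * f *+ 2 = cst (a *+ 2)%:C%C * f.
    by rewrite (rmorphMn (real_complex R)) (rmorphMn cst) mulrnAl.
  rewrite mulrA /k -(rmorphM cst) -(rmorphM (real_complex R)) /= mulVf ?mulrn_eq0 //.
  by rewrite !rmorph1 mul1r.
have rk : rr k by exact: rr_cst.
have rF c : rp c -> rr (flowL (t + c)) by move=> rc; apply/rr_flowL/rrD => //; exact: rp_rr.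
pose T c := c - k * slot N (flowL (t + c) - L).
have rT c : rp c -> rp (T c).
  move=> rc; apply: rpB => //; apply: rpM; first exact: rp_cst.
  by apply/slot_rp/rrB => //; exact: rF.
have hX' l : flt al (2 * N * l) (iter l X' 1).
  elim: l => [|l IH] /=; first by rewrite muln0; exact: flt_0.
  rewrite mulnS (addnC (2 * N)%N (2 * N * l)%N); apply: fltM; last exact: flt_al_rho.
  by apply: fltD; [exact: fltMn|exact: flt_Eu].
have key (x y u v : A) : rp x -> rp y ->
    x - k * slot N (u - L) - (y - k * slot N (v - L)) =
    - (k * slot N (u - v - (x - y) * (cst a%:C%C * ss ^+ N) *+ 2)).
  move=> rx ry.
  have e1 : slot N ((x - y) * (cst a%:C%C * ss ^+ N) *+ 2) = cst a%:C%C * (x - y) *+ 2.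
    have pc : par (cst a%:C%C * (x - y) *+ 2).
      by rewrite mulr2n; apply: suppD; apply: suppZ; case: (rpB rx ry).
    have -> : (x - y) * (cst a%:C%C * ss ^+ N) *+ 2 =
       ss ^+ N * (cst a%:C%C * (x - y) *+ 2) by ring.
    apply: ser_eqP => -[[i j] n]; rewrite /slot {1}/co /=.
    case: ifP => h0; last by rewrite (supp_co pc) //= h0.
    rewrite co_ss_par // eqxx mulr1n.
    by move: h0; rewrite addn_eq0 => /andP[/eqP -> /eqP ->].
  by rewrite (slotB _ (u - v)) mulrBr e1 ek !slotB; ring.
have [||||c rc e] := @fixpt _ _ (@rp R m) al T 0.
- by split; [exact: supp0|exact: star0].
- exact: closed_rp.
- exact: rT.
- move=> d c c' rc rc' hcc.
  have hdiff : flt al (2 * N + d).+1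
      (flowL (t + c) - flowL (t + c') - (c - c') * (cst a%:C%C * ss ^+ N) *+ 2).
    pose tl u : A := osum (fun l => ifac R m l.+2 * u ^+ l.+2 * iter l.+2 X' 1).
    have eF u : flowL u = 1 + (u * (rho *+ 2) + tl u).
      rewrite /flowL /flow osum_recl; last exact: smb_flow X'_raising.
      rewrite osum_recl; last first.
        by move=> l; apply/fltMr/(flt_le (flt_iter l.+1 X'_raising (flt_0 1 1))); lia.
      rewrite ifac0 expr0 !mul1r /= expr1; have -> : ifac R m 1 = 1 by have := ifacS R m 0; rewrite ifac0.
      by rewrite mul1r {1}/X' (Eu_par (par1 R m)) addr0 mulrnAl mul1r.
    have gen (x y u v r s : A) : 1 + (x * (r *+ 2) + u) - (1 + (y * (r *+ 2) + v))
        - (x - y) * s *+ 2 = (x - y) * (r - s) *+ 2 + (u - v) by ring.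
    rewrite !eF -[c - c'](_ : t + c - (t + c') = _); last by ring.
    rewrite gen [t + c - _](_ : _ = c - c'); last by ring.
    apply: fltD.
      by apply/fltMn; apply: (flt_le (fltM hcc rho_lead)); lia.
    rewrite /tl -osumB; apply: flt_osum_ge => l; rewrite -mulrBl -mulrBr.
    have h1 : flt al d ((t + c) ^+ l.+2 - (t + c') ^+ l.+2).
      by rewrite subrXX; apply: fltMl; rewrite opprD addrACA subrr add0r.
    apply: (flt_le (fltM (fltMr _ h1) (hX' l.+2))); rewrite mulnS mulnS; lia.
  rewrite /T key //; apply/fltN/fltMr; apply: (@flt_slot_drop _ _ _ d.+1).
  by rewrite (addnS (2 * N) d).
exists c => // n.
have e0 : k * slot N (flowL (t + c) - L) = 0.
  have -> : k * slot N (flowL (t + c) - L) = c - T c by rewrite /T opprB addrCA subrr addr0.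
  by rewrite e subrr.
have := congr1 (fun f : A => co f (0%N, 0%N, n)) e0.
rewrite coZ co_slot coB => /eqP; rewrite mulf_eq0 => /orP[|]; last by rewrite subr_eq0 => /eqP.
rewrite -(rmorph0 (real_complex R)) (inj_eq (@complexI R)) invr_eq0 mulrn_eq0 /=.
by rewrite (negbTE a0).
Qed.

End Symmetry.

Definition adE y f : A := (exp_ad (fld y) (fld f)).1.

Lemma bracket_fld y f : bracket (fld y) (fld f) = fld (bracket (fld y) (fld f)).1.
Proof.
rewrite [LHS]surjective_pairing; congr pair.
by rewrite bracket1 bracket2 starB !star_vder.
Qed.

Lemma exp_ad_fld y f : exp_ad (fld y) (fld f) = fld (adE y f).
Proof.
rewrite [LHS]surjective_pairing; congr pair.
rewrite /adE exp_ad1 exp_ad2.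
transitivity (osum (fun l => star (ifac R m l * ((iter l (bracket (fld y)) (fld f)).1 : A)))).
  apply: eq_osum => l; rewrite starM star_cst conjc_real; congr (_ * _).
  have hl : iter l (bracket (fld y)) (fld f) = fld (iter l (bracket (fld y)) (fld f)).1.
    by elim: l => //= l IH; rewrite IH; exact: bracket_fld.
  by rewrite hl.
by apply: ser_eqP => x; rewrite co_star !co_osumE wt_swap rmorph_sum.
Qed.

Lemma adE_conj y f g : flt 1 2 y -> flt 1 1 f ->
  expd y (vder (fld (adE y f)) g) = vder (fld f) (expd y g).
Proof. by move=> hy hf; rewrite -exp_ad_fld expd_exp_ad //; exact: vflt_fld. Qed.

Lemma flt_equi P Q : flt 1 1 P -> flt 1 1 (Q - 1) -> flt 1 1 (P + ii * Q - ii).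
Proof.
move=> hP hQ; have -> : P + ii * Q - ii = P + ii * (Q - 1) by ring.
by apply: fltD => //; exact: fltMr.
Qed.

Lemma flt1M f g : flt 1 1 (f - 1) -> flt 1 1 (g - 1) -> flt 1 1 (f * g - 1).
Proof.
move=> hf hg; have -> : f * g - 1 = (f - 1) * g + (g - 1) by ring.
by apply: fltD => //; exact: fltMl.
Qed.

Lemma flt_q b : flt 1 1 (1 + b * ss ^+ N - 1).
Proof.
rewrite addrC addKr; apply: fltMr; apply: (flt_le (flt_ss _ _ 1 N)); lia.
Qed.

Lemma rr_q b : rp b -> rr (1 + b * ss ^+ N).
Proof.
by move=> hb; apply: rrD; [exact: rr1|apply: rrM; [exact: rp_rr|apply/rrX/rr_ss]].
Qed.

Lemma flt_zz_unit H : flt 1 2 (zz * H - zz) -> flt 1 1 (H - 1).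
Proof. by move=> h; apply: flt_zz_cancel; rewrite mulrBr mulr1. Qed.

Lemma star_fixed (T : A -> A) f : (forall g, star (T g) = T (star g)) -> star f = f -> star (T f) = T f.
Proof. by move=> h e; rewrite h e. Qed.

Lemma unit_inj (t u f g : A) : t * u = 1 -> t * f = t * g -> f = g.
Proof.
move=> h e; rewrite -[f]mul1r -[g]mul1r -h [t * u]mulrC -!mulrA; congr (_ * _).
exact: e.
Qed.

(** The conjugation [K] between two normal forms of the same field commutes with
    rotations, hence maps s to sL.  Here L solves the normal form equation with the
    data of the second form, for the speeds of the first form perturbed by the
    angular part of [K].  A symmetry of the first form solves the same equation
    with the data of the first form, and solutions are unique. *)
Theorem normal_unique f0 y y' a chi b t a' chi' b' t' : a != 0 -> flt 1 1 f0 ->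
  flt 1 2 y -> flt 1 2 y' ->
  (forall i, rp (chi i)) -> (forall i, flt 1 1 (chi i)) -> rp b ->
  (forall i, rp (chi' i)) -> (forall i, flt 1 1 (chi' i)) -> rp b' ->
  rr t -> flt 1 1 (t - 1) -> rr t' -> flt 1 1 (t' - 1) ->
  adE y f0 = zz * (t * (unf a chi ss + ii * (1 + b * ss ^+ N))) ->
  adE y' f0 = zz * (t' * (unf a' chi' ss + ii * (1 + b' * ss ^+ N))) ->
  [/\ a' = a, forall i, chi' i = chi i & b' = b].
Proof.
move=> a0 hf0 hy hy' hc hc1 hb hc' hc1' hb' rt ht rt' ht' ex ex'.
set p := unf a chi ss in ex; set q := 1 + b * ss ^+ N in ex.
set p' := unf a' chi' ss in ex'; set q' := 1 + b' * ss ^+ N in ex'.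
have rs := rr_ss R m.
have [rp1 rp1'] : rr p /\ rr p' by split; exact: rr_unf.
have [rq rq'] : rr q /\ rr q' by split; exact: rr_q.
have [E' [aE' nE' eE eE']] := near_inv (expd_alg hy) (expd_near hy).
have ay' := expd_alg hy'; have ny' := expd_near hy'.
have inj := near_inj (algO (expd_alg hy)) (expd_near hy).
pose K f := E' (expd y' f).
have aK : alg K by exact: (alg_comp aE' ay').
have fE' p0 f : flt 1 p0 f -> flt 1 p0 (E' f) by exact: (operF (algO aE')).
have nK : near K.
  move=> k f hf; rewrite /K; have -> : E' (expd y' f) - f =
    (E' (expd y' f) - expd y' f) + (expd y' f - f) by ring.
  by apply: fltD; [apply: nE'; apply: (operF (algO ay'))|apply: ny'].
have sE' f : star (E' f) = E' (star f) by apply: inj; rewrite -star_expd !eE.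
have sK f : star (K f) = K (star f) by rewrite /K sE' star_expd.
have Kmu i : K (mu R i) = mu R i.
  by rewrite /K expd_mu //; apply: inj; rewrite eE expd_mu.
have Kpar f : par f -> K f = f by exact: alg_fix_par.
pose U := t * (p + ii * q); pose U' := t' * (p' + ii * q').
have eU : U = t * p + ii * (t * q) by rewrite /U; ring.
have eU' : U' = t' * p' + ii * (t' * q') by rewrite /U'; ring.
have conjK f : K (vder (fld (zz * U')) f) = vder (fld (zz * U)) (K f).
  apply: inj; rewrite /K eE -ex' (adE_conj _ hy' hf0) -ex (adE_conj _ hy hf0).
  by rewrite eE.
have rad_equi P Q : rr P -> rr Q -> rad (P + ii * Q).
  by move=> [hP _] [hQ _]; apply: suppD => //; apply: radM => //; exact: rad_ii.
have rU : rad U by rewrite eU; apply: rad_equi; exact: rrM.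
have rU' : rad U' by rewrite eU'; apply: rad_equi; exact: rrM.
have hU : flt 1 1 (U - ii).
  by rewrite eU; apply: flt_equi; [apply/fltMr/flt_unf|apply: flt1M => //; exact: flt_q].
have hU' : flt 1 1 (U' - ii).
  by rewrite eU'; apply: flt_equi; [apply/fltMr/flt_unf|apply: flt1M => //; exact: flt_q].
have [H rH eH] := equivariant (algO aK) rU' rU hU' hU conjK.
have hH : flt 1 1 (H - 1) by apply: flt_zz_unit; rewrite -eH; apply: nK; exact: flt_zz.
have [Hi [rHi eHi _]] := inv_exists (@good_rad R m) rH hH.
pose L := H * star H.
have rL : rr L.
  by split; [apply: radM => //; exact: rad_star|rewrite /L starM starK mulrC].
have hL : flt 1 1 (L - 1).
  by apply: flt1M => //; have := flt_star hH; rewrite starB star1.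
have Kw : K ww = ww * star H by rewrite -star_zz -sK eH starM star_zz.
have es : ss = zz * ww by [].
have Ks : K ss = ss * L by rewrite es (algM aK) eH Kw /L; ring.
have Kp' : K p' = unf a' chi' (ss * L).
  by rewrite (alg_unf _ _ aK) ?Ks // => i; apply: Kpar; case: (hc' i).
have Kq' : K q' = 1 + b' * (ss * L) ^+ N.
  by rewrite (operD aK) (alg1 aK) (algM aK) (algX _ _ aK) Ks Kpar //; case: hb'.
(* The logarithmic derivative of [H]; its real part governs [L]. *)
pose eta := Eu H * Hi.
have e1 : K U' = U + t * p * eta.
  have := conjK zz; rewrite eH vder_zz /= (algM aK) eH eU.
  rewrite (vder_equi_zz (rrM rt rp1) (rrM rt rq) rH) -mulrA => /zz_inj e.
  apply: (unit_inj eHi); rewrite e /eta -eU; ring: eHi.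
have rKf f : rr f -> star (K f) = K f by case=> _; exact: star_fixed.
have e2 : K t' * K p' + ii * (K t' * K q') = t * p + ii * (t * q) + t * p * eta.
  have eKi : K ii = ii by exact: (alg_cst _ aK).
  rewrite -eU -e1 eU' (operD aK (t' * p')) (algM aK t' p') (algM aK ii) eKi.
  by rewrite (algM aK t' q').
have e3 : K t' * K p' - ii * (K t' * K q') = t * p - ii * (t * q) + t * p * star eta.
  have := congr1 (@star R m) e2; rewrite !starD !starM star_ii !rKf //.
  case: (rt) => _ ->; case: (rp1) => _ ->; case: (rq) => _ ->.
  by rewrite !mulNr.
have eL : Eu L = L * (eta + star eta).
  have eh : Eu H = H * eta by rewrite /eta mulrCA eHi mulr1.
  have eh' : Eu (star H) = star H * star eta by rewrite -star_Eu eh starM.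
  by rewrite /L EuM eh eh'; ring.
pose h2 : A := cst (2^-1 : R)%:C%C.
have e22 : h2 *+ 2 = 1.
  rewrite /h2 -(rmorphMn cst) -(rmorphMn (real_complex R)) /=.
  have -> : (2^-1 : R) *+ 2 = 1 by rewrite -[LHS]mulr_natr mulVf // pnatr_eq0.
  by rewrite !rmorph1.
(* The imaginary part of [eta]: the angular part of the conjugation. *)
pose theta := - (ii * h2 * (eta - star eta)).
have rth : rr theta.
  split.
    have re : rad eta by apply: radM => //; exact: rad_Eu.
    apply/suppN/radM; last by apply: suppB => //; exact: rad_star.
    by apply: radM; exact: rad_cst.
  have se : star (eta - star eta) = star eta - eta by rewrite starB starK.
  have sh : star h2 = h2 by rewrite star_cst conjc_real.
  by rewrite /theta starN (starM (ii * h2)) (starM ii h2) se sh star_ii; ring.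
have r1 : L *+ 2 * (K t' * K p') = t * p * (L *+ 2 + Eu L).
  have -> : L *+ 2 * (K t' * K p') = L * ((K t' * K p' + ii * (K t' * K q')) +
     (K t' * K p' - ii * (K t' * K q'))) by ring.
  by rewrite e2 e3 eL; ring.
have r2 : K t' * K q' = t * (q + p * theta).
  have -> : K t' * K q' = - (ii * ii) * (h2 *+ 2) * (K t' * K q') by rewrite ii2 e22; ring.
  have -> : - (ii * ii) * (h2 *+ 2) * (K t' * K q') =
    - (ii * h2) * ((K t' * K p' + ii * (K t' * K q')) -
       (K t' * K p' - ii * (K t' * K q'))) by ring.
  rewrite e2 e3 /theta.
  transitivity (- (ii * ii) * (h2 *+ 2) * (t * q) - (ii * h2) * (t * p * (eta - star eta))).
    by ring.
  by rewrite ii2 e22; ring.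
have th0 n : co theta (0%N, 0%N, n) = 0.
  apply: moving0; apply/suppN/movingMr.
  have me : moving eta by apply: movingMl; exact: moving_Eu.
  by apply: suppB => //; exact: moving_star.
(* The angular part is absorbed by the time [beta] of a symmetry. *)
have [beta rbeta ebeta] := Eu_primitive rth th0.
have [ti [rti eti _]] := inv_exists (@good_rr R m) rt ht.
have [ti' [rti' eti' _]] := inv_exists (@good_rr R m) rt' ht'.
have eKt : K t' * K ti' = 1 by rewrite -(algM aK) eti' (alg1 aK).
have core1 : core a' p (q + p * theta) L chi' b' = 0.
  rewrite /core -Kp' -Kq'; apply/eqP; rewrite subr_eq0; apply/eqP.
  apply: (unit_inj eti); apply: (unit_inj eKt).
  transitivity ((L *+ 2 * (K t' * K p')) * (t * (q + p * theta))); first by ring.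
  by rewrite r1 -r2; ring.
have [qi [rqi eqi qi1]] := inv_exists (@good_rr R m) rq (flt_q b).
have [c rc ec] := flowL_prescribe hc hc1 rqi qi1 a0 rbeta rL.
set L2 := flowL a chi qi (beta + c) in ec.
have core2 : core a p (q + p * theta) L2 chi b = 0.
  have := flowL_core a hc hc1 hb eqi (beta + c).
  by rewrite EuD ebeta (Eu_par (proj1 rc)) addr0.
have al0 : (0 < al)%N by lia.
have hP : flt al al (p - cst a%:C%C * ss ^+ N) by apply/unf_lead => i; exact: flt_al_chi.
have hQ : flt al 1 (q + p * theta - 1).
  apply: flt1_weight => //; have -> : q + p * theta - 1 = (q - 1) + p * theta by ring.
  by apply: fltD; [exact: flt_q|apply/fltMl/flt_unf].
have adm1 : adm L chi' b'.
  by split=> // [|i]; [exact: flt1_weight|exact: flt_al_chi].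
have adm2 : adm L2 chi b.
  split=> // [||i]; [|exact/flt1_weight/flowL1|exact: flt_al_chi].
  by apply: rr_flowL => //; apply: rrD => //; exact: rp_rr.
have ea : a' = a := core_lead hN hP hQ a0 adm1 core1.
rewrite ea in core1.
have [_ echi eb] := core_unique hN hP hQ a0 adm1 adm2 (fun n => esym (ec n)) core1 core2.
by split.
Qed.

End Uniqueness.

(** * The first level normal form *)

Section FirstLevel.
Variables (R : realType) (m al : nat).
Hypothesis hal : (1 <= al)%N.
Local Notation C := R[i].
Local Notation A := (ser R m).
Implicit Types (f g h y : A) (p q k : nat) (a : R) (v w : vfield R m).
Local Notation zz := (zz R m).
Local Notation cst := (@cst R m).
Local Notation ii := (ii R m).

Lemma fldD f g : fld (f + g) = fld f + fld g.
Proof. by rewrite /fld starD. Qed.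

(** The terms X_jk, Y_jk are the real fields; the remaining conditions say that
    the only linear parameter-free term is a multiple of Y_10. *)
Lemma state_fld v : state_space v ->
  [/\ v = fld v.1, moving v.1, co v.1 (0%N, 1%N, 0%MM) = 0 &
      complex.Re (co v.1 (1%N, 0%N, 0%MM)) = 0].
Proof.
case=> a [cX [cY ->]]; set u := _ + _.
have e1 j k n : co (u.1 : A) (j, k, n) =
   a%:C%C * ('i%C * (smono 1 0 0%MM : zwseries R m) j k n) +
   (higher_part cX j k n +i* higher_part cY j k n)%C by [].
have e2 j k n : co (u.2 : A) (j, k, n) =
   a%:C%C * (- 'i%C * (smono 0 1 0%MM : zwseries R m) j k n) +
   (higher_part cX k j n -i* higher_part cY k j n)%C by [].
split.
- rewrite [LHS]surjective_pairing; congr pair; apply: ser_eqP => -[[j k] n].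
  rewrite co_star e1 e2 rmorphD; congr (_ + _).
  rewrite !rmorphM /= rmorph_nat oppr0 /smono.
  by rewrite andbCA; congr (_ * (_ * _)); apply/eqP; rewrite eq_complex /= oppr0 !eqxx.
- split=> -[[j k] n] /=; rewrite negbK addn_eq0 => /andP[/eqP -> /eqP ->].
  by rewrite e1 /smono /higher_part /higher /= !mulr0 add0r.
- by rewrite e1 /smono /higher_part /higher /= mdeg0 !mulr0 add0r.
rewrite e1 /smono /higher_part /higher /= mdeg0 eqxx /= !mulr1.
by rewrite /= !(mulr0, mul0r, mulr1, mul1r, subrr, addr0, subr0, oppr0).
Qed.

Lemma fld_state f : moving f -> co f (0%N, 1%N, 0%MM) = 0 ->
  complex.Re (co f (1%N, 0%N, 0%MM)) = 0 -> state_space (fld f).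
Proof.
move=> mf h01 h10; pose a := complex.Im (co f (1%N, 0%N, 0%MM)).
exists a, (fun j k n => complex.Re (f j k n)), (fun j k n => complex.Im (f j k n)).
have e j k n : f j k n = a%:C%C * ('i%C * (smono 1 0 0%MM : zwseries R m) j k n) +
   (higher_part (fun j k n => complex.Re (f j k n)) j k n +i*
    higher_part (fun j k n => complex.Im (f j k n)) j k n)%C.
  rewrite /higher_part; case: (boolP (higher j k n)) => hh.
    have -> : (smono 1 0 0%MM : zwseries R m) j k n = 0.
      rewrite /smono; case: and3P => // -[/eqP ej /eqP ek /eqP en].
      by move: hh; rewrite ej ek en /higher mdeg0.
    by rewrite !mulr0 add0r; case: (f j k n).
  rewrite addr0; move: hh; rewrite /higher negb_and -!ltnNge !ltnS leqn0.
  case/orP => [hjk | hd].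
    have := supp_co mf (x := (j, k, n)); rewrite /= negbK => /(_ hjk); rewrite /co /= => ->.
    by move: hjk; rewrite addn_eq0 => /andP[/eqP -> /eqP ->]; rewrite /smono /= !mulr0.
  case: (posnP (j + k)) => hjk.
    have := supp_co mf (x := (j, k, n)); rewrite /= negbK hjk => /(_ isT); rewrite /co /= => ->.
    have [-> ->] : j = 0%N /\ k = 0%N by lia.
    by rewrite /smono /= !mulr0.
  have /eqP : mdeg n = 0%N by lia.
  rewrite mdeg_eq0 => /eqP en; rewrite en in hd *; rewrite mdeg0 in hd.
  have [[-> ->]|[-> ->]] : (j = 1%N /\ k = 0%N) \/ (j = 0%N /\ k = 1%N) by lia.
    rewrite /smono /= eqxx mulr1; apply/eqP; rewrite eq_complex /=.
    move: h10; rewrite /co /a /co /= => ->.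
    by rewrite !(mulr0, mul0r, mulr1, subr0, addr0, eqxx).
  by move: h01; rewrite /co /= => ->; rewrite /smono /= !mulr0.
rewrite [RHS]surjective_pairing; congr pair.
  by apply/funext => j; apply/funext => k; apply/funext => n; exact: e.
apply/funext => j; apply/funext => k; apply/funext => n; rewrite /star e.
rewrite rmorphD; congr (_ + _).
rewrite !rmorphM /= rmorph_nat oppr0 /sscale /smono.
by rewrite andbCA; congr (_ * (_ * _)); apply/eqP; rewrite eq_complex /= oppr0 !eqxx.
Qed.

Lemma grade_wt j k (n : 'X_{1..m}) : (0 < j + k)%N ->
  wt al (j, k, n) = (grade al j k n).+1.
Proof. by rewrite /wt /grade /=; lia. Qed.

Lemma moving_co0 f j k n : moving f -> (j + k)%N = 0%N -> co f (j, k, n) = 0.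
Proof. by move=> h hjk; apply: (supp_co h (x := (j, k, n))); rewrite /= hjk. Qed.

Lemma state_filt_fld p v : state_filt al p v ->
  [/\ v = fld v.1, moving v.1 & flt al p.+1 v.1].
Proof.
move=> [hs hv]; have [e mv _ _] := state_fld hs; split=> //.
split=> -[[j k] n] hx; case: (posnP (j + k)) => hjk; first exact: moving_co0.
have [] := hv j k n; first by move: hx; rewrite grade_wt.
by rewrite /X_coef /Y_coef /co /=; case: (v.1 j k n) => re im /= -> ->.
Qed.

Lemma fld_state_filt p f : (1 <= p)%N -> moving f -> flt al p.+1 f ->
  state_filt al p (fld f).
Proof.
move=> hp mf hf; split.
  by apply: fld_state => //; rewrite (flt_co hf) // /wt mdeg0 muln0.
move=> j k n hg; rewrite /X_coef /Y_coef /=.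
suff : co f (j, k, n) = 0 by rewrite /co /= => ->.
case: (posnP (j + k)) => hjk; first exact: moving_co0.
by rewrite (flt_co hf) // grade_wt.
Qed.

Lemma flt_al_1 f : moving f -> flt al 2 f -> flt 1 2 f.
Proof.
move=> mf hf; split=> -[[j k] n] hx; case: (posnP (j + k)) => hjk; first exact: moving_co0.
rewrite (flt_co hf) //; move: hx; rewrite /wt /= mul1n => hx.
have -> : mdeg n = 0%N by lia.
by rewrite muln0; lia.
Qed.

Lemma grade_part_fld n (x : idx m) s r : grade al x.1.1 x.1.2 x.2 = n ->
  moving r -> flt al n.+2 r ->
  grade_part al n (fld (cst s * mono R x + r)) = fld (cst s * mono R x).
Proof.
move=> hx mr hr.
have e1 : (grade_part al n (fld (cst s * mono R x + r))).1 = cst s * mono R x.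
  apply: ser_eqP => -[[j k] c]; rewrite {1}/co /=.
  case: eqP => hg; last first.
    by rewrite coZ co_mono; case: eqP => [e|]; rewrite ?mulr0 //; case: hg; rewrite -hx -e.
  rewrite -[LHS]/(co (cst s * mono R x + r) (j, k, c)) coD.
  suff -> : co r (j, k, c) = 0 by rewrite addr0.
  case: (posnP (j + k)) => hjk; first exact: moving_co0.
  by rewrite (flt_co hr) // grade_wt // hg.
rewrite [LHS]surjective_pairing e1; congr pair.
transitivity (star (grade_part al n (fld (cst s * mono R x + r))).1); last by rewrite e1.
apply: ser_eqP => -[[j k] c]; rewrite co_star /co /= /grade (addnC j).
by case: ifP => _; rewrite ?rmorph0.
Qed.

Lemma higher_fld (cX cY : nat -> nat -> 'X_{1..m} -> R) :
  let g : A := (higher_series cX cY).1 in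
  [/\ higher_series cX cY = fld g, moving g & flt al 2 g].
Proof.
have hs : state_space (higher_series cX cY).
  exists 0, cX, cY; rewrite -[LHS]add0r; congr (_ + _); rewrite /vscale rmorph0 !sscaleE.
  by rewrite rmorph0 !mul0r.
have [e mg _ _] := state_fld hs; split=> //.
split=> -[[j k] n]; rewrite /wt /= => hn.
have hh : higher j k n = false.
  apply/negbTE; rewrite /higher; apply/andP => -[_ h2].
  by have : (mdeg n <= al * mdeg n)%N; [rewrite leq_pmull|lia].
by rewrite /co /= /higher_part hh.
Qed.

Section Removable.
Variables (f0 g : A).
Hypotheses (hf0 : f0 = ii * zz + g) (mg : moving g) (hg : flt al 2 g).

Lemma vder0 v : vder v (0 : A) = 0.
Proof.
have p0 : pz (0 : A) = 0 by apply: ser_eqP => x; rewrite co_pz !co0 mul0rn.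
have p1 : pw (0 : A) = 0 by apply: ser_eqP => x; rewrite co_pw !co0 mul0rn.
by rewrite vderE p0 p1 !mul0r addr0.
Qed.

Lemma vder_fldD f h u : vder (fld (f + h)) u = vder (fld f) u + vder (fld h) u.
Proof. by rewrite !vderE /= starD; ring. Qed.

Lemma vder_f0 u : vder (fld f0) u = ii * (thz u - thw u) + vder (fld g) u.
Proof.
rewrite hf0 vder_fldD; congr (_ + _).
rewrite vderE /= starM star_ii star_zz -zz_pz -ww_pw; ring.
Qed.

Lemma dmap_state v w : dmap v (fun _ _ => 0) (fun _ _ => 0) w = bracket w v.
Proof.
rewrite /dmap; suff [-> ->] : dmu_act (fun _ _ => 0) v = 0 /\
    time_act (fun _ _ => 0) v = 0 by rewrite !add0r.
have t0 : time_series (fun _ _ => 0 : R) = 0 :> ser R m.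
  by apply: ser_eqP => -[[j k] n]; rewrite /co /time_series /=; case: ifP; rewrite ?rmorph0.
have p0 : param_series (fun _ => 0 : R) = 0 :> ser R m.
  by apply: ser_eqP => -[[j k] n]; rewrite /co /param_series /=; case: ifP; rewrite ?rmorph0.
split; last first.
  rewrite /time_act t0; congr pair; exact: (mul0r (_ : A)).
rewrite /dmu_act big1 // => i _; rewrite p0; congr pair; exact: (mulr0 (_ : A)).
Qed.

(** Terms that do not commute with the rotation are brackets with it, up to higher
    grade. *)
Lemma removable_equi n j k (c : 'X_{1..m}) s : j != k.+1 -> (0 < j + k)%N ->
  grade al j k c = n -> (1 <= n)%N ->
  removable al 1 (fld f0) n (fld (cst s * mono R (j, k, c))).
Proof.
move=> hjk hjk0 hn n1; set x := (j, k, c).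
(* Division by the eigenvalue of the bracket with the rotation. *)
pose kap : C := s / ('i%C * (j%:R - k.+1%:R)).
have d0 : j%:R - k.+1%:R != 0 :> C by rewrite subr_eq0 eqr_nat.
have i0 : 'i%C != 0 :> C.
  by apply/eqP => /(congr1 (@complex.Im R)) /eqP; rewrite /= oner_eq0.
pose y : A := cst kap * mono R x.
have wx : wt al x = n.+1 by rewrite grade_wt // hn.
have my : moving y by apply/suppZ/supp_mono; rewrite /= -lt0n.
have hy : flt al n.+1 y by rewrite -wx; apply/fltMr/flt_mono.
pose r : A := vder (fld g) y - vder (fld y) g.
have mr : moving r by apply: suppB; exact: moving_vder.
have hr : flt al n.+2 r.
  apply: fltB; first by rewrite -(addn1 n.+1); apply: flt_vder => //; exact: vflt_fld.
  by rewrite -(add2n n); apply: flt_vder => //; exact: vflt_fld.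
have dY : oper (vder (fld y)).
  apply/vder_oper/vflt_fld; apply: (@fltW _ _ _ _ 2) => //.
  by apply: flt_al_1 => //; apply: (flt_le hy); lia.
have e0 : thz y - thw y = cst (j%:R - k%:R) * y.
  apply: ser_eqP => z; rewrite coB co_thz co_thw coZ /y !coZ co_mono.
  case: eqP => [->|]; last by rewrite !mulr0 !mul0rn subrr.
  by rewrite /= !mulr1 mulrBl !mulr_natl.
have e1 : cst s * mono R x = ii * (cst (j%:R - k.+1%:R) * y).
  rewrite /y !mulrA; congr (_ * _); rewrite -!rmorphM /=; congr cst.
  by rewrite /kap mulrCA mulfV ?mulr1 // mulf_neq0.
have e : (bracket (fld y) (fld f0)).1 = cst s * mono R x + r.
  have eYz : vder (fld y) (ii * zz) = ii * y by rewrite (operZ dY) vder_zz.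
  rewrite bracket1 vder_f0 [(fld f0).1]hf0 (operD dY) eYz -[(fld y).1]/y e0 e1 /r.
  have -> : cst (j%:R - k%:R) = cst (j%:R - k.+1%:R) + 1 :> A.
    by rewrite -(rmorph1 cst) -rmorphD; congr cst; rewrite -addn1 natrD; ring.
  have gen (I D Y u u' : A) : I * ((D + 1) * Y) + u - (I * Y + u') =
    I * (D * Y) + (u - u') by ring.
  exact: gen.
exists (fun _ _ => 0), (fun _ _ => 0), (fld y); rewrite dmap_state.
have -> : bracket (fld y) (fld f0) = fld (cst s * mono R x + r) by rewrite bracket_fld e.
have hm : (maxn (n.+1 - 1) 1) = n by rewrite subn1 /=; apply/maxn_idPl.
split; last by rewrite grade_part_fld.
  by rewrite hm; split=> //; apply: fld_state_filt.
apply: fld_state_filt => //.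
  by apply: suppD => //; apply/suppZ/supp_mono; rewrite /= -lt0n.
apply: fltD; last by apply: (flt_le hr).
by rewrite -wx; apply/fltMr/flt_mono.
Qed.

(** The rotational terms are multiples of the rotation, hence removed by a
    rescaling of time. *)
Lemma removable_ang n k (c : 'X_{1..m}) : grade al k.+1 k c = n -> (1 <= n)%N ->
  removable al 1 (fld f0) n (fld (cst 'i%C * mono R (k.+1, k, c))).
Proof.
move=> hn n1; set x := (k.+1, k, c).
have wx : wt al x = n.+1 by rewrite grade_wt // hn.
pose t : time_space R m := fun k' c' => ((k' == k) && (c' == c))%:R.
have et : time_series t = mono R (k, k, c).
  apply: ser_eqP => -[[j j'] c']; rewrite co_mono /co /time_series /t /= !xpair_eqE.
  case: (j =P j') => [->|hj]; first by rewrite rmorph_nat andbb.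
  case: (j =P k) => //= e; case: (j' =P k) => //= e'.
  by case: hj; rewrite e e'.
pose y : A := 0.
have ex : mono R x = zz * mono R (k, k, c).
  by rewrite -[zz]/(mono R (1%N, 0%N, 0%MM)) -monoD ixadd_z.
pose r : A := mono R (k, k, c) * g.
have wk : wt al (k, k, c) = n by move: wx; rewrite /wt /=; lia.
have mr : moving r by exact: movingMr.
have hr : flt al n.+2 r by rewrite -(addn2 n) -{1}wk; apply: fltM => //; exact: flt_mono.
have e : dmap (fld f0) (fun _ _ => 0) t (fld y) = fld (cst 'i%C * mono R x + r).
  have := dmap_state (fld f0) (fld y); rewrite /dmap.
  have t0 : time_act (fun _ _ => 0) (fld f0) = 0.
    have t0 : time_series (fun _ _ => 0 : R) = 0 :> ser R m.
      by apply: ser_eqP => -[[i j] c']; rewrite /co /time_series /=; case: ifP; rewrite ?rmorph0.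
    by rewrite /time_act t0; congr pair; exact: (mul0r (_ : A)).
  rewrite t0 addr0 => /eqP; rewrite -subr_eq0 addrK => /eqP ->; rewrite add0r.
  have -> : bracket (fld y) (fld f0) = 0.
    have d0 : fld y = 0 :> vfield R m by rewrite /fld /y star0.
    have b0 : vder 0 f0 = 0 :> A by rewrite vderE !mulr0 addr0.
    rewrite bracket_fld bracket1 d0 -[(0 : vfield R m).1]/(0 : A) vder0 sub0r b0.
    by rewrite oppr0 /fld star0.
  rewrite addr0 /time_act et.
  have e1 : mono R (k, k, c) * f0 = cst 'i%C * mono R x + r.
    by rewrite hf0 ex /r; ring.
  by rewrite -e1 /fld starM star_mono.
exists (fun _ _ => 0), t, (fld y); rewrite e.
have hm : (maxn (n.+1 - 1) 1) = n by rewrite subn1 /=; apply/maxn_idPl.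
split; last by rewrite grade_part_fld.
  rewrite hm; split=> //.
    move=> k' c'; rewrite /t; case: andP => // -[/eqP -> /eqP ->].
    by move: wk; rewrite /wt /=; lia.
  by apply: fld_state_filt.
apply: fld_state_filt => //.
  by apply: suppD => //; apply/suppZ/supp_mono.
apply: fltD; last by apply: (flt_le hr).
by rewrite -wx; apply/fltMr/flt_mono.
Qed.

End Removable.
Lemma Xmon_fld j k (c : 'X_{1..m}) : Xmon j k c = fld (cst 1 * mono R (j, k, c)).
Proof. by rewrite /fld rmorph1 mul1r star_mono. Qed.

Lemma Ymon_fld j k (c : 'X_{1..m}) : Ymon j k c = fld (cst 'i%C * mono R (j, k, c)).
Proof.
rewrite /fld starM star_mono star_cst /Ymon !sscaleE; congr (_, cst _ * _).
by apply/eqP; rewrite eq_complex /= oppr0 !eqxx.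
Qed.

Section FirstForm.
Variables (e : nat -> monomial m) (f0 g : A).
Hypotheses (he : formal_basis_style al e).
Hypotheses (hf0 : f0 = ii * zz + g) (mg : moving g) (hg : flt al 2 g).
Local Notation W n := (removable al 1 (fld f0) n).

Definition radial_X (b : monomial m) : bool :=
  if b is MX j k _ then j == k.+1 else false.

Lemma in_span0 s : in_span e s (0 : vfield R m).
Proof.
exists (fun _ => 0); rewrite big1 // => q _.
by rewrite /vscale rmorph0 !sscaleE rmorph0 !mul0r.
Qed.

Lemma pivots_radial n s : (1 <= n)%N -> pivots al e (W n) n s ->
  forall q, q \in s -> radial_X (e q) /\ monomial_grade al (e q) = n.
Proof.
move=> n1; elim=> [//|{}s p _ IH [hgr hnot] _ q].
rewrite mem_rcons inE => /orP[/eqP -> {q}|]; last exact: IH.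
split=> //; apply/negPn/negP => hx; apply: hnot.
exists (monomial_field R (e p)), 0; split; [|exact: in_span0|by rewrite addr0].
have [_ hst _] := he; have {hst} : state_monomial (e p) by apply/hst; exists p.
case: (e p) hgr hx => j k c /= hgr hx hs.
  by rewrite Xmon_fld; apply: (removable_equi hf0 mg hg) => //; case/andP: hs.
rewrite Ymon_fld.
have hjk : (0 < j + k)%N.
  by case/orP: hs => [|/and3P[/eqP -> /eqP -> _]] //; rewrite /higher; lia.
case: (j =P k.+1) => [ej|/eqP hj]; last exact: (removable_equi hf0 mg hg).
by rewrite ej in hgr *; exact: (removable_ang hf0 mg hg).
Qed.

Lemma span_radial s v : in_span e s v -> (forall q, q \in s -> radial_X (e q)) ->
  forall j k c, co (v.1 : A) (j, k, c) = (complex.Re (v.1 j k c))%:C%C /\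
    (j != k.+1 -> co (v.1 : A) (j, k, c) = 0).
Proof.
case=> d ->; elim: s => [|p s IH] hs j k c; first by rewrite big_nil.
rewrite big_cons; set S := \sum_(q <- s) _.
have [h1 h2] := IH (fun q hq => hs q (@mem_behead _ (p :: s) q hq)) j k c.
have := hs p (mem_head _ _); case: (e p) => // j' k' c' /eqP ej /=.
rewrite -/S in h1 h2.
have e1 : co ((vscale (d p) (Xmon j' k' c') + S).1 : A) (j, k, c) =
   (d p)%:C%C * ((j, k, c) == (j', k', c'))%:R + co (S.1 : A) (j, k, c).
  by rewrite -(co_mono R (j', k', c')) -coZ -sscaleE.
split.
  transitivity (complex.Re (co ((vscale (d p) (Xmon j' k' c') + S).1 : A) (j, k, c)))%:C%C => //.
  rewrite e1 h1; case: (_ == _); rewrite ?mulr1 ?mulr0 ?add0r //=.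
  by apply/eqP; rewrite eq_complex /= !(addr0, eqxx).
move=> hjk; rewrite e1 h2 // addr0; case: eqP => [[ea eb _]|]; rewrite ?mulr0 //.
by move: hjk; rewrite ea eb ej eqxx.
Qed.

(** The greedy complement never contains a removable monomial, so that only the
    terms X_(k+1)k survive. *)
Lemma first_form w : (forall n, unique_complement al e (W n) n (grade_part al n w)) ->
  w = fld w.1 -> moving w.1 -> flt 1 2 (w.1 - ii * zz) ->
  exists2 P, rr P & w.1 = zz * (P + ii).
Proof.
move=> hw ew mw h1.
have key j k c : co (w.1 - ii * zz) (j, k, c) = (complex.Re (co (w.1 - ii * zz) (j, k, c)))%:C%C
    /\ (j != k.+1 -> co (w.1 - ii * zz) (j, k, c) = 0).
  case: (ltnP (wt 1 (j, k, c)) 2) => hx.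
    by rewrite (flt_co h1 hx); split=> //; rewrite /= rmorph0.
  have ez : co (ii * zz) (j, k, c) = 0.
    rewrite coZ -[zz]/(mono R (1%N, 0%N, 0%MM)) co_mono; case: eqP => [e'|]; rewrite ?mulr0 //.
    by move: hx; rewrite e' /wt mdeg0.
  rewrite coB ez subr0; case: (posnP (j + k)) => hjk.
    by rewrite (moving_co0 c mw hjk); split=> //; rewrite /= rmorph0.
  case: (posnP (grade al j k c)) => hn.
    move: hn hx hjk; rewrite /grade /wt /= => /eqP; rewrite addn_eq0 muln_eq0.
    by case/andP => h /orP[h'|h']; lia.
  have [s hs hsp] := hw (grade al j k c).
  have hr q (hq : q \in s) : radial_X (e q) by case: (pivots_radial hn hs hq).
  have [] := span_radial hsp hr j k c.
  by rewrite /co /= eqxx.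
have [|H rH eH] := @ch1_zz R m (w.1 - ii * zz).
  by split=> -[[j k] c] hj; case: (key j k c) => _; apply.
exists H; last by rewrite mulrDr -eH [zz * ii]mulrC subrK.
split=> //; apply: ser_eqP => -[[j k] c]; rewrite co_star /=.
case: (j =P k) => [->|/eqP hj]; last first.
  by rewrite !(rad_co _ rH) ?rmorph0 // eq_sym.
have [e1 _] := key k.+1 k c.
have e2 : co (w.1 - ii * zz) (k.+1, k, c) = co H (k, k, c).
  by rewrite eH -ixadd_z; exact: (coM_mono (1%N, 0%N, 0%MM)).
by rewrite -e2 e1; apply/eqP; rewrite eq_complex /= oppr0 !eqxx.
Qed.

End FirstForm.

End FirstLevel.

(** * The three kinds of transformations *)

Section Transformations.
Variables (R : realType) (m al : nat).
Hypothesis hal : (1 <= al)%N.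
Local Notation C := R[i].
Local Notation A := (ser R m).
Implicit Types (f g h y T : A) (p q k : nat) (a : R) (v w : vfield R m).
Implicit Types (M : 'M[R]_m).
Local Notation zz := (zz R m).
Local Notation ww := (ww R m).
Local Notation cst := (@cst R m).
Local Notation pser := (@param_series R m).

Lemma psub_fld Phi f : psub Phi -> (Phi f, Phi (star f)) = fld (Phi f).
Proof. by move=> hP; rewrite /fld psub_star. Qed.

Definition linpar M (i : 'I_m) : A := \sum_(j < m) cst (M i j)%:C%C * mu R j.

Lemma pser_linpar M i :
  pser (fun n => \sum_(j < m) M i j * (n == U_(j)%MM)%:R) = linpar M i.
Proof.
apply: ser_eqP => -[[j k] n]; rewrite /linpar co_sum {1}/co /param_series.
transitivity (\sum_(l < m) (M i l)%:C%C * ((j, k, n) == (0%N, 0%N, U_(l)%MM))%:R); last first.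
  by apply: eq_bigr => l _; rewrite coZ -[mu R l]/(mono R (0%N, 0%N, U_(l)%MM)) co_mono.
case: (boolP ((j == 0%N) && (k == 0%N))) => hjk.
  rewrite rmorph_sum; apply: eq_bigr => l _.
  by rewrite rmorphM rmorph_nat !xpair_eqE hjk.
by rewrite big1 // => l _; rewrite !xpair_eqE (negbTE hjk) mulr0.
Qed.

Lemma rp_linpar M i : rp (linpar M i).
Proof. by rewrite -pser_linpar; exact: param_rp. Qed.

Lemma flt_linpar M i : flt 1 1 (linpar M i).
Proof. by apply: flt_sum => j _; apply/fltMr/flt_mu. Qed.

Definition Lop M : A -> A := Sub zz ww (linpar M).

Lemma psub_Lop M : psub (Lop M).
Proof. by apply: psub_Sub => i; [exact: flt_linpar | exact: rp_linpar]. Qed.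

Lemma Lop_mu M i : Lop M (mu R i) = linpar M i.
Proof. by rewrite /Lop Sub_mu //; [exact: flt_zz|exact: flt_ww|exact: flt_linpar]. Qed.

Lemma linear_reparam_fld M f : linear_reparam M (fld f) = fld (Lop M f).
Proof.
rewrite -(psub_fld f (psub_Lop M)) /linear_reparam /vsubst /Lop.
have e : (fun i => pser (fun n => \sum_(j < m) M i j * (n == U_(j)%MM)%:R)) = linpar M.
  by apply/funext => i; exact: pser_linpar.
by rewrite !ssubstE ?e // => i; rewrite pser_linpar; exact: flt_linpar.
Qed.

Lemma pser_near (yP : param_space R m) i :
  pser (fun n => (n == U_(i)%MM)%:R + yP i n) = mu R i + (pser (yP i) : A).
Proof.
apply: ser_eqP => -[[j k] n]; rewrite coD -[mu R i]/(mono R (0%N, 0%N, U_(i)%MM)) co_mono.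
rewrite /co /param_series !xpair_eqE.
by case: (_ && _); rewrite ?addr0 // rmorphD rmorph_nat.
Qed.

Lemma param_map_fld (yP : param_space R m) f : (forall i, flt 1 2 (pser (yP i))) ->
  param_map yP (fld f) = fld (Sub zz ww (fun i => mu R i + (pser (yP i) : A)) f).
Proof.
move=> h; have h1 i : flt 1 1 (mu R i + (pser (yP i) : A)).
  by apply: fltD; [exact: flt_mu | apply: (flt_le (h i))].
have hp : psub (Sub zz ww (fun i => mu R i + (pser (yP i) : A))).
  by apply: psub_Sub => // i; apply: rpD; [exact: rp_mu | exact: param_rp].
rewrite -(psub_fld f hp) /param_map /vsubst.
have e : (fun i => pser (fun n => (n == U_(i)%MM)%:R + yP i n)) =
    (fun i => mu R i + (pser (yP i) : A)) by apply/funext => i; exact: pser_near.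
by rewrite !ssubstE ?e // => i; rewrite pser_near.
Qed.

Lemma time_map_fld t f : time_map t (fld f) = fld ((1 + (time_series t : A)) * f).
Proof.
have [_ st] := time_rr t; rewrite /time_map /time_act /vmul /fld starM starD star1 st.
by rewrite !mulrDl !mul1r.
Qed.

Lemma param_filtE (yP : param_space R m) :
  param_filt al 1 yP <-> forall i, flt 1 2 (pser (yP i)).
Proof.
split=> [h i|h i n hn].
  split=> -[[j k] n]; rewrite /wt /= mul1n => hn; rewrite /co /param_series /=.
  case: andP => // -[/eqP ej /eqP ek]; rewrite h ?rmorph0 // (addnC 1%N) addn1 ltnS.
  by rewrite -[leqRHS]muln1 leq_mul2l; apply/orP; right; move: hn; rewrite ej ek.
have : co (pser (yP i)) (0%N, 0%N, n) = 0.
  apply: (flt_co (h i)); rewrite /wt /= mul1n; move: hn.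
  case: (ltnP (mdeg n) 2) => // h2 hn.
  have : (al * 2 <= al * mdeg n)%N by rewrite leq_mul2l h2 orbT.
  by lia.
by rewrite /co /param_series /= => /(congr1 (@complex.Re R)).
Qed.

Lemma time_filtE (t : time_space R m) :
  time_filt al 1 t <-> flt 1 1 (time_series t).
Proof.
split=> [h|h k n hn].
  split=> -[[j k] n]; rewrite /wt /= mul1n => hn; rewrite /co /time_series /=.
  case: eqP => // e; rewrite h ?rmorph0 //.
  have [-> ->] : j = 0%N /\ mdeg n = 0%N by lia.
  by rewrite !muln0.
have : co (time_series t) (k, k, n) = 0.
  apply: (flt_co h); rewrite /wt /= mul1n; move: hn.
  case: (posnP (mdeg n)) => [->|h2]; first by lia.
  have : (1 * 1 <= al * mdeg n)%N by exact: leq_mul.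
  by lia.
by rewrite /co /time_series /= eqxx => /(congr1 (@complex.Re R)).
Qed.

(** Over the ring of series, the state, time and parameter transformations are an
    exponential, the product with a unit and an endomorphism; [transform_exists]
    is the converse. *)
Lemma transform_data (yP : param_space R m) (yT : time_space R m) (yS : vfield R m) f :
  filtA al 1 yP yT yS ->
  exists y T Phi, [/\ flt 1 2 y, moving y, rr T & flt 1 1 (T - 1)] /\
    [/\ psub Phi, forall i, flt 1 2 (Phi (mu R i) - mu R i) &
     param_map yP (time_map yT (exp_ad yS (fld f))) = fld (Phi (T * adE y f))].
Proof.
case=> /param_filtE hP /time_filtE hT hS.
have [eS mS fS] := state_filt_fld hal hS.
have h1 i : flt 1 1 (mu R i + (pser (yP i) : A)).
  by apply: fltD; [exact: flt_mu | apply: (flt_le (hP i))].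
exists yS.1, (1 + (time_series yT : A)), (Sub zz ww (fun i => mu R i + (pser (yP i) : A))).
split; first split=> //.
- exact: (flt_al_1 hal).
- by apply: rrD; [exact: rr1|exact: time_rr].
- by rewrite (addrC 1) addrK.
split.
- by apply: psub_Sub => // i; apply: rpD; [exact: rp_mu | exact: param_rp].
- move=> i; rewrite Sub_mu //; [by rewrite (addrC (mu R i)) addrK|exact: flt_zz|exact: flt_ww].
by rewrite {1}eS exp_ad_fld time_map_fld param_map_fld.
Qed.

Lemma transform_exists y T Phi f : flt 1 2 y -> moving y -> rr T -> flt 1 1 (T - 1) ->
  psub Phi -> (forall i, flt 1 2 (Phi (mu R i) - mu R i)) ->
  exists yP yT yS, filtA al 1 yP yT yS /\
     param_map yP (time_map yT (exp_ad yS (fld f))) = fld (Phi (T * adE y f)).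
Proof.
move=> hy my rT hT hPhi nPhi.
have [t et] := rr_time (rrB rT (rr1 _ _)).
have /fin_all_exists [yP hyP] i : exists r : pseries R m, Phi (mu R i) - mu R i = pser r.
  by apply: rp_param; apply: rpB; [exact: psub_mu|exact: rp_mu].
have fP i : flt 1 2 (pser (yP i)) by rewrite -hyP.
exists yP, t, (fld y); split.
  split; [exact/param_filtE|by apply/time_filtE; rewrite -et|].
  apply: (fld_state_filt hal) => //; split=> x hx; rewrite (flt_co hy) //.
  move: hx; rewrite /wt; have : (mdeg x.2 <= al * mdeg x.2)%N by rewrite leq_pmull.
  by lia.
rewrite exp_ad_fld time_map_fld param_map_fld // -et addrCA addrN addr0; congr fld.
have h1 i : flt 1 1 (mu R i + (pser (yP i) : A)).
  by apply: fltD; [exact: flt_mu | apply: (flt_le (fP i))].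
have hp : psub (Sub zz ww (fun i => mu R i + (pser (yP i) : A))).
  by apply: psub_Sub => // i; apply: rpD; [exact: rp_mu | exact: param_rp].
apply: psub_ext => // i; rewrite Sub_mu //; [|exact: flt_zz|exact: flt_ww].
by rewrite -hyP (addrC (mu R i)) subrK.
Qed.

End Transformations.

(** * Reductions to the normal form *)

Section Reductions.
Variables (R : realType) (N : nat).
Hypothesis hN : (1 <= N)%N.
Local Notation C := R[i].
Local Notation A := (ser R N).
Local Notation al := (2 * N + 1)%N.
Implicit Types (f g h y T b : A) (p q k : nat) (a : R) (v w : vfield R N).
Implicit Types (M : 'M[R]_N) (chi : 'I_N -> A).
Local Notation zz := (zz R N).
Local Notation ww := (ww R N).
Local Notation cst := (@cst R N).
Local Notation ss := (ss R N).
Local Notation ii := (ii R N).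
Local Notation pser b := (@param_series R N b : A).

Lemma fld_inj f g : fld f = fld g -> f = g.
Proof. by case. Qed.

Lemma fld_sum I r (F : I -> A) : fld (\sum_(i <- r) F i) = \sum_(i <- r) fld (F i).
Proof.
elim: r => [|i r IH]; first by rewrite !big_nil /fld star0.
by rewrite !big_cons fldD IH.
Qed.

Lemma infinite_form a (b : pseries R N) : infinite_level_form 1 a b =
  fld (zz * (unf a (@mu R N) ss + ii * (1 + pser b * ss ^+ N))).
Proof.
rewrite /infinite_level_form Ymon_fld.
have -> : \sum_(i < N) Xmon i.+1 i U_((1%g : 'S_N) i)%MM =
    fld (zz * \sum_(i < N) mu R i * ss ^+ i).
  rewrite big_distrr fld_sum; apply: eq_bigr => i _; rewrite Xmon_fld perm1; congr fld.
  by rewrite rmorph1 mul1r -ixadd_z monoD mono_rad [mu R i * _]mulrC.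
have -> : vscale a (Xmon N.+1 N 0%MM) = fld (zz * (cst a%:C%C * ss ^+ N)).
  rewrite Xmon_fld /vscale /fld !sscaleE rmorph1 mul1r.
  rewrite !starM star_cst conjc_real starX star_ss star_zz star_mono.
  have e : mono R (N, N.+1, 0%MM) = ww * ss ^+ N.
    by rewrite ssE -[ww]/(mono R (0%N, 1%N, 0%MM)) -monoD ixadd_w.
  have e' : mono R (N.+1, N, 0%MM) = zz * ss ^+ N.
    by rewrite ssE -[zz]/(mono R (1%N, 0%N, 0%MM)) -monoD ixadd_z.
  by rewrite /swap /= e e'; congr (_, _); rewrite mulrCA.
have -> : XYseries (fun _ _ _ => 0)
      (fun j k n => if (j == N.+1) && (k == N) then b n else 0) =
    fld (ii * (zz * (ss ^+ N * pser b))).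
  have e : (XYseries (fun _ _ _ => 0)
      (fun j k n => if (j == N.+1) && (k == N) then b n else 0)).1 =
    ii * (zz * (ss ^+ N * pser b)).
    apply: ser_eqP => -[[j k] n]; rewrite coZ.
    have [pb _] := param_rp b.
    case: j => [|j].
      by rewrite (coM_mono0 (b := (1%N, 0%N, 0%MM))) ?mulr0 // => -[[j' k'] n']; rewrite ixadd_z.
    have -> : co (zz * (ss ^+ N * pser b)) (j.+1, k, n) = co (ss ^+ N * pser b) (j, k, n).
      by rewrite -ixadd_z; exact: (coM_mono (1%N, 0%N, 0%MM)).
    case: (j =P k) => [->|/eqP hj]; last first.
      rewrite (rad_co _ _ hj); last by apply: radM; [apply/radX; case: (rr_ss R N)|exact: par_rad].
      rewrite mulr0 /co /= eqSS; case: andP => // -[/eqP e1 /eqP e2].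
      by move: hj; rewrite e1 e2 eqxx.
    rewrite co_ss_par // /co /= eqSS andbb /param_series /=.
    case: (k =P N) => _; last by rewrite mulr0n mulr0.
    rewrite mulr1n; apply/eqP; rewrite eq_complex /=.
    by rewrite !(mul0r, mul1r, subr0, addr0, mulr0, subrr, add0r, oppr0, eqxx).
  rewrite [LHS]surjective_pairing e; congr pair; rewrite -e.
  apply: ser_eqP => -[[j k] n]; rewrite co_star /co /=.
  by apply/eqP; rewrite eq_complex /= !eqxx.
rewrite -!fldD; congr fld; rewrite -[mono R (1%N, 0%N, 0%MM)]/zz -[cst 'i%C]/ii /unf.
ring.
Qed.

Lemma linparM M M' i :
  \sum_(j < N) cst (M i j)%:C%C * linpar M' j = linpar (M *m M') i.
Proof.
rewrite /linpar; under eq_bigr do rewrite big_distrr.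
rewrite exchange_big; apply: eq_bigr => k _; rewrite mxE !rmorph_sum big_distrl.
by apply: eq_bigr => j _ /=; rewrite mulrA !rmorphM.
Qed.

Lemma linpar1 (i : 'I_N) : linpar 1%:M i = mu R i.
Proof.
rewrite /linpar (bigD1 i) //= big1 ?addr0 => [|j hj]; first by rewrite mxE eqxx !rmorph1 mul1r.
by rewrite mxE eq_sym (negbTE hj) !rmorph0 mul0r.
Qed.

Lemma psub_linpar Phi M i : psub Phi ->
  Phi (linpar M i) = \sum_(j < N) cst (M i j)%:C%C * Phi (mu R j).
Proof.
move=> hP; rewrite /linpar (oper_sum _ _ _ hP); apply: eq_bigr => j _.
by rewrite (operZ hP).
Qed.

Lemma Lop_linpar M M' i : Lop M (linpar M' i) = linpar (M' *m M) i.
Proof.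
rewrite (psub_linpar _ _ (psub_Lop M)) -linparM.
by apply: eq_bigr => j _; rewrite Lop_mu.
Qed.

Lemma LopK M f : M \in unitmx -> Lop M (Lop (invmx M) f) = f.
Proof.
move=> hM; apply: (psub_ext _ (psub_comp (psub_Lop M) (psub_Lop (invmx M))) (psub_id R N)) => i.
by rewrite /= Lop_mu Lop_linpar mulVmx // linpar1.
Qed.

Lemma LopVK M f : M \in unitmx -> Lop (invmx M) (Lop M f) = f.
Proof.
move=> hM; apply: (psub_ext _ (psub_comp (psub_Lop (invmx M)) (psub_Lop M)) (psub_id R N)) => i.
by rewrite /= Lop_mu Lop_linpar mulmxV // linpar1.
Qed.

Lemma psub_unf Phi a chi : psub Phi ->
  Phi (unf a chi ss) = unf a (fun i => Phi (chi i)) ss.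
Proof.
move=> hP; rewrite /unf (operD hP) (algM hP) (alg_cst _ hP) (algX _ _ hP) (psub_ss hP).
congr (_ + _); rewrite (oper_sum _ _ _ hP); apply: eq_bigr => i _.
by rewrite (algM hP) (algX _ _ hP) (psub_ss hP).
Qed.

Lemma psub_form Phi a chi b : psub Phi ->
  Phi (zz * (unf a chi ss + ii * (1 + b * ss ^+ N))) =
  zz * (unf a (fun i => Phi (chi i)) ss + ii * (1 + Phi b * ss ^+ N)).
Proof.
move=> hP; rewrite (algM hP) (psub_zz hP) (operD hP) (psub_unf _ _ hP) (algM hP).
by rewrite (alg_cst _ hP) (operD hP) (alg1 hP) (algM hP) (algX _ _ hP) (psub_ss hP).
Qed.

Lemma al1 : (1 <= al)%N. Proof. by rewrite addn1. Qed.

(** Undoing the change of parameters turns the parameters of the normal form into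
    unfolding functions. *)
Lemma reduced_data f a (b : pseries R N) :
  reduces_to al (fld f) (infinite_level_form 1 a b) ->
  exists y t Phi Psi, [/\ flt 1 2 y, rr t, flt 1 1 (t - 1) & psub Psi] /\
    [/\ forall h, Phi (Psi h) = h, forall i, flt 1 1 (Psi (mu R i)) &
     adE y f = zz * (t * (unf a (fun i => Psi (mu R i)) ss +
                     ii * (1 + Psi (pser b) * ss ^+ N)))].
Proof.
case=> yP [yT [yS [M [hA hM]]]]; rewrite infinite_form.
have [y [T [Phi [[hy _ rT hT] [pP nP ->]]]]] := transform_data al1 f hA.
rewrite linear_reparam_fld => /fld_inj e.
have [Psi [pPsi K1 K2 _]] := psub_inv pP nP.
have [t [rt et ht]] := inv_exists (good_rr R N) rT hT.
have pPL : psub (Psi \o Lop (invmx M)) by apply: psub_comp => //; exact: psub_Lop.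
exists y, t, (Lop M \o Phi), (Psi \o Lop (invmx M)); split; first by [].
split.
- by move=> h; rewrite /= K1 LopK.
- by move=> i; apply: (operF pPL); exact: flt_mu.
have e2 : T * adE y f = (Psi \o Lop (invmx M)) (zz * (unf a (@mu R N) ss + ii * (1 + pser b * ss ^+ N))).
  by rewrite e /= LopVK // K2.
move: e2; rewrite (psub_form _ _ _ pPL) => e2.
have -> : adE y f = t * (T * adE y f) by rewrite mulrA (mulrC t) et mul1r.
by rewrite e2 mulrCA.
Qed.

Lemma rp_linear f : rp f -> flt 1 1 f ->
  flt 1 2 (f - \sum_(j < N) cst (complex.Re (co f (0%N, 0%N, U_(j)%MM)))%:C%C * mu R j).
Proof.
move=> [pf sf] hf; set g := \sum_(j < N) _.
have pg : par g.
  by apply: supp_sum => j _; apply: parM; [exact: par_cst|exact: par_mu].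
split=> -[[j k] n]; rewrite /wt /= mul1n => hn; rewrite coB.
case: (boolP ((j + k)%N == 0%N)) => hjk; last first.
  by rewrite (supp_co pf (x := (j, k, n))) // (supp_co pg (x := (j, k, n))) // subrr.
move: hjk; rewrite addn_eq0 => /andP[/eqP ej /eqP ek]; rewrite ej ek in hn *.
case: (posnP (mdeg n)) => hn0.
  have [h1 h2] : flt 1 1 f /\ flt 1 1 g.
    by split=> //; apply: flt_sum => l _; apply/fltMr/flt_mu.
  by rewrite (flt_co h1) ?(flt_co h2) ?subrr // /wt hn0.
have /mdeg1P [l /eqP el] : mdeg n == 1%N by rewrite !add0n in hn; rewrite eqn_leq hn0 andbT.
rewrite el /g co_sum (bigD1 l) //= big1 ?addr0 => [|i hi]; last first.
  rewrite coZ -[mu R i]/(mono R (0%N, 0%N, U_(i)%MM)) co_mono !xpair_eqE /=.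
  case: eqP => [e|]; rewrite ?mulr0 //.
  move: hi; have := congr1 (fun n : 'X_{1..N} => n i) e; rewrite !mnm1E eqxx eq_sym.
  by case: eqP.
rewrite coZ -[mu R l]/(mono R (0%N, 0%N, U_(l)%MM)) co_mono eqxx mulr1.
by rewrite (rr_real 0 _ sf) subrr.
Qed.

(** Taking the unfolding functions [chi] as new parameters: their linear part is
    straightened by a linear reparametrization, and what remains is a change of
    parameters near the identity. *)
Lemma normal_reduces f y T a chi b : flt 1 2 y -> moving y -> rr T -> flt 1 1 (T - 1) ->
  (forall i, rp (chi i)) -> (forall i, flt 1 1 (chi i)) -> rp b ->
  \matrix_(i, j) complex.Re (co (chi i) (0%N, 0%N, U_(j)%MM)) \in unitmx ->
  T * adE y f = zz * (unf a chi ss + ii * (1 + b * ss ^+ N)) ->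
  exists beta, reduces_to al (fld f) (infinite_level_form 1 a beta).
Proof.
move=> hy my rT hT rc hc rb; set X := \matrix_(i, j) _ => uX e.
have pK : psub (Sub zz ww chi) by exact: psub_Sub.
have eK i : Sub zz ww chi (mu R i) = chi i by rewrite Sub_mu //; [exact: flt_zz|exact: flt_ww].
(* [K \o Lop X^-1] is near the identity, since [K] has the linear part [X]. *)
have pK' := psub_comp pK (psub_Lop (invmx X)).
have nK' i : flt 1 2 ((Sub zz ww chi \o Lop (invmx X)) (mu R i) - mu R i).
  rewrite /= Lop_mu (psub_linpar _ _ pK) -(linpar1 i) -(mulVmx uX) -linparM -sumrB.
  apply: flt_sum => j _; rewrite eK -mulrBr; apply: fltMr.
  have := rp_linear (rc j) (hc j); congr (flt _ _ (_ - _)).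
  by apply: eq_bigr => l _; rewrite mxE.
have [Phi [pPhi _ KP nPhi]] := psub_inv pK' nK'.
have eP i : Phi (chi i) = linpar X i by rewrite -eK -{1}[mu R i](LopVK _ uX) KP Lop_mu.
have pLP := psub_comp (psub_Lop (invmx X)) pPhi.
have [beta eb] : exists q : pseries R N, Lop (invmx X) (Phi b) = pser q.
  by apply: rp_param; exact: (psub_rp pLP).
have [yP [yT [yS [hA eA]]]] := transform_exists al1 f hy my rT hT pPhi nPhi.
exists beta, yP, yT, yS, (invmx X); split=> //; first by rewrite unitmx_inv.
rewrite eA linear_reparam_fld e infinite_form; congr fld.
transitivity ((Lop (invmx X) \o Phi) (zz * (unf a chi ss + ii * (1 + b * ss ^+ N)))) => //.
rewrite (psub_form _ _ _ pLP) /= eb /unf; congr (_ * (_ + _ + _)).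
by apply: eq_bigr => i _; rewrite eP Lop_linpar mulmxV // linpar1.
Qed.

(** Two reductions of one field give two normal forms with unfolding functions
    [Psi mu_i] and [Psi' mu_i]; by [normal_unique] these agree, hence so do the
    changes of parameters. *)
Lemma reduction_unique f a (b : pseries R N) a' (b' : pseries R N) : flt 1 1 f -> a != 0 ->
  reduces_to al (fld f) (infinite_level_form 1 a b) ->
  reduces_to al (fld f) (infinite_level_form 1 a' b') -> a' = a /\ b' = b.
Proof.
move=> hf a0 /reduced_data[y [t [Phi [Psi [[hy rt ht pP] [K h1 e]]]]]].
case/reduced_data=> [y' [t' [Phi' [Psi' [[hy' rt' ht' pP'] [_ h1' e']]]]]].
have rm (Th : A -> A) : psub Th -> forall i, rp (Th (mu R i)) by move=> hT i; exact: psub_mu.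
have [ea ec eb] := normal_unique hN a0 hf hy hy' (rm _ pP) h1 (psub_rp pP (param_rp b))
  (rm _ pP') h1' (psub_rp pP' (param_rp b')) rt ht rt' ht' e e'.
split=> //; apply/funext => n.
have {}eb : pser b' = pser b :> A.
  by rewrite -(K (pser b')) -(K (pser b)) -eb; congr Phi; apply: psub_ext => // i; rewrite ec.
have := congr1 (fun g : A => complex.Re (co g (0%N, 0%N, n))) eb.
by rewrite /co /param_series.
Qed.

End Reductions.

(** * Terms that are linear in the parameters *)

Section LinearTerms.
Variables (R : realType) (m : nat).
Local Notation A := (ser R m).
Implicit Types (f V : A) (k : nat).
Local Notation ss := (ss R m).

Lemma co_ss_sub k f i n : (k <= i)%N -> co (ss ^+ k * f) (i, i, n) = co f ((i - k)%N, (i - k)%N, n).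
Proof.
move=> h; have -> : (i, i, n) = ixadd (k, k, 0%MM) ((i - k)%N, (i - k)%N, n) :> idx m.
  by rewrite ixadd_ss subnKC.
exact: co_ss.
Qed.

Lemma slot_split D f : rr f ->
  f = \sum_(i < D) ss ^+ i * slot i f + ss ^+ D * shift D f.
Proof.
move=> rf; have rS : rr (\sum_(i < D) ss ^+ i * slot i f + ss ^+ D * shift D f).
  apply: rrD; last by apply: rrM; [apply/rrX/rr_ss|exact: shift_rr].
  by apply: rr_sum => i _; apply: rrM; [apply/rrX/rr_ss|apply/rp_rr/slot_rp].
apply: ser_eqP => -[[j k] n]; case: (j =P k) => [->|/eqP hj]; last first.
  by rewrite (rad_co _ (proj1 rf) hj) (rad_co _ (proj1 rS) hj).
rewrite coD co_sum.
have es (i : 'I_D) : co (ss ^+ i * slot i f) (k, k, n) = co f (k, k, n) *+ (i == k :> nat).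
  rewrite co_ss_par; last by case: (slot_rp i rf).
  by rewrite co_slot eq_sym; case: eqP => [->|]; rewrite ?mulr0n.
rewrite (eq_bigr _ (fun i _ => es i)) (ord_sum_delta D (fun=> co f (k, k, n)) k).
case: (ltnP k D) => hk; first by rewrite co_ss_lt // addr0.
rewrite co_ss_sub // add0r /co /shift /=.
by rewrite subnKC.
Qed.

Lemma psub_slot Phi k f : psub Phi -> rr f -> slot k (Phi f) = Phi (slot k f).
Proof.
move=> hP rf; have pk : par (Phi (slot k f)) by case: (psub_rp hP (slot_rp k rf)).
have [pk' _] := slot_rp k (psub_rr hP rf).
apply: ser_eqP => -[[i j] n]; case: (boolP ((i + j)%N == 0%N)) => h; last first.
  by rewrite (supp_co pk (x := (i, j, n))) // (supp_co pk' (x := (i, j, n))).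
move: h; rewrite addn_eq0 => /andP[/eqP -> /eqP ->]; rewrite co_slot.
rewrite {1}(slot_split k.+1 rf) (operD hP) (oper_sum _ _ _ hP) coD co_sum.
rewrite (algM hP) (algX _ _ hP) (psub_ss hP) co_ss_lt // addr0.
have es (l : 'I_k.+1) : co (Phi (ss ^+ l * slot l f)) (k, k, n) =
   co (Phi (slot l f)) (0%N, 0%N, n) *+ (l == k :> nat).
  rewrite (algM hP) (algX _ _ hP) (psub_ss hP) co_ss_par 1?eq_sym //.
  by case: (psub_rp hP (slot_rp l rf)).
rewrite (eq_bigr _ (fun l _ => es l)).
rewrite (ord_sum_delta k.+1 (fun l => co (Phi (slot l f)) (0%N, 0%N, n)) k).
by rewrite ltnSn.
Qed.

Lemma flt_slot1 k f : rr f -> co f (k, k, 0%MM) = 0 -> flt 1 1 (slot k f).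
Proof.
move=> rf h; have [pk _] := slot_rp k rf; split=> -[[i j] n].
rewrite /wt /= mul1n => hn.
have [-> -> hn0] : [/\ i = 0%N, j = 0%N & mdeg n = 0%N] by split; lia.
by move/eqP: hn0; rewrite mdeg_eq0 => /eqP ->; rewrite co_slot.
Qed.

(** A change of parameters near the identity affects the terms that are linear in
    the parameters only through terms without parameters. *)
Lemma psub_linear Phi k f : psub Phi -> near Phi -> rr f ->
  co (Phi f) (k, k, 0%MM) = co f (k, k, 0%MM) /\
  (co f (k, k, 0%MM) = 0 -> forall j,
     co (Phi f) (k, k, U_(j)%MM) = co f (k, k, U_(j)%MM)).
Proof.
move=> hP nP rf; split=> [|h j].
all: rewrite -(co_slot k f) -(co_slot k (Phi f)) (psub_slot _ hP rf).
all: apply/eqP; rewrite -subr_eq0 -coB.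
  by rewrite (flt_co (nP 0%N _ (flt_0 _ _))) // /wt mdeg0.
by rewrite (flt_co (nP 1%N _ (flt_slot1 rf h))) // /wt mdeg1.
Qed.

(** Since [f] has no constant term, the parameter in a linear term of the product
    comes from [f]. *)
Lemma co_linearM f V i (j : 'I_m) : rp f -> flt 1 1 f ->
  co (f * V) (i, i, U_(j)%MM) = co f (0%N, 0%N, U_(j)%MM) * co V (i, i, 0%MM).
Proof.
move=> rf hf; have hr := rp_linear rf hf; set g := (\sum_(l < m) _ : A) in hr.
have pr : par (f - g).
  apply: suppB; first by case: rf.
  by apply: supp_sum => l _; apply: parM; [exact: par_cst|exact: par_mu].
rewrite -{1}[f](subrK g) mulrDl coD.
rewrite (@coM_eq0 _ _ (f - g)) ?add0r; last first.
  move=> [[a b] c] [[a' b'] c'] /(congr1 snd) /= ec.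
  case: (boolP ((a + b)%N == 0%N)) => h; last first.
    by rewrite (supp_co pr (x := (a, b, c))) // mul0r.
  rewrite (flt_co hr) ?mul0r //; move: (congr1 mdeg ec); rewrite mdegD mdeg1 /wt /= (eqP h).
  by lia.
rewrite /g mulr_suml co_sum (bigD1 j) //= big1 ?addr0 => [|l hl].
  rewrite -mulrA coZ -[mu R j]/(mono R (0%N, 0%N, U_(j)%MM)).
  have -> : (i, i, U_(j)%MM) = ixadd (0%N, 0%N, U_(j)%MM) (i, i, 0%MM) :> idx m.
    by rewrite /ixadd /= addm0.
  by rewrite coM_mono (rr_real 0 _ (proj2 rf)).
rewrite -mulrA coZ -[mu R l]/(mono R (0%N, 0%N, U_(l)%MM)) coM_mono0 ?mulr0 //.
case=> [[a b] c] /(congr1 snd) /= ec; move: hl; have := congr1 (fun n : 'X_{1..m} => n l) ec.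
by rewrite mnmDE !mnm1E eqxx eq_sym; case: eqP.
Qed.

End LinearTerms.

(** * Existence of the normal form *)

Section Existence.
Variables (R : realType) (N : nat).
Hypothesis hN : (1 <= N)%N.
Local Notation C := R[i].
Local Notation A := (ser R N).
Local Notation al := (2 * N + 1)%N.
Implicit Types (f g h y T b P Q L V W : A) (p q k : nat) (a : R) (v w : vfield R N).
Implicit Types (chi : 'I_N -> A).
Local Notation cst := (@cst R N).
Local Notation ss := (ss R N).

Lemma co_linear_sum (F : 'I_N -> A) (V : 'I_N -> A) W (i j : 'I_N) :
  (forall l, rp (F l)) -> (forall l, flt 1 1 (F l)) ->
  co (\sum_(k < N) ss ^+ k * (F k * V k) + ss ^+ N * W) (i : nat, i : nat, U_(j)%MM) =
  \sum_(k < N) (if (k <= i)%N then co (V k) ((i - k)%N, (i - k)%N, 0%MM) else 0) *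
               co (F k) (0%N, 0%N, U_(j)%MM).
Proof.
move=> rF hF; rewrite coD co_sum (co_ss_lt (k := N)) // addr0; apply: eq_bigr => k _.
case: leqP => hk; last by rewrite co_ss_lt // mul0r.
by rewrite co_ss_sub // co_linearM // mulrC.
Qed.

Lemma flt_al1 f : flt al 1 f -> flt 1 1 f.
Proof.
move=> hf; split=> x hx; rewrite (flt_co hf) //; move: hx; rewrite /wt mul1n !ltnS !leqn0.
by rewrite !addn_eq0 => /andP[-> /eqP ->]; rewrite muln0.
Qed.

Lemma co1_flt f : flt 1 1 (f - 1) -> co f (0%N, 0%N, 0%MM) = 1.
Proof.
move=> h; apply/eqP; rewrite -subr_eq0.
have := flt_co h (x := (0%N, 0%N, 0%MM)); rewrite coB co1 eqxx => -> //.
by rewrite /wt mdeg0.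
Qed.

(** The equation expresses the linear parts of the unfolding parameters through
    those of the given field, by a triangular system. *)
Lemma core_linear a P L chi b : rr P -> (forall k, (k < N)%N -> co P (k, k, 0%MM) = 0) ->
  adm L chi b -> core a P 1 L chi b = 0 ->
  \matrix_(k < N, j < N) complex.Re (co P (k : nat, k : nat, U_(j)%MM)) \in unitmx ->
  \matrix_(i < N, j < N) complex.Re (co (chi i) (0%N, 0%N, U_(j)%MM)) \in unitmx.
Proof.
move=> rP hP [rL hL rc hc rb] e uA.
have hL1 := flt_al1 hL; have hc1 i : flt 1 1 (chi i).
  by apply: flt_al1; apply: (flt_le (hc i)); rewrite addn1.
(* Both sides of the equation become sums over the unfolding functions [chi k],
   resp. the coefficients of [P], with triangular matrices of diagonal 2. *)
pose V : A := L *+ 2 + Eu L.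
pose Cm : 'M[C]_N := \matrix_(i, k) (if (k <= i)%N then co (L ^+ k.+1 *+ 2) ((i - k)%N, (i - k)%N, 0%MM) else 0).
pose Dm : 'M[C]_N := \matrix_(i, k) (if (k <= i)%N then co V ((i - k)%N, (i - k)%N, 0%MM) else 0).
pose Am : 'M[C]_N := \matrix_(k, j) co (slot k P) (0%N, 0%N, U_(j)%MM).
pose Xm : 'M[C]_N := \matrix_(i, j) co (chi i) (0%N, 0%N, U_(j)%MM).
have two0 : 2 != 0 :> C by rewrite pnatr_eq0.
have uT (M : 'M[C]_N) : (forall i j : 'I_N, (i < j)%N -> M i j = 0) ->
    (forall i, M i i = 2) -> M \in unitmx.
  move=> h1 h2; rewrite unitmxE det_trig; last by apply/is_trig_mxP.
  by rewrite unitfE; apply/prodf_neq0 => i _; rewrite h2.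
have uC : Cm \in unitmx.
  apply: uT => [i j hij|i]; rewrite mxE; first by rewrite leqNgt hij.
  by rewrite leqnn subnn coMn co1_flt // ; apply: (@cg1X _ _ 1).
have uD : Dm \in unitmx.
  apply: uT => [i j hij|i]; rewrite mxE; first by rewrite leqNgt hij.
  by rewrite leqnn subnn /V coD coMn co1_flt // co_Eu addr0.
have eM : Cm *m Xm = Dm *m Am.
  apply/matrixP => i j; rewrite !mxE.
  have rS (k : 'I_N) : rp (slot k P) by exact: slot_rp.
  have hS (k : 'I_N) : flt 1 1 (slot k P) by apply: flt_slot1 => //; exact: hP.
  have eL := co_linear_sum (fun k : 'I_N => L ^+ k.+1 *+ 2) (cst a%:C%C * L ^+ N * L *+ 2) i j rc hc1.
  have eR := co_linear_sum (fun k : 'I_N => V) (shift N P * V + P * V * b * L ^+ N) i j rS hS.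
  under eq_bigr do rewrite !mxE.
  under [RHS]eq_bigr do rewrite !mxE.
  rewrite -eL -eR; congr (co _ _); move: e; rewrite /core.
  have -> : L * unf a chi (ss * L) * 1 *+ 2 = \sum_(k < N) ss ^+ k * (chi k * (L ^+ k.+1 *+ 2)) + ss ^+ N * (cst a%:C%C * L ^+ N * L *+ 2).
    rewrite /unf mulr1 exprMn mulrDr mulr_sumr mulrnDl addrC -sumrMnl; congr (_ + _).
      by apply: eq_bigr => k _; rewrite exprMn exprS; ring.
    ring.
  have -> : P * (L *+ 2 + Eu L) * (1 + b * (ss * L) ^+ N) =
      \sum_(k < N) ss ^+ k * (slot k P * V) + ss ^+ N * (shift N P * V + P * V * b * L ^+ N).
    have eP := slot_split N rP; set S := (\sum_(k < N) ss ^+ k * slot k P : A) in eP.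
    have -> : \sum_(k < N) ss ^+ k * (slot k P * V) = S * V.
      by rewrite mulr_suml; apply: eq_bigr => k _; rewrite mulrA.
    have gen (p v s sN sh b' l : A) : p = s + sN * sh ->
        p * v * (1 + b' * (sN * l)) = s * v + sN * (sh * v + p * v * b' * l).
      by move=> ep; rewrite {1}ep ep; ring.
    by rewrite exprMn; exact: gen.
  by move/eqP; rewrite subr_eq0 => /eqP.
have uAm : Am \in unitmx.
  suff -> : Am = map_mx (real_complex R) (\matrix_(k < N, j < N) complex.Re (co P (k : nat, k : nat, U_(j)%MM))).
    by rewrite map_unitmx.
  by apply/matrixP => k j; rewrite !mxE co_slot (rr_real k _ (proj2 rP)).
have uX : Xm \in unitmx.
  have : Cm *m Xm \in unitmx by rewrite eM unitmx_mul uD.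
  by rewrite unitmx_mul uC.
rewrite -(map_unitmx (real_complex R)).
suff <- : Xm = map_mx (real_complex R) (\matrix_(i < N, j < N) complex.Re (co (chi i) (0%N, 0%N, U_(j)%MM))) by [].
by apply/matrixP => k j; rewrite !mxE (rr_real 0 _ (proj2 (rc k))).
Qed.

End Existence.

Section Conjugation.
Variables (R : realType) (N : nat).
Hypothesis hN : (1 <= N)%N.
Local Notation C := R[i].
Local Notation A := (ser R N).
Local Notation al := (2 * N + 1)%N.
Implicit Types (f g h y T t b P Q L V W : A) (p q k : nat) (a : R) (v w : vfield R N).
Implicit Types (chi : 'I_N -> A).
Local Notation zz := (zz R N).
Local Notation ww := (ww R N).
Local Notation cst := (@cst R N).
Local Notation ss := (ss R N).
Local Notation ii := (ii R N).

Lemma mul2I f g : f *+ 2 = g *+ 2 -> f = g.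
Proof.
move=> e; apply: ser_eqP => x; have := congr1 (fun h : A => co h x) e.
by rewrite !coMn => /pmulrnI; apply.
Qed.

Lemma moving_expd y f : moving y -> moving f -> moving (expd y f).
Proof.
move=> my mf; rewrite expdE; apply: supp_osum => l; apply: movingMr.
by case: l => //= l; exact: moving_vder.
Qed.

(** A solution [L] of the normal form equation is the square of a radial factor
    [H], and the scaling of z and w by [H] carries the field into the normal
    form, up to its time. *)
Lemma core_conjugation f0 y t a P chi b L : flt 1 1 f0 -> flt 1 2 y -> moving y ->
  rr P -> rr t -> flt 1 1 (t - 1) -> adE y f0 = zz * (t * (P + ii)) ->
  adm L chi b -> core a P 1 L chi b = 0 ->
  exists y' T, [/\ flt 1 2 y', moving y', rr T & flt 1 1 (T - 1)] /\
    T * adE y' f0 = zz * (unf a chi ss + ii * (1 + b * ss ^+ N)).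
Proof.
move=> hf hy my rP rt ht ex [rL hL rc hc rb] eC; set x := adE y f0 in ex.
have {}hL := flt_al1 hL.
have [H [rH eH hH]] := sqrt_exists rL hL.
have [Hi [rHi eHi _]] := inv_exists (good_rr R N) rH hH.
set q := 1 + b * ss ^+ N; set pp := unf a chi ss.
have rq : rr q by apply: rr_q.
have rpp : rr pp by apply: rr_unf => //; exact: rr_ss.
have [qi [rqi eqi hqi]] := inv_exists (good_rr R N) rq (flt_q hN b).
have [rho erho] : exists rho, rho = pp * qi by exists (pp * qi).
have rrho : rr rho by rewrite erho; exact: rrM.
have hzH : flt 1 2 (zz * H - zz).
  rewrite -{2}[zz]mulr1 -mulrBr -(add1n 1); apply: fltM => //; exact: flt_zz.
have hwH : flt 1 2 (ww * H - ww).
  rewrite -{2}[ww]mulr1 -mulrBr -(add1n 1); apply: fltM => //; exact: flt_ww.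
pose G := Sub (zz * H) (ww * H) (fun i => mu R i).
have f1 : flt 1 1 (zz * H) by apply/fltMl/flt_zz.
have f2 : flt 1 1 (ww * H) by apply/fltMl/flt_ww.
have f3 i : flt 1 1 (@mu R N i) by exact: flt_mu.
have aG : alg G by exact: Sub_alg.
have Gz : G zz = zz * H by exact: Sub_zz.
have Gw : G ww = ww * H by exact: Sub_ww.
have Gm i : G (mu R i) = mu R i by exact: Sub_mu.
clearbody G.
have nG : near G.
  apply: (alg_near aG); [by rewrite Gz|by rewrite Gw|].
  by move=> i; rewrite Gm subrr; exact: flt0.
have sH : star H = H by case: rH.
have sG f : star (G f) = G (star f).
  apply: alg_star => //; first by rewrite Gz Gw starM star_zz sH.
  by move=> i; rewrite Gm star_mu.
have Gs : G ss = ss * L by rewrite -[ss]/(zz * ww) (algM aG) Gz Gw -eH; ring.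
have rG f : rr f -> rr (G f).
  move=> [rf sf]; split; last by rewrite sG sf.
  apply: (alg_rad aG) => // [|i]; last by rewrite Gm; exact: rad_mu.
  by rewrite Gs; apply: radM; [case: (rr_ss R N)|case: rL].
have [th rth eth] : exists2 th, rr th & G th = t.
  by apply: (near_surj aG nG (@closed_rr R N 1)) => //; exact: rrB.
have hth : flt 1 1 (th - 1).
  have -> : th - 1 = (t - 1) - (G th - th) by rewrite eth; ring.
  by apply: fltB => //; exact: (nG 0%N _ (flt_0 _ _)).
have [thi [rthi ethi hthi]] := inv_exists (good_rr R N) rth hth.
have Gpar f : par f -> G f = f by apply: alg_fix_par.
have Gp : G pp = unf a chi (ss * L).
  by rewrite /pp alg_unf ?Gs // => i; apply: Gpar; case: (rc i).
have Gq : G q = 1 + b * (ss * L) ^+ N.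
  rewrite (operD aG) (alg1 aG) (algM aG) (algX _ _ aG) Gs (Gpar b) //; by case: rb.
have Grho : G rho * G q = G pp by rewrite -(algM aG) erho -mulrA (mulrC qi) eqi mulr1.
have GqU : G q * G qi = 1 by rewrite -(algM aG) eqi (alg1 aG).
have eP : P * (H + Eu H) = H * G rho.
  apply: (unit_inj GqU); apply: (unit_inj eHi).
  have e2 : (H * (G q * (P * (H + Eu H)))) *+ 2 = (H * (G q * (H * G rho))) *+ 2.
    have -> : H * (G q * (H * G rho)) = L * G pp * 1.
      by rewrite -Grho -eH; ring.
    move/eqP: eC; rewrite /core -Gp -Gq subr_eq0 => /eqP ->.
    by rewrite -eH EuM; ring.
  exact: mul2I e2.
set rx := t * (P + ii) in ex.
have erx : rx = t * P + ii * t by rewrite /rx; ring.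
set x3 := zz * (th * (rho + ii)).
have ex3 : x3 = zz * (th * rho + ii * th) by rewrite /x3; ring.
have dx g : vder (fld x) (G g) = G (vder (fld x3) g).
  have fx : flt 1 1 x by rewrite ex; apply/fltMl/flt_zz.
  have fx3 : flt 1 1 x3 by apply/fltMl/flt_zz.
  have d1 := der_compr aG (vder_der (vflt_fld fx)).
  have d2 := der_compl aG (vder_der (vflt_fld fx3)).
  have ezz : vder (fld x) (G zz) = G (vder (fld x3) zz).
    rewrite vder_zz Gz ex erx vder_equi_zz //; [|exact: rrM|by case: rH].
    rewrite /fst /= ex3 (algM aG) Gz (operD aG) !(algM aG) eth (alg_cst _ aG) -/ii.
    have gen (z h e p r i u : A) : p * (h + e) = h * r ->
        z * ((u * p + i * u) * h + u * p * e) = z * h * (u * r + i * u).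
      move=> e0; have -> : (u * p + i * u) * h + u * p * e = u * (p * (h + e)) + i * u * h by ring.
      by rewrite e0; ring.
    exact: gen.
  apply: (der_ext aG d1 d2) => //=.
    by rewrite -star_zz -!(sG, star_vder) ezz !(sG, star_vder).
  by move=> i; rewrite Gm !vder_mu (oper0 aG).
have aE := alg_comp (expd_alg hy) aG.
have [y' [hy' my' ey']] : exists y', [/\ flt 1 2 y', moving y' & expd y' zz = expd y (G zz)].
  apply: expd_surj.
    have -> : expd y (G zz) - zz = (expd y (G zz) - G zz) + (zz * H - zz) by rewrite Gz; ring.
    by apply: fltD => //; apply: (expd_near hy (p := 1)); rewrite Gz.
  by apply: moving_expd => //; rewrite Gz; apply/movingMl/moving_zz.
have eE g : expd y' g = expd y (G g).
  apply: (alg_ext (expd_alg hy') aE) => //=.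
    by rewrite -star_zz -sG -!star_expd ey'.
  by move=> i; rewrite Gm !expd_mu.
have ex' : adE y' f0 = x3.
  rewrite -[LHS](vder_zz (fld _)) -[RHS](vder_zz (fld _)).
  apply: (near_inj (expd_alg hy') (expd_near hy')).
  by rewrite adE_conj // !eE -adE_conj // -/x dx.
exists y', (q * thi); split.
  split=> //; first exact: rrM.
  by apply: flt1M => //; exact: flt_q.
rewrite ex' /x3 erho.
have gen (z u u' p k k' i : A) : u * u' = 1 -> k * k' = 1 ->
    k * u' * (z * (u * (p * k' + i))) = z * (p + i * k).
  move=> e1 e2; have -> : k * u' * (z * (u * (p * k' + i))) = z * (u * u') * (p * (k * k') + i * k) by ring.
  by rewrite e1 e2 !mulr1.
exact: gen.
Qed.

Lemma flt_P_lead a P : rr P -> (forall k, (k < N)%N -> co P (k, k, 0%MM) = 0) ->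
  co P (N, N, 0%MM) = a%:C%C -> flt al al (P - cst a%:C%C * ss ^+ N).
Proof.
move=> rP h0 hN'; have rQ : rr (P - cst a%:C%C * ss ^+ N).
  by apply: rrB => //; apply: rrM; [exact: rr_cst|apply/rrX/rr_ss].
split=> -[[j k] n]; rewrite /wt /= => hn.
case: (j =P k) => [e|/eqP hj]; last by rewrite (rad_co _ (proj1 rQ) hj).
rewrite -{k}e in hn *; have /eqP : mdeg n = 0%N.
  by case: (posnP (mdeg n)) => // h; have := leq_mul (leqnn al) h; lia.
rewrite mdeg_eq0 => /eqP ->; rewrite coB coZ ssE co_mono !xpair_eqE !eqxx !andbT andbb.
case: eqP => [->|hj]; first by rewrite mulr1 hN' subrr.
by rewrite mulr0 subr0 h0 //; move: hn hj; lia.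
Qed.

Lemma first_level_reduces f y T Phi P : flt 1 1 f -> flt 1 2 y -> moving y -> rr T ->
  flt 1 1 (T - 1) -> psub Phi -> (forall i, flt 1 2 (Phi (mu R i) - mu R i)) ->
  rr P -> Phi (T * adE y f) = zz * (P + ii) ->
  (forall k, (k < N)%N -> co P (k, k, 0%MM) = 0) -> co P (N, N, 0%MM) != 0 ->
  \matrix_(k < N, j < N) complex.Re (co P (k : nat, k : nat, U_(j)%MM)) \in unitmx ->
  exists a beta, a != 0 /\ reduces_to al (fld f) (infinite_level_form 1 a beta).
Proof.
move=> hf hy my rT hT pPhi nPhi rP e h0 hN0 uM.
have [Psi [pPsi _ K nPsi]] := psub_inv pPhi nPhi.
have nPs := psub_near pPsi nPsi.
have rQ : rr (Psi P) by exact: psub_rr.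
have Q0 k : co (Psi P) (k, k, 0%MM) = co P (k, k, 0%MM) by case: (psub_linear k pPsi nPs rP).
have Q1 k j : (k < N)%N -> co (Psi P) (k, k, U_(j)%MM) = co P (k, k, U_(j)%MM).
  by move=> hk; case: (psub_linear k pPsi nPs rP) => _ /(_ (h0 k hk)).
pose a := complex.Re (co P (N, N, 0%MM)).
have ea : co P (N, N, 0%MM) = a%:C%C by rewrite (rr_real N _ (proj2 rP)).
have a0 : a != 0 by apply: contra hN0 => /eqP h; rewrite ea h rmorph0.
have Q0' k : (k < N)%N -> co (Psi P) (k, k, 0%MM) = 0 by move=> hk; rewrite Q0 h0.
have hQ : flt al al (Psi P - cst a%:C%C * ss ^+ N).
  by apply: flt_P_lead => //; rewrite Q0.
have h1 : flt al 1 (1 - 1 : A) by rewrite subrr; exact: flt0.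
have [L [chi [b [hadm _ eC]]]] := core_exists hN hQ h1 a0 rQ (rr1 R N).
have [t [rt et ht]] := inv_exists (good_rr R N) rT hT.
have ex : adE y f = zz * (t * (Psi P + ii)).
  have : T * adE y f = zz * (Psi P + ii).
    rewrite -(K (T * adE y f)) e (algM pPsi) (psub_zz pPsi) (operD pPsi).
    by rewrite (alg_cst _ pPsi).
  move=> e1; rewrite mulrCA -e1 mulrA (mulrC t) et mul1r //.
have [y' [T' [[hy' my' rT' hT'] eT]]] := core_conjugation hf hy my rQ rt ht ex hadm eC.
have uX : \matrix_(i < N, j < N) complex.Re (co (chi i) (0%N, 0%N, U_(j)%MM)) \in unitmx.
  apply: (core_linear rQ Q0' hadm eC); congr (_ \in unitmx): uM.
  by apply/matrixP => k j; rewrite !mxE Q1.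
have hc i : flt 1 1 (chi i).
  by apply: flt_al1; apply: (flt_le (admc1 hadm i)); rewrite addn1.
have [beta hb] := normal_reduces hy' my' rT' hT' (admc hadm) hc (admb hadm) uX eT.
by exists a, beta.
Qed.

Lemma iter_bracket_fld l y f : exists g, iter l (bracket (fld y)) (fld f) = fld g /\
  (moving y -> moving f -> moving g).
Proof.
elim: l => [|l [g [IH hg]]]; first by exists f.
exists (bracket (fld y) (fld g)).1; split; first by rewrite iterS IH bracket_fld.
by move=> my mf; rewrite bracket1; apply: suppB; apply: moving_vder => //; exact: hg.
Qed.

Lemma moving_adE y f : moving y -> moving f -> moving (adE y f).
Proof.
move=> my mf; rewrite /adE exp_ad1; apply: supp_osum => l; apply: movingMr.
by have [g [-> hg]] := iter_bracket_fld l y f; exact: hg.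
Qed.

Lemma near_adE y f : flt 1 2 y -> flt 1 1 f -> flt 1 2 (adE y f - f).
Proof.
move=> hy hf; rewrite /adE exp_ad1; set F := fun l => _.
have hF l : flt 1 l.+1 (F l).
  apply: fltMr.
  by case: (vflt_iter_bracket l (vflt_fld hy) (vflt_fld hf)).
have sF : smb F by move=> l; apply: (flt_le (hF l)).
have -> : osum F - f = (osum F - \sum_(l < 2) F l) + F 1.
  by rewrite !big_ord_recl big_ord0 /F ifac0 /=; ring.
by apply: fltD; [exact: flt_osum|exact: hF].
Qed.

End Conjugation.

(** * The infinite level normal form *)

Theorem theorem5p3 (R : realType) (N0 : nat) (hN0 : (1 <= N0)%N)
    (e : nat -> monomial N0) (he : formal_basis_style (2 * N0 + 1) e)
    (a0 b0 : nat -> nat -> 'X_{1..N0} -> R) (v0 : vfield R N0)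
    (hv0 : v0 = Ymon 1 0 0%MM + higher_series a0 b0)
    (vt : nat -> vfield R N0)
    (hvt : extended_partial_normal_forms (2 * N0 + 1) e v0 vt)
    (hdim : parametric_dimension vt N0)
    (hgen : parametric_generic vt N0) :
  exists (sigma : 'S_N0) (a : R) (b : 'X_{1..N0} -> R),
    reduces_to (2 * N0 + 1) v0 (infinite_level_form sigma a b) /\
    forall (a' : R) (b' : 'X_{1..N0} -> R),
      reduces_to (2 * N0 + 1) v0 (infinite_level_form sigma a' b') ->
      a' = a /\ b' = b.
Proof.
have hal : (1 <= 2 * N0 + 1)%N by rewrite addn1.
have [eh mg hg] := higher_fld hal a0 b0; set g : ser R N0 := (higher_series a0 b0).1 in eh mg hg.
pose f0 : ser R N0 := ii R N0 * zz R N0 + g.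
have ef : v0 = fld f0 by rewrite hv0 eh Ymon_fld fldD.
have hg1 := flt_al_1 hal mg hg.
have hf0 : flt 1 1 f0.
  by apply: fltD; [apply/fltMr/flt_zz|apply: (flt_le hg1)].
have mf0 : moving f0 by apply: suppD => //; apply/movingMr/moving_zz.
have [evt /(_ 1%N isT)[[yP [yT [yS [hA ew]]]] hw]] := hvt.
move: ew hw; rewrite evt ef => ew hw.
have [y [T [Phi [[hy my rT hT] [pPhi nPhi e1]]]]] := transform_data hal f0 hA.
move: ew; rewrite e1 => {e1} ew; set u := Phi (T * adE y f0) in ew.
have mu : moving u.
  apply: (alg_moving pPhi); [rewrite psub_zz //; exact: moving_zz|
    rewrite psub_ww //; exact: moving_ww|].
  by apply: movingMr; exact: moving_adE.
have hu : flt 1 2 (u - ii R N0 * zz R N0).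
  have nx : flt 1 2 (adE y f0 - f0) by exact: near_adE.
  have hx : flt 1 1 (adE y f0).
    by rewrite -[adE y f0](subrK f0); apply: fltD => //; apply: (flt_le nx).
  have gen (p t x f z h : ser R N0) : f = z + h ->
      p - z = (p - t * x) + ((t - 1) * x + ((x - f) + h)) by move=> ->; ring.
  rewrite (gen u T (adE y f0) f0 _ g) //; apply: fltD.
    by apply: (psub_near pPhi nPhi); apply: fltMr.
  by apply: fltD; [apply: (fltM hT hx)|apply: fltD].
have euw : (vt 1%N).1 = u :> ser R N0 by rewrite ew.
(* At the first level the field is equivariant, with angular speed one. *)
have [P rP eP] : exists2 P, rr P & (vt 1%N).1 = zz R N0 * (P + ii R N0) :> ser R N0.
  by apply: (first_form hal he (erefl f0) mg hg hw) => //; rewrite euw.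
have cP i n : X_coef (vt 1%N) i.+1 i n = complex.Re (co P (i, i, n)).
  rewrite /X_coef -[(vt 1%N).1 i.+1 i n]/(co ((vt 1%N).1 : ser R N0) (i.+1, i, n)) eP -ixadd_z.
  rewrite (coM_mono (1%N, 0%N, 0%MM)) coD co_cst; case: (_ == _); rewrite ?mulr0 ?mulr1 ?addr0 //=.
  by case: (co P _) => ? ? /=; rewrite addr0.
have [hd0 hdN] := hdim 1%N isT.
have h0 k : (k < N0)%N -> co P (k, k, 0%MM) = 0.
  by move=> hk; rewrite -[LHS](rr_real k _ (proj2 rP)) -[complex.Re _]cP hd0 // rmorph0.
have hN' : co P (N0, N0, 0%MM) != 0 by apply/eqP => h; apply: hdN; rewrite cP h.
have uM : \matrix_(k < N0, j < N0) complex.Re (co P (k : nat, k : nat, U_(j)%MM)) \in unitmx.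
  rewrite -row_free_unit /row_free; apply/eqP; rewrite -[RHS]hgen; congr (\rank _).
  by apply/matrixP => k j; rewrite !mxE cP.
have eu : Phi (T * adE y f0) = zz R N0 * (P + ii R N0) by rewrite -eP euw.
have [a [beta [ha hr]]] :=
  first_level_reduces hN0 hf0 hy my rT hT pPhi nPhi rP eu h0 hN' uM.
exists 1%g, a, beta; split=> // a' b' hr'.
exact: (reduction_unique hN0 hf0 ha hr hr').
Qed.
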